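(* Let $I_f\approx0.3137$ and $I_g\approx 0.3186$ be the constants defined in the context. The tests $\{\delta_I(c)\}$ defined in the context are asymptotically Bayes, i.e. $$\lim_{c\to0}\frac{\mathcal{R}_c(\delta_B^*(c))}{\mathcal{R}_c(\delta_I(c))}=1,$$ where $\delta_B^*(c)$ denotes a Bayes solution, i.e. a decentralized sequential test minimizing $\mathcal{R}_c(\delta)$ over all decentralized sequential tests $\delta$. Moreover, as $c\to0$, for both $\delta=\delta_I(c)$ and $\delta=\delta_B^*(c)$, $$\mathcal{R}_c(\delta)=c|\log c|\,(1+o(1))\Big[\frac{\pi_f}{I_f}+\frac{\pi_{g_1}+\pi_{g_2}}{I_g}\Big].$$
   Context: **Model.** $X_1,X_2,\dots$ are i.i.d. $N(\mu,1)$, and one tests $H_0:\mu=0$ versus $H_1:\mu=\pm1$. Let $f,g_1,g_2$ denote the densities of $N(0,1)$, $N(-1,1)$, $N(1,1)$. $\mathbf{P}_f,\mathbf{P}_{g_1},\mathbf{P}_{g_2}$ (with expectations $\mathbf{E}_f,\mathbf{E}_{g_1},\mathbf{E}_{g_2}$) are the probability measures when $\mu=0,-1,1$ respectively. $I(A)$ is the indicator of the event $A$; $\log$ is the natural logarithm. **Decentralized sequential test.** It consists of: quantizers $\phi_n$ and feedback functions $\psi_n$ producing binary messages $U_n=\phi_n(X_n;V_{n-1})\in\{0,1\}$, where the feedback $V_{n-1}=\psi_n(U_1,\dots,U_{n-1})$ depends only on past messages (no restriction on the range of $V_{n-1}$); a stopping time $N$ at the fusion center, based on the messages $U_1,U_2,\dots$;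 and a decision $d\in\{0,1\}$ (for $H_0$, $H_1$) based on the information received by the fusion center up to time $N$. **Bayes risk.** Fix a prior $\pi=(\pi_f,\pi_{g_1},\pi_{g_2})$ with positive entries summing to $1$, and positive costs of incorrect decisions $W_f,W_{g_1},W_{g_2}$. With $c>0$ the cost per sample, the Bayes risk of a decentralized sequential test $\delta$ is $$\mathcal{R}_c(\delta)=\pi_f[c\,\mathbf{E}_f(N)+W_f\mathbf{P}_f\{d=1\}]+\sum_{i=1}^2\pi_{g_i}[c\,\mathbf{E}_{g_i}(N)+W_{g_i}\mathbf{P}_{g_i}\{d=0\}].$$ **Constants.** For $\lambda\in\mathbb{R}$ and $\varphi\in\{f,g_1,g_2\}$ let $p_\lambda(\varphi)=\mathbf{P}_\varphi(X_1\ge\lambda)$, and for $p,q\in(0,1)$ let $\mathrm{kl}(p,q)=p\log\frac pq+(1-p)\log\frac{1-p}{1-q}$. Put $$I_f=\mathrm{kl}(p_0(f),p_0(g_1))=\mathrm{kl}(p_0(f),p_0(g_2))\approx 0.3137,\qquad I_g=\sup_{\lambda\in\mathbb{R}}\mathrm{kl}(p_\lambda(g_2),p_\lambda(f))\approx0.3186,$$ and let $\lambda^*\approx 0.7941$ be the value of $\lambda$ attaining the supremum defining $I_g$. **The test $\delta_I(c)$.** Let $u(c)\in(0,1/2)$ satisfy $u(c)\to0$ and $\log u(c)/\log c\to0$ as $c\to0$. Let $(\pi_{f,n},\pi_{g_1,n},\pi_{g_2,n})$ be the posterior distribution of the three densities given $U_1,\dots,U_n$, starting from $\pi$ and updated recursively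 by Bayes' rule: for $j\in\{f,g_1,g_2\}$, upon observing $U_n=u$, $$\pi_{j,n}=\frac{\pi_{j,n-1}\mathbf{P}_j(U_n=u)}{\sum_{i\in\{f,g_1,g_2\}}\pi_{i,n-1}\mathbf{P}_i(U_n=u)},$$ where the probabilities are those induced by the quantizer used at time $n$. *First stage:* the sensor uses $U_n=I(X_n\ge0)$. The stage stops at $N_1=\min\{n\ge1:\max\{\pi_{f,n},\pi_{g_1,n},\pi_{g_2,n}\}\ge1-u(c)\}$, and the fusion center makes a preliminary decision $d^0\in\{f,g_1,g_2\}$ with $\pi_{d^0,N_1}=\max\{\pi_{f,N_1},\pi_{g_1,N_1},\pi_{g_2,N_1}\}$. *Second stage:* $d^0$ is sent to the sensor as a one-shot feedback, and for all $n>N_1$ the sensor uses $U_n=\phi^*_{d^0}(X_n)$, where $\phi_f^*(X)=I(X\ge0)$, $\phi_{g_1}^*(X)=I(X\ge-\lambda^* )$, $\phi_{g_2}^*(X)=I(X\ge\lambda^* )$. The posterior continues to be updated, and the test stops at $$N=\min\Big\{n\ge N_1:\ \frac{\pi_{f,n}W_f}{\pi_{g_1,n}W_{g_1}+\pi_{g_2,n}W_{g_2}}\notin(c,1/c)\Big\},$$ with $d=0$ if the ratio is $\ge 1/c$ and $d=1$ if it is $\le c$. *)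

(* Defs.v *)
(* MathComp / MathComp-Analysis *)
From HB Require Import structures.
From mathcomp Require Import all_boot all_order all_algebra.
From mathcomp Require Import all_classical all_reals all_analysis.
From mathcomp Require Import measurable_realfun.
Import Order.TTheory GRing.Theory Num.Theory.
Import numFieldNormedType.Exports.

Set Implicit Arguments.
Unset Strict Implicit.
Unset Printing Implicit Defensive.

Local Open Scope classical_set_scope.
Local Open Scope ring_scope.

Inductive hyp := Hf | Hg1 | Hg2.

Definition hyp_to_ord (j : hyp) : 'I_3 :=
  match j with Hf => inord 0 | Hg1 => inord 1 | Hg2 => inord 2 end.

Definition ord_to_hyp (i : 'I_3) : hyp :=
  match val i with 0%N => Hf | 1%N => Hg1 | _ => Hg2 end.

Lemma hyp_to_ordK : cancel hyp_to_ord ord_to_hyp.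
Proof. by case; rewrite /ord_to_hyp /= inordK. Qed.

HB.instance Definition _ := Finite.copy hyp (can_type hyp_to_ordK).

Definition mean {R : realType} (j : hyp) : R :=
  match j with Hf => 0 | Hg1 => -1 | Hg2 => 1 end.

(** * The observations *)

Definition mutually_independent {R : realType} d (T : measurableType d)
    (P : probability T R) (X : nat -> {mfun T >-> R}) : Prop :=
  forall (s : seq nat) (A : nat -> set R), uniq s ->
    (forall i, measurable (A i)) ->
    P (\bigcap_(i in [set` s]) (X i @^-1` A i)) =
    (\prod_(i <- s) P (X i @^-1` A i))%E.

Definition iid_normal {R : realType} d (T : measurableType d)
    (P : probability T R) (X : nat -> {mfun T >-> R}) (m : R) : Prop :=
  mutually_independent P X /\
  forall n (A : set R), measurable A -> P (X n @^-1` A) = normal_prob m 1 A.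

(** * Decentralized sequential tests *)

(** Indices are shifted by one: [X n] is the observation at time [n.+1].
    [quantizer n v] is used at time [n.+1] when the feedback is
    [v = feedback n [:: U_1; ..; U_n]]; only sequences of size [n] matter there.
    [stop] maps a whole message sequence to the value of the stopping time
    ([None] for infinity); [stop_adapted] says that the event that it equals [n]
    depends on the first [n] messages only. [decide] is evaluated at the messages
    received up to the stopping time; [true] stands for [d = 1]. *)
Record dtest (R : realType) := DTest {
  feedback_range : nat -> Type;
  feedback : forall n, seq bool -> feedback_range n;
  quantizer : forall n, feedback_range n -> R -> bool;
  quantizer_measurable : forall n (v : feedback_range n),
    measurable_fun [set: R] (quantizer v);
  stop : (nat -> bool) -> option nat;
  stop_adapted : forall (U U' : nat -> bool) n,
    (forall k, (k < n)%N -> U k = U' k) -> stop U = Some n -> stop U' = Some n;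
  decide : seq bool -> bool
}.

Fixpoint messages_upto {R : realType} (delta : dtest R) (x : nat -> R) (n : nat)
    : seq bool :=
  if n is n'.+1 then
    let s := messages_upto delta x n' in
    rcons s (quantizer (feedback delta n' s) (x n'))
  else [::].

Definition messages {R : realType} (delta : dtest R) (x : nat -> R) (n : nat)
    : bool :=
  quantizer (feedback delta n (messages_upto delta x n)) (x n).

Section Risk.
Context {R : realType} d (T : measurableType d).
Variables (P : hyp -> probability T R) (X : nat -> {mfun T >-> R}).

Definition sample_size (delta : dtest R) (t : T) : \bar R :=
  if stop delta (messages delta (X ^~ t)) is Some n then n%:R%:E else +oo%E.

Definition decision_event (delta : dtest R) (b : bool) : set T :=
  [set t | exists2 n, stop delta (messages delta (X ^~ t)) = Some n &
                      decide delta (messages_upto delta (X ^~ t) n) = b].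

Definition risk (prior W : hyp -> R) (c : R) (delta : dtest R) : \bar R :=
  let EN j := (\int[P j]_t sample_size delta t)%E in
  ((prior Hf)%:E * (c%:E * EN Hf + (W Hf)%:E * P Hf (decision_event delta true))
   + (prior Hg1)%:E *
       (c%:E * EN Hg1 + (W Hg1)%:E * P Hg1 (decision_event delta false))
   + (prior Hg2)%:E *
       (c%:E * EN Hg2 + (W Hg2)%:E * P Hg2 (decision_event delta false)))%E.

Definition bayes_solution (prior W : hyp -> R) (c : R) (delta : dtest R) : Prop :=
  forall delta' : dtest R,
    (risk prior W c delta <= risk prior W c delta')%E.

End Risk.

(** * Constants *)

Section Constants.
Context {R : realType}.

Definition ptail (lambda : R) (j : hyp) : R :=
  fine (normal_prob (mean j) 1 [set x : R | lambda <= x]).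

Definition kl (p q : R) : R :=
  p * ln (p / q) + (1 - p) * ln ((1 - p) / (1 - q)).

Definition I_f : R := kl (ptail 0 Hf) (ptail 0 Hg1).

Definition kl_g (lambda : R) : R := kl (ptail lambda Hg2) (ptail lambda Hf).

Definition I_g : R := sup (range kl_g).

End Constants.

(** * The two-stage test *)

Section TwoStage.
Context {R : realType}.
Variables (prior W : hyp -> R) (lambda : R).

Definition message_prob (phi : R -> bool) (j : hyp) (b : bool) : R :=
  fine (normal_prob (mean j) 1 [set x : R | phi x = b]).

Definition bayes_update (phi : R -> bool) (post : hyp -> R) (b : bool) (j : hyp)
    : R :=
  post j * message_prob phi j b / \sum_(i : hyp) post i * message_prob phi i b.

(** [None] during the first stage, [Some d0] during the second one. This is also
    the information fed back to the sensor. *)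
Definition stage := option hyp.

Definition stage_threshold (s : stage) : R :=
  match s with
  | None | Some Hf => 0
  | Some Hg1 => - lambda
  | Some Hg2 => lambda
  end.

Definition stage_quantizer (s : stage) (x : R) : bool := stage_threshold s <= x.

Lemma stage_quantizer_measurable (s : stage) :
  measurable_fun [set: R] (stage_quantizer s).
Proof.
by apply: measurable_fun_ler => //; exact: measurable_cst.
Qed.

Definition max_post (post : hyp -> R) : R :=
  Num.max (post Hf) (Num.max (post Hg1) (post Hg2)).

(** One message: update the posterior with the quantizer in use, then test for
    the end of the first stage. The test is not run on the prior, so that
    [N_1 >= 1]. For [u < 1/2] the maximizing hypothesis is unique when the first
    stage ends. *)
Definition two_stage_step (u : R) (st : (hyp -> R) * stage) (b : bool)
    : (hyp -> R) * stage :=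
  let post := bayes_update (stage_quantizer st.2) st.1 b in
  (post,
   if st.2 is Some d0 then Some d0
   else if 1 - u <= max_post post
        then Some [arg max_(j > Hf) post j]%O
        else None).

Definition two_stage_state (u : R) (s : seq bool) : (hyp -> R) * stage :=
  foldl (two_stage_step u) (prior, None) s.

Definition post_ratio (post : hyp -> R) : R :=
  (post Hf * W Hf) / (post Hg1 * W Hg1 + post Hg2 * W Hg2).

Definition two_stage_stops (u c : R) (s : seq bool) : bool :=
  ((two_stage_state u s).2 != None) &&
  (post_ratio (two_stage_state u s).1 \notin `]c, c^-1[).

End TwoStage.

Definition first_time (b : pred (seq bool)) (U : nat -> bool) : option nat :=
  if pselect (exists n, b (mkseq U n)) is left h then Some (ex_minn h) else None.

Lemma first_time_adapted (b : pred (seq bool)) (U U' : nat -> bool) n :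
  (forall k, (k < n)%N -> U k = U' k) ->
  first_time b U = Some n -> first_time b U' = Some n.
Proof.
move=> UU'.
have E m : (m <= n)%N -> mkseq U m = mkseq U' m.
  move=> mn; apply/eq_in_map => k; rewrite mem_iota => /andP[_ km].
  by apply: UU'; exact: leq_trans km mn.
rewrite /first_time; case: pselect => // h; case: ex_minnP => m bm mmin [mn].
rewrite {m}mn in bm mmin.
case: pselect => [h'|]; last by case; exists n; rewrite -E.
case: ex_minnP => m bm' mmin'; congr Some; apply/eqP; rewrite eqn_leq.
have mn : (m <= n)%N by apply: mmin'; rewrite -E.
by rewrite mn /=; apply: mmin; rewrite E.
Qed.

Definition delta_I {R : realType} (prior W : hyp -> R) (lambda u c : R) : dtest R :=
  @DTest R (fun=> stage)
    (fun _ s => (two_stage_state prior lambda u s).2)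
    (fun _ => stage_quantizer lambda)
    (fun _ => @stage_quantizer_measurable R lambda)
    (first_time (two_stage_stops prior W lambda u c))
    (@first_time_adapted (two_stage_stops prior W lambda u c))
    (fun s => post_ratio W (two_stage_state prior lambda u s).1 <= c).

Definition risk_expansion {R : realType} (r : R -> \bar R) (K : R) : Prop :=
  exists2 o : R -> R, o c @[c --> 0^'+] --> 0 &
    \forall c \near 0^'+, r c = (c * `|ln c| * (1 + o c) * K)%:E.

(* Main.v *)
Require Import Defs.
From HB Require Import structures.
From mathcomp Require Import all_boot all_order all_algebra.
From mathcomp Require Import ring lra.
From mathcomp Require Import all_classical all_reals all_analysis.
From mathcomp Require Import measurable_realfun.
Import Order.TTheory GRing.Theory Num.Theory.
Import numFieldNormedType.Exports.
Set Implicit Arguments.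
Unset Strict Implicit.
Unset Printing Implicit Defensive.
Local Open Scope classical_set_scope.
Local Open Scope ring_scope.

(** The messages form a binary tree, and stopping times and decisions are bounded
    by backward induction on it.

    Lower bound. A test of risk [O(c |log c|)] has error probabilities
    [O(c |log c|)], so Wald's information inequality forces the information
    collected under each hypothesis, against each opposite one, to be at least
    [|log c| (1 + o(1))]. Under [g_i] a message carries at most [I_g] by the
    Neyman-Pearson lemma. Under [f] one quantizer has to serve against [g_1] and
    [g_2] at once, and the sum of its two informations is at most [2 I_f]: whatever
    the past, the sign of the observation is the best compromise, so feedback does
    not help.

    Upper bound. For a small exponent [theta], a sum of [theta]-th powers of posterior
    odds decreases geometrically, at a rate close to the information of the quantizer
    in use. Its logarithm is a supersolution for the remaining sample size. The first
    stage costs [O(|log u|) = o(|log c|)], a wrong preliminary decision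
    has probability [O(u)] and costs [O(|log c|)], and otherwise the second stage runs
    at the optimal rate. The error probabilities are [O(c)] because
    weighted posterior odds are martingales. *)

(** * Kullback-Leibler numbers of Bernoulli laws *)

(** The delicate point is the bound [2 I_f], which must hold for every measurable message set, not
    only for half-lines. Two facts are used about the probabilities [p], [q_1], [q_2] of such a set
    under [f], [g_1], [g_2]: with [p = Phi z], both [q_i] lie between [Phi (z - 1)] and
    [Phi (z + 1)] (Neyman-Pearson), and [p^2 <= e q_1 q_2] (Cauchy-Schwarz). If the [q_i] lie on
    opposite sides of [p], both informations are largest at one and the same half-line, and what
    remains is an inequality on [Phi], tight at [z = 0]. If they lie on the same side, they cannot
    both be extreme; the margin left is narrow, hence the numerical bounds on [pi], [e] and [Phi 1].

    On the tree every statement concerns [m] further messages and is proved by induction on [m] with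
    a bound free of [m]; measure theory enters only when [m] goes to infinity.

    Under [f] the odds of both alternatives have to become small. A power sum is a smooth maximum of
    the two, with an overshoot bounded by a constant for fixed [theta], and its drift is governed by
    the smaller of the two informations. *)

Section kullback_leibler.
Context {R : realType}.
Implicit Types p q x y : R.

Lemma ln_le_sub1 x : 0 < x -> ln x <= x - 1.
Proof.
by move=> x0; rewrite -{1}[x](subrKC 1); apply: le_ln1Dx; lra.
Qed.

Lemma ln_ge_subV x : 0 < x -> 1 - x^-1 <= ln x.
Proof.
move=> x0; have := @ln_le_sub1 x^-1; rewrite invr_gt0 => /(_ x0).
by rewrite lnV ?posrE//; lra.
Qed.

Lemma klE p q : 0 < p < 1 -> 0 < q < 1 ->
  kl p q = p * (ln p - ln q) + (1 - p) * (ln (1 - p) - ln (1 - q)).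
Proof. by move=> p01 q01; rewrite /kl !ln_div// posrE; lra. Qed.

Lemma klC p q : kl (1 - p) (1 - q) = kl p q.
Proof. by rewrite /kl !subKr addrC. Qed.

Lemma klxx p : 0 < p < 1 -> kl p p = 0.
Proof. by move=> p01; rewrite klE// !subrr; lra. Qed.

Lemma kl_gt0 p q : 0 < p < 1 -> 0 < q < 1 -> p != q -> 0 < kl p q.
Proof.
move=> p01 q01 pq; rewrite klE//.
have lt1 x y : 0 < x -> 0 < y -> x != y -> ln y - ln x < y / x - 1.
  move=> x0 y0 xy; rewrite -ln_div ?posrE//.
  have yx0 : 0 < y / x by rewrite divr_gt0.
  have h : ln (y / x) != 0.
    rewrite ln_eq0//; apply: contra xy => /eqP yx1.
    by rewrite -[eqbRHS](divfK (lt0r_neq0 x0)) yx1 mul1r.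
  have := expR_gt1Dx h; rewrite lnK ?posrE//; lra.
have h1 := lt1 p q ltac:(lra) ltac:(lra) pq.
have pq' : 1 - p != 1 - q by apply: contra pq => /eqP ?; apply/eqP; lra.
have h2 := lt1 (1 - p) (1 - q) ltac:(lra) ltac:(lra) pq'.
have : p * (ln q - ln p) < p * (q / p - 1) by rewrite ltr_pM2l//; lra.
have : (1 - p) * (ln (1 - q) - ln (1 - p)) < (1 - p) * ((1 - q) / (1 - p) - 1).
  by rewrite ltr_pM2l//; lra.
rewrite !mulrBr ![_ * (_ / _)]mulrC !divfK; [lra|lra|lra].
Qed.

Lemma kl_ge0 p q : 0 < p < 1 -> 0 < q < 1 -> 0 <= kl p q.
Proof.
move=> p01 q01; have [->|pq] := eqVneq p q; first by rewrite klxx.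
exact/ltW/kl_gt0.
Qed.

Lemma kl_anti_r p q q' : 0 < q -> q <= q' -> q' <= p -> p < 1 ->
  kl p q' <= kl p q.
Proof.
move=> q0 qq' q'p p1; rewrite !klE; try lra.
have h1 := @ln_ge_subV (q' / q) ltac:(by apply: divr_gt0; lra).
have h2 := @ln_ge_subV ((1 - q') / (1 - q)) ltac:(by apply: divr_gt0; lra).
rewrite !ln_div ?posrE in h1 h2; try lra.
rewrite !invf_div in h1 h2.
have k1 : p * (1 - q / q') <= p * (ln q' - ln q) by rewrite ler_wpM2l//; lra.
have k2 : (1 - p) * (1 - (1 - q) / (1 - q')) <=
    (1 - p) * (ln (1 - q') - ln (1 - q)) by rewrite ler_wpM2l//; lra.
suff : 0 <= p * (1 - q / q') + (1 - p) * (1 - (1 - q) / (1 - q')) by lra.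
have -> : p * (1 - q / q') + (1 - p) * (1 - (1 - q) / (1 - q')) =
    (q' - q) * (p - q') / (q' * (1 - q')) by field; apply/andP; split; lra.
by rewrite divr_ge0// mulr_ge0//; lra.
Qed.

Lemma kl_mono_r p q q' : 0 < p -> p <= q -> q <= q' -> q' < 1 ->
  kl p q <= kl p q'.
Proof.
move=> p0 pq qq' q'1; rewrite -(klC p q) -(klC p q').
by apply: kl_anti_r; lra.
Qed.

(** The difference of the two sides is [kl p' p] plus [p' - p] times the difference of the log odds
    of [p] and [q]. *)
Lemma kl_mono_l p p' q : 0 < q -> q <= p -> p <= p' -> p' < 1 ->
  kl p q <= kl p' q.
Proof.
move=> q0 qp pp' p'1.
have := @kl_ge0 p' p ltac:(lra) ltac:(lra).
rewrite !klE; try lra.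
have : ln q <= ln p by rewrite ler_ln ?posrE; lra.
have : ln (1 - p) <= ln (1 - q) by rewrite ler_ln ?posrE; lra.
nra.
Qed.

(** The terms in [ln q1] and [ln q2] add up exactly; the complementary terms lose the factor hidden
    in [(p - q1) (p - q2) / p >= 0]. The two informations are thus merged into one that depends on
    the product [q1 * q2], the quantity that Cauchy-Schwarz controls. *)
Lemma kl_same_side p q1 q2 : 0 < p < 1 -> 0 < q1 <= p -> 0 < q2 <= p ->
  kl p q1 + kl p q2 <= kl p (q1 * q2 / p).
Proof.
move=> p01 h1 h2.
have y0 : 0 < q1 * q2 / p by rewrite divr_gt0 ?mulr_gt0//; lra.
have yp : q1 * q2 / p <= p by rewrite ler_pdivrMr; nra.
rewrite !klE; try lra.
rewrite ln_div ?posrE ?mulr_gt0//; try lra.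
rewrite lnM ?posrE; try lra.
have : ln (1 - p) + ln (1 - q1 * q2 / p) <= ln (1 - q1) + ln (1 - q2).
  rewrite -!lnM ?posrE ?ler_ln ?posrE ?mulr_gt0//; try lra.
  have -> : (1 - q1) * (1 - q2) =
      (1 - p) * (1 - q1 * q2 / p) + (p - q1) * (p - q2) / p by field; lra.
  by rewrite lerDl divr_ge0 ?mulr_ge0//; lra.
nra.
Qed.

Lemma is_derive_le0_nincr (f df : R -> R) (a b : R) : a <= b ->
  (forall x, a <= x <= b -> is_derive x 1 f (df x)) ->
  (forall x, a < x < b -> df x <= 0) -> f b <= f a.
Proof.
rewrite le_eqVlt => /predU1P[->//|ab] fdf df0.
have [||c cab fE] := @MVT R f df a b ab.
- by move=> x; rewrite in_itv/= => xab; apply: fdf; lra.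
- apply: derivable_within_continuous => x; rewrite in_itv/= => xab.
  by have [] := fdf x xab.
rewrite -subr_le0 fE mulr_le0_ge0 ?subr_ge0 ?(ltW ab)//.
by apply: df0; rewrite in_itv/= in cab.
Qed.

Lemma ln_le_half x : 1 <= x -> ln x <= (x - x^-1) / 2.
Proof.
move=> x1; pose f y : R := 2 * (y * ln y) - y ^+ 2.
pose df y : R := 2 * (ln y + 1) - 2 * y.
have : f x <= f 1.
  apply: (@is_derive_le0_nincr f df) => // y y1x; last first.
    by rewrite /df; have := @ln_le_sub1 y; lra.
  have y0 : 0 < y by lra.
  have ? := is_derive1_ln y0.
  apply: is_derive_eq; rewrite /df /GRing.scale/=.
  by field; lra.
rewrite /f ln1 mulr0 mulr0 expr1n sub0r => fx.
have -> : (x - x^-1) / 2 = (x ^+ 2 - 1) / (2 * x) by field; lra.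
by rewrite ler_pdivlMr; lra.
Qed.

Lemma ln_le_sqrt x : 1 <= x -> ln x <= (x - 1) / Num.sqrt x.
Proof.
move=> x1; set y := Num.sqrt x; have y1 : 1 <= y by rewrite -sqrtr1 ler_wsqrtr.
have -> : x = y ^+ 2 by rewrite sqr_sqrtr; lra.
have := ln_le_half y1; rewrite lnXn; last lra.
have -> : (y ^+ 2 - 1) / y = 2 * ((y - y^-1) / 2) by field; lra.
lra.
Qed.

Lemma kl_half p : 1 / 2 <= p < 1 -> kl p (1 / 2) <= kl (1 / 2) p.
Proof.
(* Up to a constant, [f] is twice the difference of the two sides. With [t = y / (1 - y)] its
   derivative is [2 (ln t - (t - 1/t) / 2)], nonpositive by [ln_le_half]. *)
move=> p01; pose f y : R := (2 * y + 1) * ln y + (3 - 2 * y) * ln (1 - y).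
pose df y : R := 2 * (ln y - ln (1 - y)) + (2 * y + 1) / y - (3 - 2 * y) / (1 - y).
have fp : f p <= f (1 / 2).
  apply: (@is_derive_le0_nincr f df); [by lra|move=> y yp|move=> y yp]; last first.
    rewrite /df -ln_div ?posrE; [|lra|lra].
    have := @ln_le_half (y / (1 - y)); rewrite ler_pdivlMr ?invf_div; last lra.
    move=> /(_ ltac:(lra)).
    have -> : 2 * ln (y / (1 - y)) + (2 * y + 1) / y - (3 - 2 * y) / (1 - y) =
      2 * (ln (y / (1 - y)) - (y / (1 - y) - (1 - y) / y) / 2).
      by field; apply/andP; split; lra.
    lra.
  have ? := @is_derive1_ln R y ltac:(lra).
  have d1 := @is_derive1_ln R (1 - y) ltac:(lra).
  have d2 : is_derive y 1 (fun y : R => 1 - y) (0 - 1) by exact: is_deriveB.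
  have ? := @is_derive1_comp R (@ln R) (fun y => 1 - y) y _ _ d1 d2.
  apply: is_derive_eq; rewrite /df /GRing.scale/=.
  by field; apply/andP; split; lra.
rewrite /f in fp; have e2 : (1 : R) - 1 / 2 = 1 / 2 by field.
rewrite e2 in fp; by rewrite !klE ?e2; lra.
Qed.

(** Concavity of [ln]: with [t = r / r'], the point [1 + a / r'] is the convex combination of
    [1 + a / r] and [1] with weights [t] and [1 - t]. *)
Lemma mul_ln1p_mono (a r r' : R) : 0 < a -> 0 < r -> r <= r' ->
  r * ln (1 + a / r) <= r' * ln (1 + a / r').
Proof.
move=> a0 r0 rr'; have r'0 : 0 < r' by lra.
have x0 : 0 < a / r by rewrite divr_gt0.
have y0 : 0 < a / r' by rewrite divr_gt0.
pose t := r / r'; have t0 : 0 < t by rewrite divr_gt0.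
have t1 : t <= 1 by rewrite ler_pdivrMr// mul1r.
have yE : a / r' = t * (a / r) by rewrite /t [RHS]mulrC mulrA divfK ?gt_eqF.
have h1 := @ln_le_sub1 ((1 + a / r) / (1 + a / r')) ltac:(apply: divr_gt0; lra).
have h2 := @ln_le_sub1 (1 / (1 + a / r')) ltac:(apply: divr_gt0; lra).
rewrite !ln_div ?posrE ?ln1 in h1 h2; try lra.
have : t * (ln (1 + a / r) - ln (1 + a / r')) + (1 - t) * (0 - ln (1 + a / r'))
   <= t * ((1 + a / r) / (1 + a / r') - 1) + (1 - t) * (1 / (1 + a / r') - 1).
  by rewrite lerD// ler_wpM2l//; lra.
have tE : t * (1 + a / r) + (1 - t) = 1 + a / r' by rewrite yE; ring.
have -> : t * ((1 + a / r) / (1 + a / r') - 1) + (1 - t) * (1 / (1 + a / r') - 1) =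
    (t * (1 + a / r) + (1 - t)) / (1 + a / r') - 1 by ring.
rewrite tE divff ?subrr; last by rewrite gt_eqF//; lra.
move=> h; have : t * ln (1 + a / r) <= ln (1 + a / r') by lra.
by rewrite /t mulrAC ler_pdivrMr// [X in _ <= X]mulrC.
Qed.

End kullback_leibler.

(** * The normal distribution *)

Section standard_normal.
Context {R : realType}.
Implicit Types (m z x p : R) (A : set R).
Let mu : {measure set _ -> \bar R} := @lebesgue_measure R.

Definition nprob m A : R := fine (normal_prob m 1 A).
Definition Phi z : R := nprob 0 `]-oo, z].
Definition phi x : R := normal_pdf 0 1 x.

Lemma normal_pdf1E m x :
  normal_pdf m 1 x = normal_peak 1 * expR (- ((x - m) ^+ 2 / 2)).
Proof.
by rewrite normal_pdfE ?oner_eq0// /normal_fun expr1n mulNr.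
Qed.

Lemma normal_peak_gt0' : 0 < normal_peak 1 :> R.
Proof. by rewrite normal_peak_gt0// oner_eq0. Qed.

Lemma sqr_normal_peak1 : (normal_peak 1 : R) ^+ 2 = (2 * pi)^-1.
Proof.
rewrite /normal_peak expr1n mul1r exprVn sqr_sqrtr ?mulr_natl//.
by rewrite mulrn_wge0// pi_ge0.
Qed.

Lemma phiE x : phi x = normal_peak 1 * expR (- (x ^+ 2 / 2)).
Proof. by rewrite /phi normal_pdf1E subr0. Qed.

Lemma phi_gt0 x : 0 < phi x.
Proof. by rewrite phiE mulr_gt0 ?normal_peak_gt0' ?expR_gt0. Qed.

Lemma nprobE m A : measurable A -> normal_prob m 1 A = (nprob m A)%:E.
Proof.
by move=> mA; rewrite /nprob fineK//; exact: fin_num_measure.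
Qed.

Lemma nprob_ge0 m A : 0 <= nprob m A.
Proof. by rewrite fine_ge0. Qed.

Lemma nprob_le1 m A : measurable A -> nprob m A <= 1.
Proof. by move=> mA; rewrite -lee_fin -nprobE// probability_le1. Qed.

Lemma nprobC m A : measurable A -> nprob m (~` A) = 1 - nprob m A.
Proof.
move=> mA; apply: EFin_inj; rewrite -nprobE; last exact: measurableC.
transitivity (1 - normal_prob m 1 A)%E; first exact: probability_setC.
by rewrite nprobE.
Qed.

Lemma is_derive_Phi z : is_derive z 1 Phi (phi z).
Proof.
have [||||d1 d2] := @continuous_FTC1 R phi (BInfty _ true) z (z + 1).
- by rewrite ltrDl.
- by apply: integrableS (integrable_normal_pdf 0 1).
- exact: ltNyr.
- by apply: continuous_normal_pdf; rewrite oner_eq0.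
apply: DeriveDef; first exact: d1.
by rewrite -derive1E; exact: d2.
Qed.

Lemma nprob_itvNy m z : nprob m `]-oo, z] = Phi (z - m).
Proof.
rewrite /Phi /nprob /normal_prob; congr fine.
have Fd : (fun x : R => x - m)^`()%classic = cst (1 : R).
  by apply/funext => x; rewrite derive1E derive_val subr0.
rewrite (@increasing_ge0_integration_by_substitutionNy R (fun x => x - m)).
- apply: eq_integral => x _; rewrite Fd /= !fctE mulr1.
  by rewrite !normal_pdf1E subr0.
- by move=> x y _ _; rewrite ltrD2r.
- by rewrite Fd => ? _; exact: cst_continuous.
- by rewrite Fd; exact: is_cvg_cst.
- by rewrite Fd; exact: cvg_cst.
- split; first by [].
  apply: cvg_at_left_filter; apply: cvgB; [exact: cvg_id|exact: cvg_cst].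
- exact: cvg_addrr_Ny.
- by apply: continuous_subspaceT; apply: continuous_normal_pdf; rewrite oner_eq0.
- by move=> x _; exact: normal_pdf_ge0.
Qed.

Lemma PhiN z : Phi (- z) = 1 - Phi z.
Proof.
rewrite -nprobC// setCitvl /Phi /nprob /normal_prob; congr fine.
rewrite ge0_integration_by_substitutionNy.
- rewrite -integral_itv_obnd_cbnd.
    by apply: eq_integral => x _; rewrite /= !normal_pdf1E !subr0 sqrrN.
    apply/measurable_EFinP; apply: (measurable_funS measurableT) => //.
    by apply: measurableT_comp => //; exact: measurable_normal_pdf.
- by apply: continuous_subspaceT; apply: continuous_normal_pdf; rewrite oner_eq0.
- by move=> x _; exact: normal_pdf_ge0.
Qed.

Lemma Phi0 : Phi 0 = 1 / 2.
Proof. by have := PhiN 0; rewrite oppr0; lra. Qed.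

Lemma Phi_lt x y : x < y -> Phi x < Phi y.
Proof.
move=> xy; have [||c _ cE] := @MVT R Phi phi x y xy.
- by move=> ? _; exact: is_derive_Phi.
- by apply: derivable_within_continuous => z _; have [] := is_derive_Phi z.
by rewrite -subr_gt0 cE mulr_gt0 ?phi_gt0 ?subr_gt0.
Qed.

Lemma Phi_le x y : x <= y -> Phi x <= Phi y.
Proof. by rewrite le_eqVlt => /predU1P[->//|/Phi_lt/ltW]. Qed.

Lemma Phi01 z : 0 < Phi z < 1.
Proof.
have := @Phi_lt (z - 1) z; have := @Phi_lt z (z + 1).
have := nprob_ge0 0 `]-oo, z - 1]; have := @nprob_le1 0 `]-oo, z + 1].
by rewrite -!/(Phi _) => /(_ (measurable_itv _)); lra.
Qed.

Lemma nprob_ge m z : nprob m [set x | z <= x] = 1 - Phi (z - m).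
Proof.
rewrite -nprob_itvNy -nprobC// setCitvl -set_itvcy /nprob /normal_prob.
congr fine; rewrite -integral_itv_obnd_cbnd//.
by apply: measurable_funTS; apply/measurable_EFinP; exact: measurable_normal_pdf.
Qed.

End standard_normal.

(** * The product [Phi (1 - Phi)] as a mixture of Gaussian functions *)

Section gaussian_mixture.
Context {R : realType}.
Implicit Types (x y z t : R).
Let mu : {measure set _ -> \bar R} := @lebesgue_measure R.

(** [mix z] is [pi * Phi z * (1 - Phi z)] by [Phi_mix]; as a mixture of functions
    [exp (- a z^2)] it satisfies Cauchy-Schwarz and Chebyshev inequalities. *)
Definition mix_fun z t : R := expR (- (z ^+ 2 / 2 * oneDsqr t)) / oneDsqr t.
Definition mix z : R := \int[mu]_(t in `[0, 1]) mix_fun z t.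

Lemma oneDsqr_gt0' t : 0 < oneDsqr t.
Proof. by rewrite /oneDsqr; nra. Qed.

Lemma continuous_mix_fun z : continuous (mix_fun z).
Proof.
move=> t; rewrite /mix_fun; apply: cvgM; last exact: continuous_oneDsqrV.
apply: continuous_comp => /=; last exact: continuous_expR.
by apply: cvgN; apply: cvgM; [exact: cvg_cst|exact: continuous_oneDsqr].
Qed.

Lemma integrable01 (f : R -> R) : continuous f ->
  mu.-integrable `[0, 1] (EFin \o f).
Proof.
move=> cf; apply: continuous_compact_integrable; first exact: segment_compact.
exact: continuous_subspaceT.
Qed.

Lemma is_derive_mix_fun z t :
  is_derive z 1 (mix_fun ^~ t) (- (z * expR (- (z ^+ 2 / 2 * oneDsqr t)))).
Proof.
have t0 := oneDsqr_gt0' t.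
have d1 : is_derive z 1 (fun z => - (z ^+ 2 / 2 * oneDsqr t)) (- (z * oneDsqr t)).
  by apply: is_derive_eq; rewrite /GRing.scale/=; field.
have d2 := is_derive_expR (- (z ^+ 2 / 2 * oneDsqr t)).
have ? := @is_derive1_comp R (@expR R) (fun z => - (z ^+ 2 / 2 * oneDsqr t)) z _ _ d2 d1.
rewrite /mix_fun; apply: is_derive_eq; rewrite /GRing.scale/=.
by field; rewrite gt_eqF.
Qed.

Lemma continuous_scaled_gauss z : continuous (fun t => z * expR (- ((z * t) ^+ 2 / 2))).
Proof.
move=> t; apply: cvgM; first exact: cvg_cst.
apply: continuous_comp => /=; last exact: continuous_expR.
apply: cvgN; apply: cvgM; last exact: cvg_cst.
apply: (cvg_comp (fun t => z * t) (fun y => y ^+ 2)); last exact: exprn_continuous.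
by apply: cvgM; [exact: cvg_cst|exact: cvg_id].
Qed.

(** Differentiation cancels the weight [1 / (1 + t^2)], and the exponential factors into a part in
    [z] alone and a Gaussian integral, which [integral_scaled_gauss] evaluates. *)
Lemma is_derive_mix z : is_derive z 1 mix
  (- (expR (- (z ^+ 2 / 2)) * \int[mu]_(t in `[0, 1]) (z * expR (- ((z * t) ^+ 2 / 2))))).
Proof.
have za : [set` `]z - 1, z + 1[] z by rewrite /= in_itv/=; lra.
have dE x t : (partial1of2 mix_fun) x t = - (x * expR (- (x ^+ 2 / 2 * oneDsqr t))).
  by rewrite partial1of2E; have /@derive_val := is_derive_mix_fun x t.
have i1 x : [set` `]z - 1, z + 1[] x -> mu.-integrable `[0, 1] (EFin \o mix_fun x).
  by move=> _; apply: integrable01; exact: continuous_mix_fun.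
have i2 x t : [set` `]z - 1, z + 1[] x -> [set` `[0, 1]] t -> derivable (mix_fun ^~ t) x 1.
  by move=> _ _; have [] := is_derive_mix_fun x t.
have G0 (t : R) : 0 <= `|z| + 1 by rewrite addr_ge0.
have iG : mu.-integrable `[0, 1] (EFin \o (fun _ : R => `|z| + 1)).
  by apply: integrable01 => ?; exact: cvg_cst.
have ub x t : [set` `]z - 1, z + 1[] x -> [set` `[0, 1]] t ->
    `|(partial1of2 mix_fun) x t| <= `|z| + 1.
  rewrite /= in_itv/= dE normrN normrM => xz _.
  rewrite (ger0_norm (expR_ge0 _)) (@le_trans _ _ `|x|)//; last first.
    clear -xz; rewrite ler_norml; have := ler_norm z; have := ler_norm (- z); rewrite normrN; lra.
  rewrite ler_piMr// expR_le1 oppr_le0 mulr_ge0 ?(ltW (oneDsqr_gt0' _))//.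
  by rewrite divr_ge0 ?sqr_ge0.
apply: DeriveDef.
  exact: (@derivable_under_integral R _ _ mu mix_fun `[0, 1] _ z (z - 1) (z + 1)
    za i1 i2 _ G0 iG ub).
rewrite -derive1E.
rewrite (@differentiation_under_integral R _ _ mu mix_fun `[0, 1] _ z (z - 1) (z + 1)
    za i1 i2 _ G0 iG ub)//.
rewrite -mulNr -RintegralZl//; last by apply: integrable01; exact: continuous_scaled_gauss.
apply: eq_Rintegral => t _; rewrite dE mulNr; congr -%R.
by rewrite mulrCA -expRD /oneDsqr; congr (_ * expR _); field.
Qed.

(** The integrand is the derivative of [Phi (z * t)] in [t], whatever the sign of [z]. *)
Lemma integral_scaled_gauss z :
  normal_peak 1 * \int[mu]_(t in `[0, 1]) (z * expR (- ((z * t) ^+ 2 / 2))) =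
  Phi z - 1 / 2.
Proof.
rewrite -RintegralZl//; last by apply: integrable01; exact: continuous_scaled_gauss.
pose f t := normal_peak 1 * (z * expR (- ((z * t) ^+ 2 / 2))) : R.
have fE t : is_derive t 1 (fun t => Phi (z * t)) (f t).
  have d1 : is_derive t 1 (fun t : R => z * t) z.
    by apply: is_derive_eq; rewrite /GRing.scale/=; ring.
  have := @is_derive1_comp R Phi (fun t => z * t) t _ _ (is_derive_Phi _) d1.
  by move=> ?; apply: is_derive_eq; rewrite phiE /f; ring.
have cP : continuous (fun t => Phi (z * t)).
  move=> t; apply/differentiable_continuous/derivable1_diffP.
  by have [] := fE t.
rewrite /Rintegral (@continuous_FTC2 R f (fun t => Phi (z * t)) 0 1).
- by rewrite mulr1 mulr0 Phi0.
- exact: ltr01.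
- apply: continuous_subspaceT => t; apply: cvgM; first exact: cvg_cst.
  exact: continuous_scaled_gauss.
- split.
  + by move=> t _; have [] := fE t.
  + exact/cvg_at_right_filter/cP.
  + exact/cvg_at_left_filter/cP.
- by move=> t _; rewrite derive1E; apply: (@derive_val _ _ _ _ _ _ _ (fE t)).
Qed.

Lemma mix0 : mix 0 = pi / 4.
Proof.
rewrite /mix -atan1 -integral0_oneDsqr//; apply: eq_Rintegral => t _.
by rewrite /mix_fun expr0n/= !mul0r oppr0 expR0 mul1r.
Qed.

(** This is the classical value of Owen's function at slope 1. Both sides equal 1 at 0 and have the
    same derivative, because [normal_peak 1 ^+ 2] is [1 / (2 pi)]. *)
Lemma Phi_mix z : 4 * (Phi z * (1 - Phi z)) = 4 / pi * mix z.
Proof.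
pose f z := 4 * (Phi z * (1 - Phi z)) - 4 / pi * mix z : R.
have f' x : is_derive x 1 f 0.
  have ? := is_derive_Phi x.
  have ? := is_derive_mix x.
  apply: is_derive_eq; rewrite /GRing.scale/=.
  have pk := @sqr_normal_peak1 R; have pi0 := @pi_gt0 R.
  set I := Rintegral _ _ _.
  have IE : normal_peak 1 * I = Phi x - 1 / 2 := integral_scaled_gauss x.
  have k0 : (normal_peak 1 : R) != 0 by rewrite gt_eqF// normal_peak_gt0'.
  have {pk} -> : 4 / pi = 8 * (normal_peak 1 : R) ^+ 2.
    by rewrite pk; move: pi pi0 => p p0; field; rewrite lt0r_neq0.
  have -> : Phi x = normal_peak 1 * I + 1 / 2 by rewrite IE; ring.
  by rewrite phiE; field.
have : f z = f 0.
  have [c] : exists c, f z - f 0 = 0 * c.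
    have c0 : continuous f.
      by move=> x; apply/differentiable_continuous/derivable1_diffP; have [] := f' x.
    have [z0|z0] := leP 0 z.
    - have [|c _ ->] := @MVT_segment R f (fun=> 0) 0 z z0.
      + exact: continuous_subspaceT.
      by exists (z - 0).
    - have [|c _ cE] := @MVT_segment R f (fun=> 0) z 0 (ltW z0).
      + exact: continuous_subspaceT.
      by exists z; rewrite -opprB cE !mul0r oppr0.
  by rewrite mul0r => /eqP; rewrite subr_eq0 => /eqP.
have pi0 := @pi_gt0 R.
rewrite {2}/f Phi0 mix0.
have -> : 4 * (1 / 2 * (1 - 1 / 2)) - 4 / pi * (pi / 4) = 0 :> R.
  by move: pi pi0 => p p0; field; rewrite lt0r_neq0.
by rewrite /f => /eqP; rewrite subr_eq0 => /eqP.
Qed.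

End gaussian_mixture.

(** * Convexity, correlation and monotonicity inequalities for the mixture *)

Section gaussian_mixture_inequalities.
Context {R : realType}.
Implicit Types (a b x y z t : R).
Let mu : {measure set _ -> \bar R} := @lebesgue_measure R.

Let mfun a t : R := expR (- (a * oneDsqr t)) / oneDsqr t.
Let mixa a : R := \int[mu]_(t in `[0, 1]) mfun a t.

Let mixE z : mix z = mixa (z ^+ 2 / 2). Proof. by []. Qed.

Let continuous_mfun a : continuous (mfun a).
Proof.
move=> t; rewrite /mfun; apply: cvgM; last exact: continuous_oneDsqrV.
apply: continuous_comp => /=; last exact: continuous_expR.
by apply: cvgN; apply: cvgM; [exact: cvg_cst|exact: continuous_oneDsqr].
Qed.

Let continuous_Zmfun k a : continuous (fun t => k * mfun a t).
Proof. by move=> t; apply: cvgM; [exact: cvg_cst|exact: continuous_mfun]. Qed.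

Let mixa_lin2 k a l b :
  \int[mu]_(t in `[0, 1]) (k * mfun a t + l * mfun b t) = k * mixa a + l * mixa b.
Proof.
have i c u := integrable01 (@continuous_Zmfun c u).
have i' u := integrable01 (@continuous_mfun u).
by rewrite RintegralD ?RintegralZl//; [exact: i'|exact: i'|exact: i|exact: i].
Qed.

Let continuous_lin2 k a l b : continuous (fun t => k * mfun a t + l * mfun b t).
Proof. by move=> t; apply: cvgD; exact: continuous_Zmfun. Qed.

Let le_mixa k a l b k' a' l' b' :
  (forall t, 0 <= t <= 1 ->
     k * mfun a t + l * mfun b t <= k' * mfun a' t + l' * mfun b' t) ->
  k * mixa a + l * mixa b <= k' * mixa a' + l' * mixa b'.
Proof.
move=> h; rewrite -!mixa_lin2; apply: le_Rintegral => //.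
- by apply: integrable01; exact: continuous_lin2.
- by apply: integrable01; exact: continuous_lin2.
Qed.

Let mixa_gt0 a : 0 < mixa a.
Proof.
pose k : R := expR (- (`|a| * 2)) / 2.
have k0 : 0 < k by rewrite divr_gt0 ?expR_gt0.
apply: lt_le_trans k0 _.
have -> : k = \int[mu]_(t in `[0, 1]) cst k t.
  rewrite Rintegral_cst// /mu/= lebesgue_measure_itv/= lte_fin ltr01.
  by rewrite -EFinB/= subr0 mulr1.
apply: le_Rintegral => //.
- by apply: integrable01 => ?; exact: cvg_cst.
- exact: integrable01.
move=> t /=; rewrite in_itv/= => t01.
have o1 : 1 <= oneDsqr t <= 2 by rewrite /oneDsqr; nra.
have le1 : expR (- (`|a| * 2)) <= expR (- (a * oneDsqr t)).
  have h1 : a * oneDsqr t <= `|a| * oneDsqr t by rewrite ler_wpM2r ?ler_norm//; lra.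
  have h2 : `|a| * oneDsqr t <= `|a| * 2 by rewrite ler_wpM2l//; lra.
  by rewrite ler_expR; lra.
have le2 : 2^-1 <= (oneDsqr t)^-1 by rewrite lef_pV2 ?posrE; lra.
by rewrite /k /mfun ler_pM ?expR_ge0 ?invr_ge0.
Qed.

Let mixa_cs a b : mixa ((a + b) / 2) ^+ 2 <= mixa a * mixa b.
Proof.
set N := mixa ((a + b) / 2).
have N0 : 0 < N := mixa_gt0 _.
have a0 : 0 < mixa a := mixa_gt0 _.
(* Pointwise, [2 p q <= k p^2 + q^2 / k]. This [k] makes the integral of the first term equal to
   [N], so that the integrated inequality becomes [N^2 <= mixa a * mixa b]. *)
pose k := N / mixa a.
have k0 : 0 < k by rewrite divr_gt0.
have := @le_mixa 1 ((a + b) / 2) 1 ((a + b) / 2) k a k^-1 b.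
rewrite -/N.
have h t : 0 <= t <= 1 -> 1 * mfun ((a + b) / 2) t + 1 * mfun ((a + b) / 2) t <=
    k * mfun a t + k^-1 * mfun b t.
  move=> _; have o0 := oneDsqr_gt0' t; rewrite !mul1r /mfun -mulrDl !mulrA -mulrDl.
  rewrite ler_wpM2r ?invr_ge0 ?(ltW o0)//.
  have -> : - ((a + b) / 2 * oneDsqr t) = - (a / 2 * oneDsqr t) + - (b / 2 * oneDsqr t) by ring.
  have e2 c : expR (- (c * oneDsqr t)) = expR (- (c / 2 * oneDsqr t)) ^+ 2.
    by rewrite expr2 -expRD; congr expR; field.
  rewrite expRD (e2 a) (e2 b).
  move: (expR _) (expR _) => q p.
  have -> : k * p ^+ 2 + k^-1 * q ^+ 2 = p * q + p * q + (k * p - q) ^+ 2 / k.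
    by field; rewrite gt_eqF.
  by rewrite lerDl divr_ge0 ?sqr_ge0 ?(ltW k0).
move=> /(_ h); rewrite !mul1r /k divfK ?gt_eqF// invf_div.
rewrite lerD2l mulrAC ler_pdivlMr// -expr2.
Qed.

(** The two exponentials are both decreasing in [oneDsqr t]. The level [s] is where the second one
    takes its mean value [w], and [v] is the value of the first one there; [(v - p) (w - q)] is then
    nonnegative for every [t], and after integration the terms in [v] cancel since
    [w * mixa 0 = mixa b]. *)
Let mixa_chebyshev a b : 0 <= a -> 0 <= b ->
  mixa a * mixa b <= mixa (a + b) * mixa 0.
Proof.
move=> a0 b0.
have m0 : 0 < mixa 0 := mixa_gt0 _.
have [->|b_gt0] := eqVneq b 0; first by rewrite addr0.
have b1 : 0 < b by rewrite lt0r b_gt0.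
have [w wE] : exists w, w = mixa b / mixa 0 by eexists.
have w0 : 0 < w by rewrite wE divr_gt0.
pose s := - ln w / b.
have ws : w = expR (- (b * s)).
  by rewrite /s mulrC divfK ?gt_eqF// opprK lnK.
pose v := expR (- (a * s)).
have := @le_mixa v b w a 1 (a + b) (v * w) 0.
have h t : 0 <= t <= 1 -> v * mfun b t + w * mfun a t <=
    1 * mfun (a + b) t + v * w * mfun 0 t.
  move=> _; have o0 := oneDsqr_gt0' t; rewrite /mfun !mulrA -!mulrDl.
  rewrite ler_wpM2r ?invr_ge0 ?(ltW o0)// mul1r mul0r oppr0 expR0 mulr1.
  rewrite mulrDl opprD expRD.
  set p := expR (- (a * oneDsqr t)); set q := expR (- (b * oneDsqr t)).
  suff : 0 <= (v - p) * (w - q) by lra.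
  have [st|ts] := leP s (oneDsqr t).
    by rewrite mulr_ge0 ?subr_ge0 ?ws ?ler_expR ?lerN2 ?ler_wpM2l.
  by rewrite mulr_le0 ?subr_le0 ?ws ?ler_expR ?lerN2 ?ler_wpM2l ?(ltW ts).
move=> /(_ h); rewrite mul1r -mulrA.
have -> : w * mixa 0 = mixa b by rewrite wE divfK ?gt_eqF.
rewrite [X in X <= _]addrC lerD2r wE mulrAC ler_pdivrMr//.
by rewrite [X in X <= _ -> _]mulrC.
Qed.

(** The mean of [(z + 1)^2] and [(z - 1)^2] is [z^2 + 1]: log-convexity in the square goes down to
    this mean, and the correlation inequality then separates [z] from [1]. *)
Lemma mix_shift z : (mix z * mix 1) ^+ 2 <= mix (z + 1) * mix (z - 1) * mix 0 ^+ 2.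
Proof.
have h1 := @mixa_cs ((z + 1) ^+ 2 / 2) ((z - 1) ^+ 2 / 2).
have h2 := @mixa_chebyshev (z ^+ 2 / 2) (1 ^+ 2 / 2).
have e0 : mix 0 = mixa 0 by rewrite mixE expr0n/= mul0r.
rewrite e0 !mixE (le_trans _ (ler_wpM2r (sqr_ge0 _) h1))// -exprMn.
rewrite ler_pXn2r ?nnegrE ?mulr_ge0 ?(ltW (mixa_gt0 _))//.
have -> : ((z + 1) ^+ 2 / 2 + (z - 1) ^+ 2 / 2) / 2 = z ^+ 2 / 2 + 1 ^+ 2 / 2 by field.
by apply: h2; rewrite divr_ge0 ?sqr_ge0.
Qed.

(** Already true under the integral sign: the exponent becomes [x^2 (1 - t^2) / 2] with [t <= 1].
    With [x^2 / 2] as compensating exponent, as in [mix_expR_half_ge], it becomes [- x^2 t^2 / 2]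
    and the monotonicity is reversed. *)
Lemma mix_expR_le x y : `|x| <= `|y| ->
  expR (x ^+ 2) * mix x <= expR (y ^+ 2) * mix y.
Proof.
move=> xy; have xy2 : x ^+ 2 <= y ^+ 2.
  by rewrite -(real_normK (num_real x)) -(real_normK (num_real y)) ler_pXn2r ?nnegrE.
rewrite !mixE.
have := @le_mixa (expR (x ^+ 2)) (x ^+ 2 / 2) 0 0 (expR (y ^+ 2)) (y ^+ 2 / 2) 0 0.
rewrite mul0r !addr0; apply => t t01.
rewrite mul0r !addr0 /mfun !mulrA -!expRD.
rewrite ler_wpM2r ?invr_ge0 ?(ltW (oneDsqr_gt0' _))// ler_expR /oneDsqr.
have : 0 <= (y ^+ 2 - x ^+ 2) * (1 - t ^+ 2) by rewrite mulr_ge0//; nra.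
lra.
Qed.

Lemma mix_expR_half_ge x y : `|x| <= `|y| ->
  expR (y ^+ 2 / 2) * mix y <= expR (x ^+ 2 / 2) * mix x.
Proof.
move=> xy; have xy2 : x ^+ 2 <= y ^+ 2.
  by rewrite -(real_normK (num_real x)) -(real_normK (num_real y)) ler_pXn2r ?nnegrE.
rewrite !mixE.
have := @le_mixa (expR (y ^+ 2 / 2)) (y ^+ 2 / 2) 0 0 (expR (x ^+ 2 / 2)) (x ^+ 2 / 2) 0 0.
rewrite mul0r !addr0; apply => t t01.
rewrite mul0r !addr0 /mfun !mulrA -!expRD.
rewrite ler_wpM2r ?invr_ge0 ?(ltW (oneDsqr_gt0' _))// ler_expR /oneDsqr.
have : 0 <= (y ^+ 2 - x ^+ 2) * t ^+ 2 by rewrite mulr_ge0 ?sqr_ge0 ?subr_ge0.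
lra.
Qed.

Lemma mix_le z : mix z <= expR (- (z ^+ 2 / 2)) * mix 0.
Proof.
rewrite !mixE expr0n/= mul0r.
have := @le_mixa 1 (z ^+ 2 / 2) 0 0 (expR (- (z ^+ 2 / 2))) 0 0 0.
rewrite !mul0r mul1r !addr0; apply => t t01.
rewrite !mul0r mul1r !addr0 /mfun !mulrA -!expRD.
rewrite ler_wpM2r ?invr_ge0 ?(ltW (oneDsqr_gt0' _))// ler_expR /oneDsqr.
by have := sqr_ge0 (z * t); nra.
Qed.

End gaussian_mixture_inequalities.

(** * Rational bounds on [pi], [e], logarithms and [Phi 1] *)

Section numeric_bounds.
Context {R : realType}.
Implicit Types x y r : R.

Lemma cos_ge_quad x : 0 <= x -> 1 - x ^+ 2 / 2 <= cos x.
Proof.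
have sin_le y : 0 <= y -> sin y <= y.
  move=> y0; rewrite -subr_le0 -[leRHS](_ : sin 0 - 0 = 0); last by rewrite sin0 subrr.
  exact: (@is_derive_le0_nincr _ (fun t => sin t - t) (fun t => cos t - 1)).
move=> x0; rewrite -subr_le0 -[leRHS](_ : 1 - 0 ^+ 2 / 2 - cos 0 = 0); last first.
  by rewrite cos0 expr0n/= mul0r subr0 subrr.
apply: (@is_derive_le0_nincr _ (fun t => 1 - t ^+ 2 / 2 - cos t) (fun t => sin t - t)) => //.
  by move=> t _; apply: is_derive_eq; rewrite /GRing.scale/=; field.
by move=> t /andP[t0 _] /=; rewrite subr_le0 sin_le// ltW.
Qed.

Lemma sin_ge_cubic x : 0 <= x -> x - x ^+ 3 / 6 <= sin x.
Proof.
move=> x0; rewrite -subr_le0 -[leRHS](_ : 0 - 0 ^+ 3 / 6 - sin 0 = 0); last first.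
  by rewrite sin0 expr0n/= mul0r !subr0.
apply: (@is_derive_le0_nincr _ (fun t => t - t ^+ 3 / 6 - sin t)
  (fun t => 1 - t ^+ 2 / 2 - cos t)) => //.
  by move=> t _; apply: is_derive_eq; rewrite /GRing.scale/=; field.
by move=> t /andP[t0 _] /=; rewrite subr_le0 cos_ge_quad// ltW.
Qed.

(** [sin (pi / 6) = 1 / 2] since [1 - 3 s + 4 s^3 = (s + 1) (2 s - 1)^2]. *)
Lemma pi_le : pi <= 315 / 100 :> R.
Proof.
have p0 := @pi_gt0 R; have p2 := @pihalf_lt2 R.
pose y : R := pi / 6; set s := sin y.
have y0 : 0 < y by rewrite divr_gt0.
have y1 : y < 2 / 3 by rewrite /y; lra.
have s0 : 0 <= s by rewrite sin_ge0_pi// /y; lra.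
have s12 : s = 1 / 2.
  have : sin (y *+ 2 + y) = 1 by rewrite -sin_pihalf; congr sin; rewrite /y; field.
  rewrite sinD sin_mulr2n cos_mulr2n -/s.
  have := cos2sin2 y; rewrite -/s => c2.
  have -> : (cos y * s) *+ 2 * cos y + (cos y ^+ 2 *+ 2 - 1) * s =
     4 * s * cos y ^+ 2 - s by ring.
  rewrite c2 => h; have : (s + 1) * (2 * s - 1) ^+ 2 = 0.
    by transitivity (1 - (4 * s * (1 - s ^+ 2) - s)); [ring|rewrite h subrr].
  move/eqP; rewrite mulf_eq0 sqrf_eq0 => /orP[] /eqP; lra.
have := @sin_ge_cubic y (ltW y0); rewrite -/s s12 => h.
suff : y <= 525 / 1000 by rewrite /y; lra.
rewrite leNgt; apply/negP => hy.
have y2 : y ^+ 2 <= 4 / 9 by nra.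
have : 0 < (y - 525 / 1000) * (6 - y ^+ 2 - 525 / 1000 * y - (525 / 1000) ^+ 2).
  by rewrite mulr_gt0; lra.
lra.
Qed.

Lemma ln_ge_pade x : 1 <= x -> 2 * (x - 1) <= (x + 1) * ln x.
Proof.
move=> x1; rewrite -subr_le0.
rewrite -[leRHS](_ : 2 * (1 - 1) - (1 + 1) * ln 1 = 0); last first.
  by rewrite ln1 subrr !mulr0 subrr.
pose f t : R := 2 * (t - 1) - (t + 1) * ln t.
pose df t : R := 2 - (ln t + (t + 1) * t^-1).
have D t : 1 <= t <= x -> is_derive t 1 f (df t).
  move=> t1; have ? := @is_derive1_ln R t ltac:(lra).
  by apply: is_derive_eq; rewrite /df /GRing.scale/=; ring.
apply: (is_derive_le0_nincr x1 D) => t t1.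
have := @ln_ge_subV R t ltac:(lra).
by rewrite /df mulrDl mulfV ?gt_eqF//; lra.
Qed.

Lemma ln_exprn n x : 0 < x -> ln (x ^+ n) = n%:R * ln x.
Proof. by move=> x0; rewrite lnXn// mulr_natl. Qed.

(** The fraction [94/83] lies just below [expR (1/8)]; its eighth power is estimated by squaring
    rounded values. The next two lemmas proceed alike, with [83/77] just above [expR (3/40)] and
    [85/73] just above [expR (243/1600)]. *)
Lemma expR1_ge : 541 / 200 <= expR 1 :> R.
Proof.
have h : ln (94 / 83) <= (94 / 83 - (94 / 83)^-1) / 2 :> R.
  by apply: ln_le_half; lra.
rewrite invf_div in h.
have : ln ((94 / 83) ^+ 8) <= 1 :> R by rewrite ln_exprn; lra.
rewrite -ler_expR lnK ?posrE; last by rewrite exprn_gt0//; lra.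
apply: le_trans.
have x2 : 513 / 400 <= (94 / 83) ^+ 2 :> R by lra.
have x4 : 822 / 500 <= (94 / 83) ^+ 4 :> R.
  by rewrite (exprM _ 2 2); nra.
by rewrite (exprM _ 4 2); nra.
Qed.

Lemma expR_06_le : expR (6 / 10) <= 73 / 40 :> R.
Proof.
have h := @ln_ge_pade (83 / 77) ltac:(lra).
have : 6 / 10 <= ln ((83 / 77) ^+ 8) :> R by rewrite ln_exprn; lra.
rewrite -ler_expR lnK ?posrE; last by rewrite exprn_gt0//; lra.
move=> /le_trans; apply.
have x2 : (83 / 77) ^+ 2 <= 581 / 500 :> R by lra.
have x0 : 0 <= (83 / 77) ^+ 2 :> R by lra.
have x4 : (83 / 77) ^+ 4 <= 77 / 57 :> R by rewrite (exprM _ 2 2); nra.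
have x40 : 0 <= (83 / 77) ^+ 4 :> R by rewrite exprn_ge0; lra.
by rewrite (exprM _ 4 2); nra.
Qed.

Lemma ln_1152_ge : 243 / 100 <= ln (288 / 25) :> R.
Proof.
have h := @ln_ge_pade (85 / 73) ltac:(lra).
have : 243 / 100 <= ln ((85 / 73) ^+ 16) :> R by rewrite ln_exprn; lra.
move=> /le_trans; apply; rewrite ler_ln ?posrE; [|by rewrite exprn_gt0//; lra|lra].
have x2 : (85 / 73) ^+ 2 <= 339 / 250 :> R by lra.
have x0 : 0 <= (85 / 73) ^+ 2 :> R by lra.
have x4 : (85 / 73) ^+ 4 <= 46 / 25 :> R by rewrite (exprM _ 2 2); nra.
have x40 : 0 <= (85 / 73) ^+ 4 :> R by rewrite exprn_ge0; lra.
have x8 : (85 / 73) ^+ 8 <= 339 / 100 :> R by rewrite (exprM _ 4 2); nra.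
have x80 : 0 <= (85 / 73) ^+ 8 :> R by rewrite exprn_ge0; lra.
by rewrite (exprM _ 8 2); nra.
Qed.

(** To be used at [r = 1 - Phi 1], whence the range [81/500]. There the first logarithm is at least
    [ln (288/25)]; the second one is replaced by its tangent at [expR (- 6/10)], close to the value
    of [4 r (1 - r)] at the end of the range. A quadratic inequality in [r] remains. *)
Lemma log_bound r : 0 < r <= 81 / 500 ->
  1 - r * ln (1 + (expR 1 - 1) / r) <= - ln (4 * (r * (1 - r))).
Proof.
move=> r0.
have h1 : 243 / 100 <= ln (1 + (expR 1 - 1) / r).
  apply: le_trans ln_1152_ge _; rewrite ler_ln ?posrE; first last.
  - by rewrite addr_gt0// divr_gt0//; have := expR1_ge; lra.
  - lra.
  have : 263 / 25 <= (expR 1 - 1) / r.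
    by rewrite ler_pdivlMr; have := expR1_ge; lra.
  lra.
have x0 : 0 < 4 * (r * (1 - r)) by rewrite mulr_gt0// mulr_gt0; lra.
have h2 : ln (4 * (r * (1 - r))) <= 73 / 40 * (4 * (r * (1 - r))) - 1 - 6 / 10.
  have e0 := expR_gt0 (6 / 10 : R).
  have := @ln_le_sub1 R (expR (6 / 10) * (4 * (r * (1 - r)))).
  rewrite lnM ?posrE// expRK => /(_ (mulr_gt0 e0 x0)).
  have := ler_wpM2r (ltW x0) expR_06_le; lra.
have h3 : r * (243 / 100) <= r * ln (1 + (expR 1 - 1) / r) by rewrite ler_wpM2l//; lra.
have h4 := sqr_ge0 (81 / 500 - r).
clear h1; lra.
Qed.

Lemma Phi1_ge : 419 / 500 <= Phi 1 :> R.
Proof.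
(* With the coefficients below, the derivative of [q] is [(1 - x^2/8)^4] without its positive term
   of degree 8, hence at most [expR (- x^2/2)], the fourth power of [expR (- x^2/8)]. *)
pose q (a b c x : R) : R := x - a * x ^+ 3 + b * x ^+ 5 - c * x ^+ 7.
pose k : R := normal_peak 1; have k0 : 0 < k := normal_peak_gt0'.
have D a b c x : 0 <= x <= 1 -> is_derive x 1 (fun x => k * q a b c x - Phi x)
    (k * (1 - 3 * a * x ^+ 2 + 5 * b * x ^+ 4 - 7 * c * x ^+ 6) - phi x).
  move=> _; have ? := is_derive_Phi x.
  by rewrite /q; apply: is_derive_eq; rewrite /GRing.scale/=; ring.
have [[a aE] [b bE] [c cE]] : [/\ exists a, 3 * a = 1 / 2 :> R,
    exists b, 5 * b = 3 / 32 :> R & exists c, 7 * c = 1 / 128 :> R].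
  by split; [exists (1 / 2 / 3)|exists (3 / 32 / 5)|exists (1 / 128 / 7)];
    rewrite mulrC divfK.
have : k * q a b c 1 - Phi 1 <= k * q a b c 0 - Phi 0.
  apply: (is_derive_le0_nincr ler01 (@D a b c)) => x x01.
  rewrite aE bE cE phiE -/k -mulrBr pmulr_rle0// subr_le0.
  have -> : - (x ^+ 2 / 2) = 4%:R * - (x ^+ 2 / 8) by field.
  rewrite expRM_natl; apply: le_trans (_ : (1 - x ^+ 2 / 8) ^+ 4 <= _); last first.
    by rewrite lerXn2r ?nnegrE ?expR_ge0//; [nra|exact: expR_ge1Dx].
  have := @exprn_even_ge0 _ 4 (x ^+ 2 / 8) isT; lra.
rewrite Phi0 /q !expr1n !expr0n/= => h.
have k2 : 10 / 63 <= k ^+ 2.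
  rewrite sqr_normal_peak1; have := pi_le; have := @pi_gt0 R.
  by move: pi => p p0 pl; rewrite -invf_div lef_pV2 ?posrE; lra.
have k1 : 199 / 500 <= k by rewrite leNgt; apply/negP => hk; nra.
have : 199 / 500 * (17 / 20) <= k * (1 - a + b - c) by apply: ler_pM; lra.
lra.
Qed.

End numeric_bounds.

(** * Information of a quantized normal observation *)

Local Opaque nprob.

Section normal_information.
Context {R : realType}.
Implicit Types (m x y z p q r : R) (A B : set R).
Let mu : {measure set _ -> \bar R} := @lebesgue_measure R.

Lemma nprob_setD m A B : measurable A -> measurable B ->
  nprob m A = nprob m (A `&` B) + nprob m (A `\` B).
Proof.
move=> mA mB; have mI := measurableI _ _ mA mB; have mD := measurableD mA mB.
apply: EFin_inj; rewrite EFinD -!nprobE// addeC.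
exact: measureDI.
Qed.

Lemma nprob_le_lin m0 m1 m2 (a b : R) A : measurable A -> 0 <= a -> 0 <= b ->
  (forall x, A x ->
     normal_pdf m0 1 x <= a * normal_pdf m1 1 x + b * normal_pdf m2 1 x) ->
  nprob m0 A <= a * nprob m1 A + b * nprob m2 A.
Proof.
move=> mA a0 b0 h; rewrite -lee_fin EFinD !EFinM -!(nprobE _ mA).
have mf m : measurable_fun A (fun x => (normal_pdf m 1 x)%:E).
  by apply: measurable_funTS; apply/measurable_EFinP; exact: measurable_normal_pdf.
have f0 m x : A x -> (0 <= (normal_pdf m 1 x)%:E)%E.
  by move=> _; rewrite lee_fin normal_pdf_ge0.
rewrite /normal_prob -!ge0_integralZl_EFin//; try by first [exact: f0|exact: mf].
have mZ k m : measurable_fun A (fun x => (k%:E * (normal_pdf m 1 x)%:E)%E).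
  by apply: measurable_funeM; exact: mf.
have Z0 k m x : 0 <= k -> A x -> (0 <= k%:E * (normal_pdf m 1 x)%:E)%E.
  by move=> k0 Ax; rewrite mule_ge0// f0.
rewrite -ge0_integralD//; try by first [exact: mZ|move=> *; exact: Z0].
apply: ge0_le_integral => //.
- exact: f0.
- exact: mf.
- by apply: emeasurable_funD; exact: mZ.
Qed.

Lemma nprob_le_scale m m' (a : R) A : measurable A -> 0 <= a ->
  (forall x, A x -> normal_pdf m 1 x <= a * normal_pdf m' 1 x) ->
  nprob m A <= a * nprob m' A.
Proof.
move=> mA a0 h; have := @nprob_le_lin m m' m' a 0 A mA a0 (lexx 0).
by rewrite mul0r addr0; apply => x Ax; rewrite mul0r addr0 h.
Qed.

(** Lagrangian form: a likelihood ratio set [B] maximizes [nprob m - k * nprob 0]. Only the two set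
    differences matter, and on each of them the densities compare in the right direction. *)
Lemma neyman_pearson m (k : R) A B : measurable A -> measurable B -> 0 < k ->
  (forall x, B x -> k * phi x <= normal_pdf m 1 x) ->
  (forall x, ~ B x -> normal_pdf m 1 x <= k * phi x) ->
  nprob m A + k * nprob 0 B <= nprob m B + k * nprob 0 A.
Proof.
move=> mA mB k0 hB hC.
have mAB := measurableD mA mB; have mBA := measurableD mB mA.
have h1 : nprob m (A `\` B) <= k * nprob 0 (A `\` B).
  by apply: nprob_le_scale => //; [exact: ltW|move=> x [_ /hC]].
have h2 : nprob 0 (B `\` A) <= k^-1 * nprob m (B `\` A).
  apply: nprob_le_scale => //; first by rewrite invr_ge0 ltW.
  by move=> x [Bx _]; rewrite mulrC ler_pdivlMr// mulrC; exact: hB.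
rewrite mulrC ler_pdivlMr// mulrC in h2.
rewrite (@nprob_setD m A B)// (@nprob_setD m B A)//.
rewrite (@nprob_setD 0 A B)// (@nprob_setD 0 B A)// (setIC B A).
move: h1 h2; move: (nprob m (A `\` B)) (nprob 0 (A `\` B)) (nprob m (B `\` A))
  (nprob 0 (B `\` A)) (nprob m (A `&` B)) (nprob 0 (A `&` B)) => *; lra.
Qed.

Lemma normal_pdf_ratio m x :
  normal_pdf m 1 x = expR (m * x - m ^+ 2 / 2) * phi x.
Proof.
rewrite normal_pdf1E phiE mulrCA -expRD; congr (_ * expR _).
by field.
Qed.

(** The most powerful test of [N(0,1)] against [N(n,1)] of a given size is a
    half-line, oriented by the sign of [n]. *)
Lemma nprob1_le (n : R) B y : `|n| = 1 -> measurable B -> nprob 0 B <= Phi y ->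
  nprob n B <= Phi (y + 1).
Proof.
move=> n1 mB By.
have [nE|nE] : n = 1 \/ n = - 1.
  by move: n1; case: ger0P => _ <-; [left|right; rewrite opprK].
- pose H := [set x : R | - y <= x].
  have HE k : nprob k H = Phi (y + k) by rewrite nprob_ge -PhiN; congr Phi; ring.
  pose k := expR (n * - y - n ^+ 2 / 2).
  have k0 : 0 < k by exact: expR_gt0.
  have mH : measurable H by rewrite /H -set_itvcy.
  have := @neyman_pearson n k B H mB mH k0.
  rewrite !HE addr0 nE => h.
  have kBy := ler_wpM2l (ltW k0) By.
  suff : nprob 1 B + k * Phi y <= Phi (y + 1) + k * nprob 0 B by lra.
  apply: h => x.
    move=> Hx; rewrite normal_pdf_ratio ler_wpM2r ?(ltW (phi_gt0 _))//.
    by rewrite /k nE ler_expR; rewrite /H/= in Hx; lra.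
  move=> /negP; rewrite -ltNge => Hx.
  rewrite normal_pdf_ratio ler_wpM2r ?(ltW (phi_gt0 _))//.
  by rewrite /k nE ler_expR; lra.
- pose H := [set` `]-oo, y]].
  have HE k : nprob k H = Phi (y - k) by rewrite nprob_itvNy.
  pose k := expR (n * y - n ^+ 2 / 2).
  have k0 : 0 < k by exact: expR_gt0.
  have mH : measurable H by exact: measurable_itv.
  have := @neyman_pearson n k B H mB mH k0.
  rewrite !HE subr0 nE opprK => h.
  have kBy := ler_wpM2l (ltW k0) By.
  suff : nprob (- 1) B + k * Phi y <= Phi (y + 1) + k * nprob 0 B by lra.
  apply: h => x.
    rewrite /H/= in_itv/= => Hx.
    rewrite normal_pdf_ratio ler_wpM2r ?(ltW (phi_gt0 _))//.
    by rewrite /k nE ler_expR; lra.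
  move=> /negP; rewrite /H/= in_itv/= -ltNge => Hx.
  rewrite normal_pdf_ratio ler_wpM2r ?(ltW (phi_gt0 _))//.
  by rewrite /k nE ler_expR; lra.
Qed.

Lemma nprob1_bounds (m : R) A z : `|m| = 1 -> measurable A -> nprob 0 A = Phi z ->
  Phi (z - 1) <= nprob m A <= Phi (z + 1).
Proof.
move=> m1 mA Az; rewrite (nprob1_le m1 mA) ?Az// andbT.
have := @nprob1_le m _ (- z) m1 (measurableC mA).
rewrite !nprobC// Az PhiN => /(_ (lexx _)).
have -> : - z + 1 = - (z - 1) by ring.
by rewrite PhiN; lra.
Qed.

(** [4 Phi z (1 - Phi z)] is at most [expR (- z^2/2)] by the mixture formula, and [Phi z] is at
    least [1/2]. *)
Lemma Phi_tail z : 0 <= z -> 1 - Phi z <= expR (- (z ^+ 2 / 2)) / 2.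
Proof.
move=> z0; have := Phi_mix z; have := mix_le z; rewrite mix0.
have := Phi_le z0; rewrite Phi0; have := Phi01 z; have := @pi_gt0 R.
move: (expR _) (mix z) (Phi z) => e v P; move: pi => p p0 P1 P2 h1 h2.
have h3 : 4 / p * v <= e.
  by rewrite mulrAC ler_pdivrMr//; lra.
nra.
Qed.

Lemma Phi_surj p : 0 < p < 1 -> exists z, Phi z = p.
Proof.
have half q : 1 / 2 <= q < 1 -> exists z, Phi z = q.
  (* A point where the tail is below [1 - q]: by [Phi_tail] it is at most [1 / (1 + y^2/2)], and
     [y <= 1 + y^2/2]. *)
  move=> q1; pose y := (1 - q)^-1.
  have y0 : 0 < y by rewrite invr_gt0; lra.
  have yq : q <= Phi y.
    have := @Phi_tail y (ltW y0).
    have e1 : expR (- (y ^+ 2 / 2)) <= (1 + y ^+ 2 / 2)^-1.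
      by rewrite expRN lef_pV2 ?posrE ?expR_gt0 ?expR_ge1Dx//; nra.
    have e2 : (1 + y ^+ 2 / 2)^-1 <= 1 - q.
      rewrite -[leRHS]invrK -/y lef_pV2 ?posrE//; nra.
    lra.
  have := @IVT R Phi 0 y q (ltW y0).
  rewrite Phi0; have -> : Num.min (1 / 2) (Phi y) = 1 / 2 by apply/min_idPl; lra.
  have -> : Num.max (1 / 2) (Phi y) = Phi y by apply/max_idPr; lra.
  case.
  - by apply: derivable_within_continuous => x _; have [] := is_derive_Phi x.
  - lra.
  - by move=> c _ <-; exists c.
move=> p01; have [p2|p2] := leP (1 / 2) p; first by apply: half; lra.
have [|z zE] := half (1 - p); first lra.
by exists (- z); rewrite PhiN zE; ring.
Qed.

(** Absolute continuity drawn from [nprob1_le]: a null set has size at most [Phi (z - 1)] for every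
    [z], hence power at most [Phi z], and [Phi z] may be taken equal to half the power. *)
Lemma nprob_null (m : R) A : `|m| = 1 -> measurable A -> nprob 0 A = 0 -> nprob m A = 0.
Proof.
move=> m1 mA A0; apply/eqP; rewrite eq_le nprob_ge0 andbT.
rewrite leNgt; apply/negP => qp.
have q1 := nprob_le1 m mA.
have [|z zE] := @Phi_surj (nprob m A / 2); first lra.
have := @nprob1_le m A (z - 1) m1 mA.
rewrite subrK zE A0 => /(_ (ltW _)); have := Phi01 (z - 1); lra.
Qed.

End normal_information.

Local Opaque Phi phi mix.

(** * Information of a half-line as a function of its threshold *)

Section quantized_information.
Context {R : realType}.
Implicit Types (m x y z p q r : R) (A B : set R).

Let w z : R := Phi z * (1 - Phi z).

Let w_gt0 z : 0 < w z.
Proof. by rewrite /w mulr_gt0//; have := Phi01 z; lra. Qed.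

Let mixE z : mix z = pi * w z.
Proof.
have := Phi_mix z; have := @pi_gt0 R; rewrite /w.
move: (mix z) (Phi z) => v P; move: pi => p p0 h.
have -> : P * (1 - P) = v / p by lra.
by rewrite mulrC divfK// gt_eqF.
Qed.

(** [mix_shift] in terms of [w]; the factor 16 is the inverse square of [w 0 = 1/4], which gives
    equality at [z = 0]. *)
Let w_shift z : 16 * (w z * w 1) ^+ 2 <= w (z + 1) * w (z - 1).
Proof.
have := mix_shift z; rewrite mix0 !mixE; have := @pi_gt0 R.
move: (w _) (w _) (w _) (w _) => a b c e; move: pi => p p0 h.
have p4 : 0 < p ^+ 4 / 16 by rewrite divr_gt0// exprn_gt0.
rewrite -(ler_pM2l p4); lra.
Qed.

Let sqr_phi x : phi x ^+ 2 = (2 * pi)^-1 * expR (- x ^+ 2).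
Proof.
rewrite phiE exprMn sqr_normal_peak1 expr2 -expRD; congr (_ * expR _).
by field.
Qed.

Let phi_w x y : `|x| <= `|y| -> phi y ^+ 2 * w x <= phi x ^+ 2 * w y.
Proof.
move=> /mix_expR_le; rewrite !mixE !sqr_phi !expRN; have := @pi_gt0 R.
have := expR_gt0 (x ^+ 2); have := expR_gt0 (y ^+ 2).
move: (expR _) (expR _) (w x) (w y) => a b u v a0 b0; move: pi => p p0 h.
rewrite -!mulrA; apply: ler_wpM2l; first by rewrite invr_ge0; lra.
rewrite [b^-1 * u]mulrC [a^-1 * v]mulrC ler_pdivrMr// mulrAC ler_pdivlMr//.
have : p * (a * u) <= p * (b * v) by lra.
rewrite ler_pM2l//; lra.
Qed.

Let phi_over_w x y : `|x| <= `|y| -> phi x / w x <= phi y / w y.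
Proof.
move=> /mix_expR_half_ge; rewrite !mixE !phiE !expRN; have := @pi_gt0 R.
have := expR_gt0 (x ^+ 2 / 2); have := expR_gt0 (y ^+ 2 / 2).
have := w_gt0 x; have := w_gt0 y.
move: (expR _) (expR _) (w x) (w y) => a b u v u0 v0 a0 b0; move: pi => p p0 h.
rewrite -!mulrA ler_wpM2l ?normal_peak_ge0// -!invfM lef_pV2 ?posrE ?mulr_gt0//.
have : p * (b * v) <= p * (a * u) by lra.
by rewrite ler_pM2l.
Qed.

Let is_derive_lnPhi z : is_derive z 1 (fun z => ln (Phi z)) (phi z / Phi z).
Proof.
have d1 := @is_derive1_ln R (Phi z) ltac:(by have := Phi01 z; lra).
have d2 := @is_derive1_comp R (@ln R) Phi z _ _ d1 (is_derive_Phi z).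
by apply: is_derive_eq; rewrite mulrC.
Qed.

Let is_derive_lnPhiC z : is_derive z 1 (fun z => ln (1 - Phi z)) (- (phi z / (1 - Phi z))).
Proof.
have d1 := @is_derive1_ln R (1 - Phi z) ltac:(by have := Phi01 z; lra).
have d3 : is_derive z 1 (fun z => 1 - Phi z) (0 - phi z).
  by apply: is_deriveB; exact: is_derive_Phi.
have d2 := @is_derive1_comp R (@ln R) (fun z => 1 - Phi z) z _ _ d1 d3.
by apply: is_derive_eq; rewrite sub0r mulrN mulrC.
Qed.

Let is_derive_shift (f df : R -> R) (a k : R) z : (forall z, is_derive z 1 f (df z)) ->
  is_derive z 1 (fun z => f (a + k * z)) (k * df (a + k * z)).
Proof.
move=> fdf.
have d1 : is_derive z 1 (fun z : R => a + k * z) k.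
  by apply: is_derive_eq; rewrite /GRing.scale/=; ring.
have ? := @is_derive1_comp R f (fun z => a + k * z) z _ _ (fdf _) d1.
by apply: is_derive_eq; rewrite mulrC.
Qed.

Let log_odds z : R := ln (Phi z) - ln (1 - Phi z).

Let is_derive_log_odds z : is_derive z 1 log_odds (phi z / w z).
Proof.
have ? := is_derive_lnPhi z; have ? := is_derive_lnPhiC z.
rewrite /log_odds; apply: is_derive_eq; have := Phi01 z; rewrite /w => P01.
by field; rewrite !lt0r_neq0//; lra.
Qed.

(** The slope [phi / w] of [log_odds] grows with the absolute value of its argument, and
    [|z - s| <= z + s] for [z], [s >= 0], so the gain on the right of [z] exceeds the loss on the
    left even where [z - s] is negative. *)
Let log_odds_midpoint z : 0 <= z ->
  2 * log_odds z <= log_odds (z + 1) + log_odds (z - 1).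
Proof.
move=> z0.
pose f s : R := 2 * log_odds z - log_odds (z + 1 * s) - log_odds (z + (- 1) * s).
pose df s : R := - (1 * (phi (z + 1 * s) / w (z + 1 * s))) -
  (- 1) * (phi (z + (- 1) * s) / w (z + (- 1) * s)).
have D (s : R) : 0 <= s <= 1 -> is_derive s 1 f (df s).
  move=> _.
  have ? := @is_derive_shift log_odds _ z 1 s is_derive_log_odds.
  have ? := @is_derive_shift log_odds _ z (- 1) s is_derive_log_odds.
  by rewrite /f; apply: is_derive_eq; rewrite /df; ring.
have : f 1 <= f 0.
  apply: (is_derive_le0_nincr ler01 D) => s s01.
  have := @phi_over_w (z + (- 1) * s) (z + 1 * s); rewrite /df.
  suff : `|z + (- 1) * s| <= `|z + 1 * s| by move=> h /(_ h); lra.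
  rewrite [leRHS]ger0_norm; last lra.
  by rewrite ler_norml; lra.
rewrite /f !mulr0 !addr0 mulr1 mulN1r; lra.
Qed.

Let w_eq z : ln (w z) = ln (Phi z) + ln (1 - Phi z).
Proof. by rewrite /w lnM ?posrE//; have := Phi01 z; lra. Qed.

(** The left-hand side is a weighted mean of minus the second differences of
    [ln Phi] and [ln (1 - Phi)] at [z]: by [log_odds_midpoint] the larger of them
    has the smaller weight, and [w_shift] bounds their plain mean. *)
Lemma kl_opposite_sides z :
  kl (Phi z) (Phi (z - 1)) + kl (Phi z) (Phi (z + 1)) <= 2 * kl (1 / 2) (Phi 1).
Proof.
have pos y : 0 <= y ->
    kl (Phi y) (Phi (y - 1)) + kl (Phi y) (Phi (y + 1)) <= 2 * kl (1 / 2) (Phi 1).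
  move=> y0.
  have h1 := log_odds_midpoint y0; rewrite /log_odds in h1.
  have w2 : 0 < w y * w 1 by exact: mulr_gt0.
  have ww2 : 0 < (w y * w 1) ^+ 2 by exact: exprn_gt0.
  have ww0 : 0 < 16 * (w y * w 1) ^+ 2 by apply: mulr_gt0.
  have h2 : ln (16 * (w y * w 1) ^+ 2) <= ln (w (y + 1) * w (y - 1)).
    by rewrite ler_ln ?posrE; [exact: w_shift|exact: ww0|exact: mulr_gt0].
  have l16 : ln 16 = - 4 * ln (1 / 2) :> R.
    have -> : (16 : R) = (1 / 2) ^- 4 by rewrite -exprVn invf_div; lra.
    by rewrite lnV ?posrE ?exprn_gt0// ln_exprn//; ring.
  rewrite (lnM _ ww2) ?posrE// (ln_exprn _ w2) (lnM (w_gt0 _) (w_gt0 _)) in h2.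
  rewrite (lnM (w_gt0 _) (w_gt0 _)) !w_eq l16 in h2.
  have h3 := Phi_le y0; rewrite Phi0 in h3.
  have h12 : 1 - 1 / 2 = 1 / 2 :> R by field.
  rewrite !klE ?Phi01//; [|lra]; rewrite h12.
  move: h1 h2 h3; move: (Phi y) (ln (Phi y)) (ln (1 - Phi y)) (ln (Phi (y - 1)))
    (ln (1 - Phi (y - 1))) (ln (Phi (y + 1))) (ln (1 - Phi (y + 1)))
    (ln (Phi 1)) (ln (1 - Phi 1)) (ln (1 / 2)) => P a b c d e f g h i h1 h2 h3.
  have : 0 <= (P - 1 / 2) * ((2 * b - d - f) - (2 * a - c - e)).
    by apply: mulr_ge0; lra.
  lra.
have [|z0] := leP 0 z; first exact: pos.
have e1 : - z - 1 = - (z + 1) by ring.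
have e2 : - z + 1 = - (z - 1) by ring.
by have := pos (- z); rewrite e1 e2 !PhiN !klC addrC; apply; lra.
Qed.

(** With [P = Phi s], [Q = Phi (s - 1)] and [x] the ratio of their odds, the derivative is [phi s *
    ln x - phi (s - 1) * (P - Q) / (Q (1 - Q))]. The bound [ln x <= (x - 1) / sqrt x] is the right
    one here: it reduces the sign to an inequality whose square is exactly [phi_w] for [s - 1] and
    [s]. *)
Lemma kl_shift_nincr z : 1 <= z -> kl (Phi z) (Phi (z - 1)) <= kl (Phi 1) (1 / 2).
Proof.
move=> z1.
pose f s : R := Phi s * (ln (Phi s) - ln (Phi (- 1 + 1 * s))) +
  (1 - Phi s) * (ln (1 - Phi s) - ln (1 - Phi (- 1 + 1 * s))).
pose df s : R := phi s * (ln (Phi s) - ln (Phi (- 1 + 1 * s)) - ln (1 - Phi s)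
    + ln (1 - Phi (- 1 + 1 * s))) +
  phi (- 1 + 1 * s) * (- (Phi s / Phi (- 1 + 1 * s)) + (1 - Phi s) / (1 - Phi (- 1 + 1 * s))).
have D (s : R) : 1 <= s <= z -> is_derive s 1 f (df s).
  move=> _.
  have ? := is_derive_Phi s; have ? := is_derive_lnPhi s; have ? := is_derive_lnPhiC s.
  have ? := @is_derive_shift (fun z => ln (Phi z)) _ (- 1) 1 s is_derive_lnPhi.
  have ? := @is_derive_shift (fun z => ln (1 - Phi z)) _ (- 1) 1 s is_derive_lnPhiC.
  rewrite /f; apply: is_derive_eq; rewrite /df /GRing.scale/=.
  have := Phi01 s; have := Phi01 (- 1 + 1 * s).
  move: (ln _) (ln _) (ln _) (ln _) => a b c d; move: (Phi s) (Phi _) => P Q P01 Q01.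
  by field; rewrite !lt0r_neq0//; lra.
have : f z <= f 1.
  apply: (is_derive_le0_nincr z1 D) => s s1; rewrite /df.
  have -> : -1 + 1 * s = s - 1 by ring.
  have PQ := @Phi_lt R (s - 1) s ltac:(lra).
  have wI := @phi_w (s - 1) s ltac:(by rewrite !ger0_norm; lra).
  have P01 := Phi01 s; have Q01 := Phi01 (s - 1).
  have f0 := phi_gt0 s; have g0 := phi_gt0 (s - 1).
  rewrite /w in wI.
  move: (Phi s) (Phi (s - 1)) (phi s) (phi (s - 1)) PQ P01 Q01 f0 g0 wI => P Q u v PQ P01 Q01 u0 v0 wI.
  have x1 : 1 <= P * (1 - Q) / (Q * (1 - P)) by rewrite ler_pdivlMr ?mulr_gt0//; lra.
  have := ln_le_sqrt x1; set y := Num.sqrt _ => hl.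
  have y0 : 0 < y by rewrite sqrtr_gt0; lra.
  have y2 : y ^+ 2 = P * (1 - Q) / (Q * (1 - P)) by rewrite sqr_sqrtr//; lra.
  have k1 : u * (1 - Q) <= v * (1 - P) * y.
    rewrite -(@ler_pXn2r _ 2) ?nnegrE ?mulr_ge0//; try lra.
    have -> : (v * (1 - P) * y) ^+ 2 = (1 - Q) / Q * (v ^+ 2 * (P * (1 - P))).
      by rewrite !exprMn y2; field; rewrite !lt0r_neq0//; lra.
    have -> : (u * (1 - Q)) ^+ 2 = (1 - Q) / Q * (u ^+ 2 * (Q * (1 - Q))).
      by field; rewrite !lt0r_neq0//; lra.
    by apply: ler_wpM2l => //; apply: divr_ge0; lra.
  rewrite ln_div ?posrE ?mulr_gt0// in hl; try lra.
  rewrite !lnM ?posrE// in hl; try lra.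
  have k2 : u * (ln P - ln Q - ln (1 - P) + ln (1 - Q)) <=
      u * ((P * (1 - Q) / (Q * (1 - P)) - 1) / y).
    by apply: ler_wpM2l; lra.
  have e3 : u * ((P * (1 - Q) / (Q * (1 - P)) - 1) / y) =
      u * (1 - Q) * ((P - Q) / (Q * (1 - P) * (1 - Q) * y)).
    by field; rewrite !lt0r_neq0//; lra.
  have k3 : u * (1 - Q) * ((P - Q) / (Q * (1 - P) * (1 - Q) * y)) <=
      v * (1 - P) * y * ((P - Q) / (Q * (1 - P) * (1 - Q) * y)).
    by apply: ler_wpM2r => //; rewrite divr_ge0 ?mulr_ge0//; lra.
  have e4 : v * (1 - P) * y * ((P - Q) / (Q * (1 - P) * (1 - Q) * y)) =
      - (v * (- (P / Q) + (1 - P) / (1 - Q))).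
    by field; rewrite !lt0r_neq0//; lra.
  lra.
have e1 : -1 + 1 * z = z - 1 by ring.
have e2 : -1 + 1 * 1 = 0 :> R by ring.
by rewrite /f e1 e2 Phi0 !klE ?Phi01//; lra.
Qed.

End quantized_information.

(** * One quantizer against both alternatives *)

Section information_against_both_alternatives.
Context {R : realType}.
Implicit Types (m x y z p q r : R) (A B : set R).

Lemma kl_same_side_le p q1 q2 z : p = Phi z ->
  Phi (z - 1) <= q1 <= p -> Phi (z - 1) <= q2 <= p -> p ^+ 2 <= expR 1 * (q1 * q2) ->
  kl p q1 + kl p q2 <= 2 * kl (1 / 2) (Phi 1).
Proof.
move=> pE h1 h2 hp; have p01 : 0 < p < 1 by rewrite pE Phi01.
have Z01 := Phi01 (z - 1); have F1 := Phi01 (1 : R); have F1g := @Phi1_ge R.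
have [z1|z1] := leP 1 z.
  have D : kl p (Phi (z - 1)) <= kl (1 / 2) (Phi 1).
    rewrite pE; apply: le_trans (kl_shift_nincr z1) _.
    by apply: kl_half; lra.
  case/andP: Z01 => Z0 _; case/andP: p01 => _ p1.
  case/andP: h1 => l1 u1; case/andP: h2 => l2 u2.
  have k1 := le_trans (kl_anti_r Z0 l1 u1 p1) D.
  have k2 := le_trans (kl_anti_r Z0 l2 u2 p1) D.
  lra.
have e1 := @expR1_ge R; have e0 := expR_gt0 (1 : R).
have k1 := @kl_same_side R p q1 q2 p01 ltac:(lra) ltac:(lra).
have k2 : kl p (q1 * q2 / p) <= kl p (p / expR 1).
  apply: kl_anti_r.
  - by apply: divr_gt0; lra.
  - rewrite ler_pdivrMr// mulrAC ler_pdivlMr; last lra.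
    by rewrite -expr2 mulrC.
  - rewrite ler_pdivrMr; last lra.
    by apply: ler_pM; lra.
  - lra.
have k3 : kl p (p / expR 1) = 1 - (1 - p) * ln (1 + (expR 1 - 1) / (1 - p)).
  have pe : 0 < p / expR 1 < 1.
    by rewrite divr_gt0 ?ltr_pdivrMr//=; lra.
  rewrite klE// ln_div ?posrE; [|lra|lra]; rewrite expRK.
  have -> : 1 + (expR 1 - 1) / (1 - p) = expR 1 * (1 - p / expR 1) / (1 - p).
    by field; rewrite !lt0r_neq0//; lra.
  rewrite ln_div ?posrE ?mulr_gt0//; try lra.
  by rewrite lnM ?posrE ?expRK//; [ring|lra].
have r1 : 1 - Phi 1 <= 1 - p by rewrite pE; have := Phi_le (ltW z1); lra.
have k4 := @mul_ln1p_mono R (expR 1 - 1) (1 - Phi 1) (1 - p) ltac:(lra) ltac:(lra) r1.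
have k5 := @log_bound R (1 - Phi 1) ltac:(lra).
have h12 : 1 - 1 / 2 = 1 / 2 :> R by field.
have k6 : 2 * kl (1 / 2) (Phi (1 : R)) = - ln (4 * ((1 - Phi 1) * (1 - (1 - Phi 1)))).
  have l4 : ln 4 = - 2 * ln (1 / 2) :> R.
    have -> : (4 : R) = (1 / 2) ^- 2 by rewrite -exprVn invf_div; lra.
    by rewrite lnV ?posrE ?exprn_gt0// ln_exprn//; ring.
  have f0 : 0 < Phi (1 : R) by lra.
  have f1 : 0 < 1 - Phi (1 : R) by lra.
  rewrite subKr klE ?h12; [|lra|lra].
  rewrite (lnM _ (mulr_gt0 f1 f0)) ?posrE// (lnM f1 f0) l4.
  by field.
lra.
Qed.

(** Cauchy-Schwarz, as [N(0,1)] has density [sqrt (e g1 g2)]. *)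
Lemma nprob_cauchy_schwarz B : measurable B ->
  nprob 0 B ^+ 2 <= expR 1 * (nprob (- 1) B * nprob 1 B).
Proof.
have n1 : `|1| = 1 :> R by rewrite normr1.
have nN1 : `|- 1| = 1 :> R by rewrite normrN normr1.
move=> mB; set p := nprob 0 B; set a := nprob (- 1) B; set b := nprob 1 B.
have p0 : 0 <= p := nprob_ge0 _ _.
have a0 : 0 <= a := nprob_ge0 _ _.
have b0 : 0 <= b := nprob_ge0 _ _.
have key k : 0 < k -> 2 * p <= expR (1 / 2) * (k * a + k^-1 * b).
  move=> k0; have e0 := expR_gt0 (1 / 2 : R).
  have : p <= expR (1 / 2) * k / 2 * a + expR (1 / 2) / k / 2 * b.
    apply: nprob_le_lin => //.
    - by rewrite !mulr_ge0// ltW.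
    - by rewrite !mulr_ge0// ?invr_ge0 ltW.
    - move=> x _; rewrite (normal_pdf_ratio (- 1)) (normal_pdf_ratio 1) -/(phi x).
      rewrite !mulrA -mulrDl ler_peMl ?(ltW (phi_gt0 _))//.
      have -> : expR (1 / 2) * k / 2 * expR (- 1 * x - (- 1) ^+ 2 / 2) +
          expR (1 / 2) / k / 2 * expR (1 * x - 1 ^+ 2 / 2) =
          (k * expR (- x) + k^-1 * expR x) / 2.
        have -> : expR (- 1 * x - (- 1) ^+ 2 / 2) = expR (- x) / expR (1 / 2).
          by rewrite -expRB; congr expR; field.
        have -> : expR (1 * x - 1 ^+ 2 / 2) = expR x / expR (1 / 2).
          by rewrite -expRB; congr expR; field.
        by field; rewrite !lt0r_neq0.
      rewrite expRN; have := expR_gt0 x; move: (expR x) => y y0.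
      have -> : (k * y^-1 + k^-1 * y) / 2 = 1 + (k - y) ^+ 2 / (2 * (k * y)).
        by field; rewrite !lt0r_neq0.
      by rewrite lerDl divr_ge0 ?sqr_ge0 ?mulr_ge0 ?ltW.
  by lra.
have e2 : expR (1 / 2) ^+ 2 = expR 1 :> R.
  by rewrite expr2 -expRD; congr expR; field.
have [pz|pp] := eqVneq p 0.
  by rewrite pz expr0n/= mulr_ge0 ?expR_ge0 ?mulr_ge0.
have {}p0 : 0 < p by rewrite lt0r pp.
have [z pz] : exists z, Phi z = p \/ p = 1.
  have [p1|p1] := ltP p 1; last first.
    by exists 0; right; apply/eqP; rewrite eq_le p1 nprob_le1.
  by have [|z zE] := @Phi_surj R p; [lra|exists z; left].
have {}a0 : 0 < a.
  case: pz => [pz|pz].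
    have := @nprob1_bounds R (- 1) B z nN1 mB (esym pz).
    by have := Phi01 (z - 1); rewrite -/a; lra.
  have := @nprob_null R (- 1) (~` B) nN1 (measurableC mB).
  by rewrite !nprobC// -/p -/a pz subrr => /(_ erefl); lra.
have e0 := expR_gt0 (1 / 2 : R).
(* The free parameter of [key] is set so that the first of its two terms equals [p]; the second one
   then has to be at least [p]. *)
pose k := p / (expR (1 / 2) * a).
have := key k; rewrite /k divr_gt0 ?mulr_gt0// => /(_ isT).
have -> : expR (1 / 2) * (p / (expR (1 / 2) * a) * a + (p / (expR (1 / 2) * a))^-1 * b) =
    p + expR (1 / 2) ^+ 2 * a * b / p by field; rewrite !lt0r_neq0.
rewrite e2 => h.
have : p <= expR 1 * a * b / p by lra.
by rewrite ler_pdivlMr// expr2 mulrA.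
Qed.

(** Averaged over the two alternatives, no quantizer is more informative under
    [N(0,1)] than the sign of the observation. *)
Lemma kl_sum_le A : measurable A ->
  kl (nprob 0 A) (nprob (- 1) A) + kl (nprob 0 A) (nprob 1 A) <=
  2 * kl (1 / 2) (Phi 1).
Proof.
have n1 : `|1| = 1 :> R by rewrite normr1.
have nN1 : `|- 1| = 1 :> R by rewrite normrN normr1.
have I0 : 0 <= 2 * kl (1 / 2) (Phi 1) :> R.
  by rewrite mulr_ge0// kl_ge0 ?Phi01//; lra.
have kl00 : kl 0 0 = 0 :> R.
  by rewrite /kl mul0r add0r subr0 divr1 ln1 mulr0.
have cs := nprob_cauchy_schwarz.
move=> mA; have mC := measurableC mA.
have csA := cs _ mA; have csC := cs _ mC; rewrite !nprobC// in csC.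
have null0 (m : R) B : `|m| = 1 -> measurable B -> nprob 0 B = 0 -> nprob m B = 0.
  exact: nprob_null.
have [p0|p0] := eqVneq (nprob 0 A) 0.
  by rewrite (null0 _ _ n1 mA p0) (null0 _ _ nN1 mA p0) p0 kl00 addr0.
have [p1|p1] := eqVneq (nprob 0 A) 1.
  have c0 : nprob 0 (~` A) = 0 by rewrite nprobC// p1 subrr.
  rewrite -(klC _ (nprob (- 1) A)) -(klC _ (nprob 1 A)) -!(nprobC _ mA).
  by rewrite (null0 _ _ n1 mC c0) (null0 _ _ nN1 mC c0) c0 kl00 addr0.
have p01 : 0 < nprob 0 A < 1.
  by rewrite lt0r p0 nprob_ge0/= lt_neqAle p1 nprob_le1.
have [z zE] := Phi_surj p01.
have b1 := nprob1_bounds nN1 mA (esym zE).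
have b2 := nprob1_bounds n1 mA (esym zE).
move: (nprob 0 A) (nprob (- 1) A) (nprob 1 A) zE p01 csA csC b1 b2 =>
  p q1 q2 zE p01 csA csC /andP[l1 u1] /andP[l2 u2].
have opp := kl_opposite_sides z; rewrite zE in opp.
have anti q : Phi (z - 1) <= q -> q <= p -> kl p q <= kl p (Phi (z - 1)).
  case/andP: (Phi01 (z - 1)) => Z0 _; case/andP: p01 => _ p1' h1 h2.
  exact: kl_anti_r.
have mono q : p <= q -> q <= Phi (z + 1) -> kl p q <= kl p (Phi (z + 1)).
  case/andP: (Phi01 (z + 1)) => _ Z1; case/andP: p01 => p0' _ h1 h2.
  exact: kl_mono_r.
(* Probabilities on opposite sides of [p] are pushed to the extremes [Phi (z - 1)] and
   [Phi (z + 1)]; both above [p] becomes both below after complementation, with [- z] for [z]. *)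
have [a1|a1] := leP q1 p; have [a2|a2] := leP q2 p.
- by apply: (@kl_same_side_le p q1 q2 z); rewrite ?zE// ?l1 ?l2.
- exact: le_trans (lerD (anti _ l1 a1) (mono _ (ltW a2) u2)) opp.
- by rewrite addrC; exact: le_trans (lerD (anti _ l2 a2) (mono _ (ltW a1) u1)) opp.
- rewrite -(klC p q1) -(klC p q2).
  apply: (@kl_same_side_le _ _ _ (- z)) => //.
  + by rewrite PhiN zE.
  + have -> : - z - 1 = - (z + 1) by ring.
    by rewrite PhiN !lerD2l !lerN2 u1 ltW.
  + have -> : - z - 1 = - (z + 1) by ring.
    by rewrite PhiN !lerD2l !lerN2 u2 ltW.
Qed.

End information_against_both_alternatives.

(** * Quantizers *)

Section quantizers.
Context {R : realType}.
Implicit Types (f : R -> bool) (j i : hyp) (b : bool).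

Lemma measurable_preimage_bool f b : measurable_fun [set: R] f ->
  measurable [set x | f x = b].
Proof.
move=> mf; rewrite (_ : [set x | f x = b] = [set: R] `&` f @^-1` [set b]); last first.
  by apply/seteqP; split => x //= [].
exact: mf.
Qed.

Lemma message_probE f j b : message_prob f j b = nprob (mean j) [set x | f x = b].
Proof. by []. Qed.

Lemma message_prob_ge0 f j b : 0 <= message_prob f j b.
Proof. exact: nprob_ge0. Qed.

Lemma message_probN f j : measurable_fun [set: R] f ->
  message_prob f j false = 1 - message_prob f j true.
Proof.
move=> mf; rewrite !message_probE -nprobC; last exact: measurable_preimage_bool.
by congr nprob; apply/seteqP; split => x /=; case: (f x).
Qed.

Definition info f j i : R := kl (message_prob f j true) (message_prob f i true).

Lemma ptailE (l : R) j : ptail l j = 1 - Phi (l - mean j).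
Proof. by rewrite -nprob_ge. Qed.

Lemma I_fE : I_f = kl (1 / 2) (Phi (1 : R)).
Proof.
rewrite /I_f !ptailE /= subr0 Phi0.
have -> : 0 - -1 = 1 :> R by ring.
by rewrite -(klC (1 / 2)); congr (kl _ _); field.
Qed.

Lemma info_f_le f : measurable_fun [set: R] f ->
  info f Hf Hg1 + info f Hf Hg2 <= 2 * I_f.
Proof.
by move=> mf; rewrite I_fE; apply: kl_sum_le; exact: measurable_preimage_bool.
Qed.

Lemma kl_gE (l : R) : kl_g l = kl (Phi (1 - l)) (Phi (- l)).
Proof.
rewrite /kl_g !ptailE /= subr0 -!PhiN.
by congr (kl (Phi _) _); ring.
Qed.

Lemma I_gE (l : R) : (forall l', kl_g l' <= kl_g l) -> I_g = kl_g l.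
Proof.
move=> lmax; apply/eqP; rewrite eq_le; apply/andP; split.
  by apply: ge_sup; [exists (kl_g l), l|move=> _ [l' _ <-]].
by apply: ub_le_sup; [exists (kl_g l) => _ [l' _ <-]|exists l].
Qed.

Lemma norm_mean_g i : i != Hf -> `|mean i| = 1 :> R.
Proof. by move=> /eqP; case: i => // _; [exact: normrN1|exact: normr1]. Qed.

(** Makes likelihood ratios of messages positive and finite, except on branches that are null under
    every hypothesis. *)
Lemma message_prob_null f i b : measurable_fun [set: R] f ->
  (message_prob f i b == 0) = (message_prob f Hf b == 0).
Proof.
move=> mf; have mA := @measurable_preimage_bool f b mf.
have [->//|/norm_mean_g iN] := eqVneq i Hf.
rewrite !message_probE; move: mA; set A := [set x | _] => mA; rewrite [mean Hf]/=.
have [A0|A0] := eqVneq (nprob 0 A) 0; first by rewrite (nprob_null iN mA A0) eqxx.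
apply: negbTE; have [A1|A1] := eqVneq (nprob 0 A) 1.
  have := nprob_null iN (measurableC mA); rewrite !nprobC// A1 subrr => /(_ erefl).
  by move/eqP; rewrite subr_eq0 eq_sym => /eqP ->; rewrite oner_eq0.
have [|z zE] := @Phi_surj R (nprob 0 A).
  by rewrite lt0r A0 nprob_ge0/= lt_neqAle A1 nprob_le1.
have /andP[h _] := nprob1_bounds iN mA (esym zE).
by rewrite gt_eqF// (lt_le_trans _ h)//; case/andP: (Phi01 (z - 1)).
Qed.

(** At given size [Phi z] under [f] the information is monotone in the power, hence largest at one
    of the two extreme powers. These belong to half-lines: the thresholds [- z] and, after
    complementation and reflection, [z]. *)
Lemma info_g_le (l : R) f i : (forall l', kl_g l' <= kl_g l) -> 0 < kl_g l ->
  measurable_fun [set: R] f -> i != Hf -> info f i Hf <= kl_g l.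
Proof.
move=> lmax l0 mf iN; have mA := @measurable_preimage_bool f true mf.
rewrite /info !message_probE; move: mA; set A := [set x | _] => mA; rewrite [mean Hf]/=.
have n1 := norm_mean_g iN.
have kl00 : kl 0 0 = 0 :> R.
  by rewrite /kl mul0r add0r subr0 divr1 ln1 mulr0.
have [A0|A0] := eqVneq (nprob 0 A) 0.
  by rewrite A0 (nprob_null n1 mA A0) kl00 ltW.
have [A1|A1] := eqVneq (nprob 0 A) 1.
  have c0 : nprob 0 (~` A) = 0 by rewrite nprobC// A1 subrr.
  rewrite -klC -!(nprobC _ mA) c0 (nprob_null n1 (measurableC mA) c0).
  by rewrite kl00 ltW.
have [|z zE] := @Phi_surj R (nprob 0 A).
  by rewrite lt0r A0 nprob_ge0/= lt_neqAle A1 nprob_le1.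
have /andP[h1 h2] := nprob1_bounds n1 mA (esym zE).
rewrite -zE; have [q1|q1] := leP (Phi z) (nprob (mean i) A).
  apply: le_trans (lmax (- z)); rewrite kl_gE !opprK addrC.
  apply: kl_mono_l => //; first by case/andP: (Phi01 z).
  by case/andP: (Phi01 (z + 1)).
apply: le_trans (lmax z); rewrite kl_gE -klC PhiN.
have -> : 1 - z = - (z - 1) by ring.
rewrite PhiN; apply: kl_mono_l.
- by rewrite subr_gt0; case/andP: (Phi01 z).
- by rewrite lerD2l lerN2 ltW.
- by rewrite lerD2l lerN2.
- by rewrite ltrBlDr ltrDl; case/andP: (Phi01 (z - 1)).
Qed.

Variable lambda : R.
Local Notation sq := (stage_quantizer lambda).
Local Notation thr := (stage_threshold lambda).

Lemma stage_message_prob s j : message_prob (sq s) j true = 1 - Phi (thr s - mean j).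
Proof. by rewrite message_probE -nprob_ge. Qed.

Lemma stage_message_prob_gt0 s j b : 0 < message_prob (sq s) j b.
Proof.
have /andP[h1 h2] := Phi01 (thr s - mean j).
case: b; last rewrite message_probN; try exact: stage_quantizer_measurable.
  by rewrite stage_message_prob subr_gt0.
by rewrite stage_message_prob subKr.
Qed.

Lemma stage_message_prob01 s j : 0 < message_prob (sq s) j true < 1.
Proof.
rewrite stage_message_prob_gt0/= -subr_gt0 -message_probN.
  exact: stage_message_prob_gt0.
exact: stage_quantizer_measurable.
Qed.

Lemma mean_inj : injective (mean : hyp -> R).
Proof. by case; case => //= h; exfalso; lra. Qed.

Lemma stage_info_gt0 s j i : j != i -> 0 < info (sq s) j i.
Proof.
move=> ji; apply: kl_gt0; [exact: stage_message_prob01|exact: stage_message_prob01|].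
have Phi_inj : injective (Phi : R -> R).
  move=> x y xy; have [|h|//] := ltgtP x y.
    by move/Phi_lt; rewrite xy ltxx.
  by have := Phi_lt h; rewrite xy ltxx.
apply: contra ji => /eqP; rewrite !stage_message_prob => h.
have := Phi_inj (thr s - mean j) (thr s - mean i).
have e : Phi (thr s - mean j) = Phi (thr s - mean i) by lra.
by move=> /(_ e) me; apply/eqP; apply: mean_inj; lra.
Qed.

Lemma info_half i s : i != Hf -> s = None \/ s = Some Hf -> info (sq s) Hf i = I_f.
Proof.
move=> iN sE; have t0 : thr s = 0 by case: sE => ->.
rewrite /info !stage_message_prob t0 I_fE /= subr0 Phi0.
move/eqP: iN; case: i => //= _.
  rewrite sub0r opprK -(klC (1 / 2)); congr (kl _ _); field.
by rewrite sub0r PhiN subKr; congr (kl _ _); field.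
Qed.

Lemma info_lambda i : i != Hf -> info (sq (Some i)) i Hf = kl_g lambda.
Proof.
move=> /eqP; rewrite /info !stage_message_prob kl_gE; case: i => //= _.
  have -> : - lambda - -1 = 1 - lambda by ring.
  by rewrite klC subr0.
have -> : lambda - 1 = - (1 - lambda) by ring.
by rewrite !PhiN subr0 subKr.
Qed.

Lemma I_f_gt0 : 0 < I_f :> R.
Proof.
rewrite I_fE; apply: kl_gt0; [lra|exact: Phi01|].
by have := @Phi1_ge R; rewrite neq_lt => ?; apply/orP; left; lra.
Qed.

Lemma kl_g_gt0 : 0 < kl_g lambda.
Proof.
have h : Hg1 != Hf by apply/eqP.
by rewrite -(info_lambda h); exact: stage_info_gt0.
Qed.

End quantizers.

(** * The message tree *)

Section message_tree.
Context {R : realType}.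
Implicit Types (p q : seq bool -> bool -> R) (F G w : seq bool -> R).
Implicit Types (s : seq bool) (b d : bool) (m : nat).

Definition tree_prob p := forall s, [/\ forall b, 0 <= p s b & p s true + p s false = 1].

Definition step p F s : R := p s true * F (rcons s true) + p s false * F (rcons s false).

(** The conditional expectation of [F] at the word reached after [m] further messages, given the
    word [s]. *)
Fixpoint Ex p m F s : R := if m is m'.+1 then step p (Ex p m' F) s else F s.

Variable delta : dtest R.

(** The stopping rule reads infinite sequences, so the word is padded with [false]. By
    [stop_adapted] the padding has no influence on a value that is at most [size s]. *)
Definition stopped s : bool :=
  if stop delta (nth false s) is Some n then (n <= size s)%N else false.

Definition decided d s : bool :=
  if stop delta (nth false s) is Some n
  then (n <= size s)%N && (decide delta (take n s) == d) else false.

(** A running cost [w], paid until the test stops and for at most [m] messages. From the empty word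
    with [w = 1] it is the expectation of the sample size truncated at [m]. *)
Definition cost p w m s : R :=
  \sum_(k < m) Ex p k (fun s => if stopped s then 0 else w s) s.

Definition decision_prob p d m s : R := Ex p m (fun s => (decided d s)%:R) s.

Lemma step_ge0 p F s : tree_prob p -> (forall b, 0 <= F (rcons s b)) -> 0 <= step p F s.
Proof. by move=> /(_ s)[p0 _] F0; rewrite addr_ge0 ?mulr_ge0. Qed.

Lemma step_le p F G s : tree_prob p -> (forall b, F (rcons s b) <= G (rcons s b)) ->
  step p F s <= step p G s.
Proof. by move=> /(_ s)[p0 _] FG; rewrite lerD ?ler_wpM2l. Qed.

Lemma stop_ext s (U : nat -> bool) n : (n <= size s)%N ->
  (forall k, (k < size s)%N -> U k = nth false s k) ->
  stop delta (nth false s) = Some n <-> stop delta U = Some n.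
Proof.
move=> ns sU; split; apply: stop_adapted => k kn.
  by rewrite sU// (leq_trans kn).
by rewrite sU// (leq_trans kn).
Qed.

Lemma nth_rcons_lt s b k : (k < size s)%N -> nth false (rcons s b) k = nth false s k.
Proof. by move=> ks; rewrite nth_rcons ks. Qed.

Lemma stopped_rcons s b : stopped s -> stopped (rcons s b).
Proof.
rewrite /stopped; case E : (stop _ _) => [n|//] ns.
rewrite (iffLR (stop_ext ns (@nth_rcons_lt s b)) E) size_rcons.
exact: leqW.
Qed.

Lemma decided_rcons d s b : stopped s -> decided d (rcons s b) = decided d s.
Proof.
rewrite /stopped /decided; case E : (stop _ _) => [n|//] ns.
rewrite (iffLR (stop_ext ns (@nth_rcons_lt s b)) E) size_rcons ns leqW//.
by rewrite -cats1 takel_cat.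
Qed.

Lemma decided_stopped d s : decided d s -> stopped s.
Proof. by rewrite /decided /stopped; case: (stop _ _) => // n /andP[]. Qed.

Lemma stopped_decided s : (stopped s)%:R = (decided true s)%:R + (decided false s)%:R :> R.
Proof.
rewrite /decided /stopped; case: (stop _ _) => [n|]; last by rewrite addr0.
by case: (n <= size s)%N; case: (decide _ _); rewrite /= ?addr0 ?add0r.
Qed.

(** Thanks to this invariant, boundary conditions need only be verified at words at whose very end
    the test stops. *)
Definition fresh s : Prop := forall n, stop delta (nth false s) = Some n -> (size s <= n)%N.

Lemma fresh_rcons s b : ~~ stopped s -> fresh (rcons s b).
Proof.
move=> sN n En; rewrite size_rcons ltnNge; apply: contra sN => ns.
by rewrite /stopped (iffRL (stop_ext ns (@nth_rcons_lt s b)) En).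
Qed.

Lemma Ex_cst p m F s c : tree_prob p -> (forall s', (exists t, s' = s ++ t) -> F s' = c) ->
  Ex p m F s = c.
Proof.
move=> pp; elim: m s => [|m IH] s Fc /=.
  by apply: Fc; exists [::]; rewrite cats0.
have [_ p1] := pp s.
rewrite /step !IH ?(mulrDl, mul1r) -?mulrDl ?p1 ?mul1r//.
- by move=> _ [t ->]; apply: Fc; exists (false :: t); rewrite cat_rcons.
- by move=> _ [t ->]; apply: Fc; exists (true :: t); rewrite cat_rcons.
Qed.

Lemma stopped_cat s t : stopped s -> stopped (s ++ t).
Proof.
elim: t s => [|b t IH] s ss; first by rewrite cats0.
by rewrite -cat_rcons; apply: IH; exact: stopped_rcons.
Qed.

Lemma decided_cat d s t : stopped s -> decided d (s ++ t) = decided d s.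
Proof.
elim: t s => [|b t IH] s ss; first by rewrite cats0.
by rewrite -cat_rcons IH ?decided_rcons//; exact: stopped_rcons.
Qed.

Lemma cost_stopped p w m s : tree_prob p -> stopped s -> cost p w m s = 0.
Proof.
move=> pp ss; rewrite /cost big1// => k _; apply: Ex_cst => // _ [t ->].
by rewrite stopped_cat.
Qed.

Lemma decision_prob_stopped p d m s : tree_prob p -> stopped s ->
  decision_prob p d m s = (decided d s)%:R.
Proof. by move=> pp ss; apply: Ex_cst => // _ [t ->]; rewrite decided_cat. Qed.

Lemma cost0 p w s : cost p w 0 s = 0. Proof. by rewrite /cost big_ord0. Qed.

Lemma costS p w m s : ~~ stopped s -> cost p w m.+1 s = w s + step p (cost p w m) s.
Proof.
move=> /negbTE ss; rewrite /cost big_ord_recl /= ss; congr (_ + _).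
rewrite /step !mulr_sumr -big_split/=; apply: eq_bigr => k _.
by rewrite /bump.
Qed.

Lemma decision_prob_ge0 p d m s : tree_prob p -> 0 <= decision_prob p d m s.
Proof.
move=> pp; rewrite /decision_prob; elim: m s => [|m IH] s //=.
by apply: step_ge0.
Qed.

Lemma cost_le p w w' m s : tree_prob p -> (forall s, w s <= w' s) ->
  cost p w m s <= cost p w' m s.
Proof.
move=> pp ww'; elim: m s => [|m IH] s; first by rewrite !cost0.
have [ss|ss] := boolP (stopped s); first by rewrite !cost_stopped.
by rewrite !costS// lerD// step_le.
Qed.

Lemma cost_scale p (x : R) m s : tree_prob p ->
  cost p (fun=> x) m s = x * cost p (fun=> 1) m s.
Proof.
move=> pp; elim: m s => [|m IH] s; first by rewrite !cost0 mulr0.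
have [ss|ss] := boolP (stopped s); first by rewrite !cost_stopped// mulr0.
by rewrite !costS// /step !IH; ring.
Qed.

Lemma costD p w w' m s : tree_prob p ->
  cost p (fun s => w s + w' s) m s = cost p w m s + cost p w' m s.
Proof.
move=> pp; elim: m s => [|m IH] s; first by rewrite !cost0 addr0.
have [ss|ss] := boolP (stopped s); first by rewrite !cost_stopped// addr0.
by rewrite !costS// /step !IH; ring.
Qed.

(** Markov's inequality for the stopping time. *)
Lemma decision_prob_total p m s : tree_prob p ->
  m%:R * (1 - decision_prob p true m s - decision_prob p false m s)
    <= cost p (fun=> 1) m s.
Proof.
move=> pp; elim: m s => [|m IH] s; first by rewrite mul0r cost0.
have [ss|ss] := boolP (stopped s).
  rewrite cost_stopped// !decision_prob_stopped// -addrA -opprD -stopped_decided ss.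
  by rewrite subrr mulr0.
rewrite costS// /decision_prob /= -!/(decision_prob _ _ _ _).
have [p0 p1] := pp s.
have A1 b : decision_prob p true m (rcons s b) + decision_prob p false m (rcons s b) <= 1.
  rewrite /decision_prob; elim: m (rcons s b) {IH} => [|k IH] s' /=.
    by rewrite -stopped_decided lern1 leq_b1.
  have [p0' p1'] := pp s'; rewrite /step.
  have := IH (rcons s' true); have := IH (rcons s' false).
  move=> h1 h2; have := ler_wpM2l (p0' true) h2; have := ler_wpM2l (p0' false) h1; lra.
have h1 := IH (rcons s true); have h2 := IH (rcons s false).
rewrite /step -/(decision_prob _ _ _ _).
have := ler_wpM2l (p0 true) h1; have := ler_wpM2l (p0 false) h2.
have := ler_wpM2l (p0 true) (A1 true); have := ler_wpM2l (p0 false) (A1 false).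
have := mulr_ge0 (p0 true) (decision_prob_ge0 true m (rcons s true) pp).
have := mulr_ge0 (p0 true) (decision_prob_ge0 false m (rcons s true) pp).
have := mulr_ge0 (p0 false) (decision_prob_ge0 true m (rcons s false) pp).
have := mulr_ge0 (p0 false) (decision_prob_ge0 false m (rcons s false) pp).
rewrite /decision_prob -natr1.
move: p1; move: (p s true) (p s false) => u v uv.
have -> : v = 1 - u by lra.
move: (Ex _ _ _ _) (Ex _ _ _ _) (Ex _ _ _ _) (Ex _ _ _ _) (cost _ _ _ _) (cost _ _ _ _) (m%:R).
move=> a b c e f g n *; lra.
Qed.

(** A Foster-Lyapunov bound by first-step analysis. Nonnegativity of [V] disposes of the stopped
    words, where nothing remains to be paid. *)
Lemma cost_supersolution p V s m : tree_prob p -> 0 <= V s ->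
  (forall s, ~~ stopped s -> (forall b, 0 <= V (rcons s b)) /\ 1 + step p V s <= V s) ->
  cost p (fun=> 1) m s <= V s.
Proof.
move=> pp V0 VP; elim: m s V0 => [|m IH] s V0; first by rewrite cost0.
have [ss|ss] := boolP (stopped s); first by rewrite cost_stopped.
have [Vb Vs] := VP _ ss; rewrite costS//; apply: le_trans Vs; rewrite lerD2l.
by apply: step_le => // b; exact: IH.
Qed.

(** Optional stopping for a nonnegative supermartingale that is at least 1 whenever the test stops
    with decision [d]. *)
Lemma decision_prob_supersolution p d H s m : tree_prob p -> 0 <= H s -> fresh s ->
  (forall s, ~~ stopped s -> (forall b, 0 <= H (rcons s b)) /\ step p H s <= H s) ->
  (forall s, stop delta (nth false s) = Some (size s) -> decide delta s = d -> 1 <= H s) ->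
  decision_prob p d m s <= H s.
Proof.
move=> pp + + HP Hd.
have base s' : 0 <= H s' -> fresh s' -> stopped s' -> (decided d s')%:R <= H s'.
  move=> H0 sf ss; case: (boolP (decided d s')) => [ds|_]; last exact: H0.
  apply: Hd.
    move: ss sf; rewrite /stopped /fresh; case: (stop _ _) => // n ns /(_ _ erefl) sn.
    by congr Some; apply/eqP; rewrite eqn_leq ns sn.
  move: ds ss sf; rewrite /stopped /decided /fresh; case: (stop _ _) => // n /andP[_ /eqP dn] ns.
  by move=> /(_ _ erefl) sn; rewrite -dn take_oversize.
elim: m s => [|m IH] s H0 sf; have [ss|ss] := boolP (stopped s).
- by rewrite decision_prob_stopped//; exact: base.
- rewrite /decision_prob /=; case: (boolP (decided d s)) => [ds|_]; last exact: H0.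
  by rewrite (decided_stopped ds) in ss.
- by rewrite decision_prob_stopped//; exact: base.
- have [Hb Hs] := HP _ ss; apply: le_trans Hs; rewrite {1}/decision_prob /=.
  by apply: step_le => // b; apply: IH => //; exact: fresh_rcons.
Qed.

Definition divergence p q s : R :=
  p s true * ln (p s true / q s true) + p s false * ln (p s false / q s false).

(** Wald's information inequality. [L] is the likelihood ratio accumulated so far;
    at the end [- ln L >= ln t + 1 - t L] is used on the decision [d] and
    [- ln L >= 1 - L] off it. *)
Lemma information_inequality p q d (t L : R) m s :
  tree_prob p -> tree_prob q -> (forall s b, p s b = 0 -> q s b = 0) ->
  (forall s b, q s b = 0 -> p s b = 0) -> 0 < t -> 0 < L ->
  decision_prob p d m s * (ln t + 1) - t * L * decision_prob q d m s
    + (1 - decision_prob p d m s) - L * (1 - decision_prob q d m s)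
  <= cost p (divergence p q) m s - ln L.
Proof.
move=> pp pq pq0 qp0 t0 L0; set w := divergence p q.
have base (L' : R) (c : bool) : 0 < L' ->
    c%:R * (ln t + 1) - t * L' * c%:R + (1 - c%:R) - L' * (1 - c%:R) <= - ln L'.
  move=> {}L0; case: c; rewrite /= ?(mul1r, mulr1, subrr, mulr0, subr0, addr0, mul0r, add0r).
    have := @ln_le_sub1 R (t * L') (mulr_gt0 t0 L0).
    by rewrite lnM ?posrE//; lra.
  by have := @ln_le_sub1 R L' L0; lra.
elim: m s L L0 => [|m IH] s L L0 /=; first by rewrite cost0 sub0r; exact: base.
have [ss|ss] := boolP (stopped s).
  by rewrite !decision_prob_stopped// cost_stopped// sub0r; exact: base.
rewrite costS//.
have [p0 p1] := pp s; have [q0 q1] := pq s.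
pose A p b := decision_prob p d m (rcons s b).
have branch b : p s b * (A p b * (ln t + 1) + (1 - A p b)) - q s b * (L * (t * A q b + (1 - A q b)))
     <= p s b * (cost p w m (rcons s b) + ln (p s b / q s b) - ln L).
  have [pb|pb] := eqVneq (p s b) 0.
    by rewrite pb (pq0 _ _ pb) !mul0r subrr.
  have pb0 : 0 < p s b by rewrite lt0r pb p0.
  have qb0 : 0 < q s b.
    by rewrite lt0r q0 andbT; apply: contra pb => /eqP /qp0 ->.
  (* The likelihood ratio after message [b]. Once weighted by [p s b], the factor [q s b / p s b]
     turns the terms in [L] into averages under [q]. *)
  have L'0 : 0 < L * (q s b / p s b) by rewrite mulr_gt0// divr_gt0.
  have := IH (rcons s b) _ L'0.
  rewrite lnM ?posrE ?divr_gt0// !ln_div ?posrE// -!/(A _ _) => h.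
  have := ler_wpM2l (p0 b) h.
  have -> : p s b * (A p b * (ln t + 1) - t * (L * (q s b / p s b)) * A q b + (1 - A p b)
      - L * (q s b / p s b) * (1 - A q b)) =
    p s b * (A p b * (ln t + 1) + (1 - A p b)) - q s b * (L * (t * A q b + (1 - A q b))).
    by field.
  lra.
have bt := branch true; have bf := branch false.
rewrite /decision_prob /= /step -!/(decision_prob _ _ _ _) -!/(A _ _) /w /divergence.
have e1 : (p s true + p s false) * ln L = ln L by rewrite p1 mul1r.
have e2 : L * (q s true + q s false) = L by rewrite q1 mulr1.
lra.
Qed.

End message_tree.

(** * The law of the messages *)

Section message_process.
Local Open Scope ereal_scope.
Context {R : realType} d (T : measurableType d).
Variables (P : hyp -> probability T R) (X : nat -> {mfun T >-> R}).
Hypothesis hX : forall j : hyp, iid_normal (P j) X (mean j).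
Variable delta : dtest R.
Implicit Types (s : seq bool) (b : bool) (j : hyp) (t : T).

Definition next_quantizer s : R -> bool := quantizer (feedback delta (size s) s).

Definition message_tree j s b : R := message_prob (next_quantizer s) j b.

Lemma measurable_next_quantizer s : measurable_fun [set: R] (next_quantizer s).
Proof. exact: quantizer_measurable. Qed.

Lemma tree_prob_message_tree j : tree_prob (message_tree j).
Proof.
move=> s; split=> [b|]; first exact: message_prob_ge0.
rewrite /message_tree message_probN; last exact: measurable_next_quantizer.
by rewrite addrC subrK.
Qed.

Local Notation upto n t := (messages_upto delta (X ^~ t) n).

Lemma size_messages_upto x n : size (messages_upto delta x n) = n.
Proof. by elim: n => //= n IH; rewrite size_rcons IH. Qed.

Lemma messagesE x n : messages delta x n = next_quantizer (messages_upto delta x n) (x n).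
Proof.
rewrite /messages /next_quantizer; move: (size_messages_upto x n).
by move: (messages_upto delta x n) => s <-.
Qed.

Lemma messages_uptoS x n : messages_upto delta x n.+1 =
  rcons (messages_upto delta x n) (messages delta x n).
Proof. by []. Qed.

Lemma nth_messages_upto x n k : (k < n)%N ->
  nth false (messages_upto delta x n) k = messages delta x k.
Proof.
elim: n => // n IH; rewrite ltnS messages_uptoS nth_rcons size_messages_upto => kn.
have [k_lt_n|] := ltnP k n; first exact: IH.
move=> nk; have -> : k = n by apply/eqP; rewrite eqn_leq kn nk.
by rewrite eqxx.
Qed.

Definition path_event s : set T := [set t | upto (size s) t = s].

Definition path_prob j s : R :=
  (\prod_(k <- iota 0 (size s)) message_tree j (take k s) (nth false s k))%R.

Lemma path_prob_rcons j s b : path_prob j (rcons s b) = (path_prob j s * message_tree j s b)%R.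
Proof.
rewrite /path_prob size_rcons -addn1 iotaD big_cat/= big_seq1 add0n.
congr (_ * _)%R; last by rewrite nth_rcons ltnn eqxx -cats1 take_cat ltnn subnn cats0.
apply: eq_big_seq => k; rewrite mem_iota add0n => /andP[_ ks].
by rewrite nth_rcons ks -cats1 takel_cat// ltnW.
Qed.

(** Along a fixed word the feedback is fixed too, so each message constrains a single observation
    through a deterministic quantizer. Independence therefore applies in spite of the feedback. *)
Lemma path_eventE s : path_event s =
  \bigcap_(k in [set` iota 0 (size s)])
    (X k @^-1` [set x | next_quantizer (take k s) x = nth false s k]).
Proof.
apply/seteqP; split => t /=; rewrite /path_event /=.
  move=> ts k /=; rewrite mem_iota add0n => /andP[_ ks].
  have <- : messages delta (X ^~ t) k = nth false s k.
    by rewrite -[in RHS]ts nth_messages_upto.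
  rewrite messagesE; congr (next_quantizer _ _).
  rewrite -[in LHS]ts; elim: (size s) ks => // n IH kn.
  rewrite messages_uptoS -cats1 takel_cat ?size_messages_upto//.
  move: kn; rewrite ltnS leq_eqVlt => /predU1P[->|]; last exact: IH.
  by rewrite take_oversize// size_messages_upto.
move=> h; suff H n : (n <= size s)%N -> upto n t = take n s.
  by rewrite H// take_size.
elim: n => [|n IH] ns; first by rewrite take0.
have hn : next_quantizer (take n s) (X n t) = nth false s n.
  by apply: h; rewrite /= mem_iota.
by rewrite messages_uptoS messagesE (IH (ltnW ns)) hn (take_nth false).
Qed.

Lemma measurable_path_event s : measurable (path_event s).
Proof.
rewrite path_eventE; apply: bigcap_measurableType => k _.
apply: measurable_funPTI.
exact: measurable_preimage_bool (measurable_next_quantizer _).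
Qed.

Lemma prob_path_event j s : P j (path_event s) = (path_prob j s)%:E.
Proof.
have [ind law] := hX j.
rewrite path_eventE ind ?iota_uniq//; last first.
  by move=> k; exact: measurable_preimage_bool (measurable_next_quantizer _).
rewrite /path_prob -prodEFin; apply: eq_bigr => k _.
rewrite law; last exact: measurable_preimage_bool (measurable_next_quantizer _).
rewrite /message_tree message_probE nprobE//.
exact: measurable_preimage_bool (measurable_next_quantizer _).
Qed.

(** The tower property, by splitting on the next message. In product form it needs no division by
    the probability of a possibly null path. *)
Lemma measurable_prob_tree j (B : pred (seq bool)) m s :
  let E := path_event s `&` [set t | B (upto (size s + m) t)] in
  measurable E /\
  P j E = (path_prob j s * Ex (message_tree j) m (fun s => (B s)%:R) s)%:E.
Proof.
elim: m s => [|m IH] s /=.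
  have -> : path_event s `&` [set t | B (upto (size s + 0) t)] =
      if B s then path_event s else set0.
    rewrite addn0 /path_event; apply/seteqP; split => t /=.
      by move=> [ts]; rewrite ts => ->.
    by case: ifP => //= Bs ts; rewrite ts Bs.
  case: (B s); rewrite ?mulr1 ?mulr0.
    by split; [exact: measurable_path_event|exact: prob_path_event].
  by split; [exact: measurable0|rewrite measure0].
pose E b := path_event (rcons s b) `&` [set t | B (upto (size (rcons s b) + m) t)].
have EE : path_event s `&` [set t | B (upto (size s + m.+1) t)] = E true `|` E false.
  rewrite /E !size_rcons addnS -addSn /path_event; apply/seteqP; split => t /=.
    move=> [ts Bt]; rewrite !size_rcons /= ts.
    by case: (quantizer _ _); [left|right].
  by rewrite !size_rcons /= => -[[/rcons_inj[ts _] Bt]|[/rcons_inj[ts _] Bt]].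
have [m1 p1] := IH (rcons s true); have [m2 p2] := IH (rcons s false).
rewrite EE; split; first exact: measurableU.
rewrite measureU//; last first.
  apply/seteqP; split => t // -[[h1 _] [h2 _]].
  have k1 : upto (size (rcons s true)) t = rcons s true := h1.
  have k2 : upto (size (rcons s false)) t = rcons s false := h2.
  rewrite size_rcons in k1; rewrite size_rcons k1 in k2.
  by have /rcons_inj[] := k2.
rewrite [X in X + _]p1 [X in _ + X]p2 !path_prob_rcons -EFinD /step; congr (_%:E); ring.
Qed.

Lemma measurable_messages_event (B : pred (seq bool)) m :
  measurable [set t | B (upto m t)].
Proof.
have [+ _] := measurable_prob_tree Hf B m [::]; rewrite add0n.
by rewrite (_ : path_event [::] = setT) ?setTI//; apply/seteqP; split.
Qed.

Lemma prob_messages_event j (B : pred (seq bool)) m :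
  P j [set t | B (upto m t)] = (Ex (message_tree j) m (fun s => (B s)%:R) [::])%:E.
Proof.
have [_ +] := measurable_prob_tree j B m [::]; rewrite add0n.
rewrite (_ : path_event [::] = setT) ?setTI; last by apply/seteqP; split.
by rewrite /path_prob /= big_nil mul1r.
Qed.

End message_process.

(** * Sample size and decision as limits of quantities on the tree *)

Section sample_size_and_decision.
Local Open Scope ereal_scope.
Context {R : realType} d (T : measurableType d).
Variables (P : hyp -> probability T R) (X : nat -> {mfun T >-> R}).
Hypothesis hX : forall j : hyp, iid_normal (P j) X (mean j).
Variable delta : dtest R.
Implicit Types (s : seq bool) (b : bool) (j : hyp) (t : T).

Local Notation upto n t := (messages_upto delta (X ^~ t) n).
Local Notation tree := (message_tree delta).

Lemma stop_upto x m n : (n <= m)%N ->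
  stop delta (nth false (messages_upto delta x m)) = Some n <->
  stop delta (messages delta x) = Some n.
Proof.
move=> nm; apply: stop_ext; rewrite size_messages_upto// => k km.
by rewrite nth_messages_upto.
Qed.

Lemma take_messages_upto x m n : (n <= m)%N ->
  take n (messages_upto delta x m) = messages_upto delta x n.
Proof.
elim: m => [|m IH]; first by rewrite leqn0 => /eqP ->.
rewrite leq_eqVlt => /predU1P[->|nm]; first by rewrite take_oversize// size_messages_upto.
by rewrite messages_uptoS -cats1 takel_cat ?size_messages_upto// IH.
Qed.

Lemma stopped_upto x m : stopped delta (messages_upto delta x m) =
  if stop delta (messages delta x) is Some n then (n <= m)%N else false.
Proof.
rewrite /stopped size_messages_upto.
case E : (stop _ (nth _ _)) => [n|].
  have [nm|mn] := leqP n m; first by rewrite (iffLR (stop_upto x nm) E) nm.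
  case E' : (stop _ _) => [n'|//]; apply/esym/negbTE; rewrite -ltnNge ltnNge.
  by apply/negP => n'm; move: E; rewrite (iffRL (stop_upto x n'm) E') => -[nn]; rewrite nn leqNgt mn in n'm.
case E' : (stop _ _) => [n'|//]; apply/esym/negbTE/negP => n'm.
by move: E; rewrite (iffRL (stop_upto x n'm) E').
Qed.

Lemma decided_upto b x m : decided delta b (messages_upto delta x m) =
  if stop delta (messages delta x) is Some n
  then (n <= m)%N && (decide delta (messages_upto delta x n) == b) else false.
Proof.
have := stopped_upto x m; rewrite /stopped /decided size_messages_upto.
case E : (stop _ (nth _ _)) => [n|]; case E' : (stop _ _) => [n'|] h //.
- have [n'm|mn'] := leqP n' m.
    move: E; rewrite (iffRL (stop_upto x n'm) E') => -[<-].
    by rewrite n'm take_messages_upto.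
  by rewrite h leqNgt mn'.
- by rewrite h.
- by rewrite -h.
Qed.

Definition alive_event k : set T := [set t | ~~ stopped delta (upto k t)].

Lemma measurable_alive_event k : measurable (alive_event k).
Proof. exact: (measurable_messages_event hX delta (fun s => ~~ stopped delta s)). Qed.

Lemma sample_size_series t :
  sample_size X delta t = \sum_(k <oo) (\1_(alive_event k) t)%:E.
Proof.
have aE k : \1_(alive_event k) t =
    (~~ (if stop delta (messages delta (X ^~ t)) is Some n then (n <= k)%N else false))%:R :> R.
  rewrite indicE -stopped_upto; congr (nat_of_bool _)%:R.
  by apply/idP/idP => [/set_mem//|h]; apply/mem_set.
under eq_eseriesr do rewrite aE.
rewrite /sample_size; case: (stop _ _) => [n|].
  rewrite (@nneseries_split _ _ 0 n)// add0n eseries0 ?adde0; last first.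
    by move=> k nk _; rewrite nk.
  rewrite (eq_big_nat _ _ (F2 := fun=> 1%:E)); last first.
    by move=> k /andP[_ kn]; rewrite leqNgt kn.
  by rewrite sumEFin sumr_const_nat subn0.
apply/esym/eqyP => r r0; have [n rn] : exists n, (r <= n%:R)%R.
  by exists (Num.trunc r).+1; rewrite ltW// truncnS_gt.
have /(_ n) := @nneseries_lim_ge R (fun=> 1%:E) xpredT 0 _ (fun _ _ _ => lee01).
apply: le_trans; rewrite sumEFin sumr_const_nat subn0 lee_fin.
exact: rn.
Qed.

Lemma expected_size_series j : \int[P j]_t sample_size X delta t =
  \sum_(k <oo) (Ex (tree j) k (fun s => (~~ stopped delta s)%:R) [::])%:E.
Proof.
under eq_integral do rewrite sample_size_series.
rewrite integral_nneseries//; last first.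
  by move=> k; apply/measurable_EFinP/measurable_indic/measurable_alive_event.
apply: eq_eseriesr => k _.
rewrite integral_indic//; last exact: measurable_alive_event.
rewrite setIT; exact: (prob_messages_event hX delta j (fun s => ~~ stopped delta s)).
Qed.

Lemma costE j m : (cost delta (tree j) (fun=> 1%R) m [::])%:E =
  \sum_(0 <= k < m) (Ex (tree j) k (fun s => (~~ stopped delta s)%:R) [::])%:E.
Proof.
rewrite /cost sumEFin big_mkord; congr EFin; apply: eq_bigr => k _.
by congr (Ex _ _ _); apply/funext => s; case: stopped.
Qed.

Let Ex_ge0 j k : 0 <= (Ex (tree j) k (fun s => (~~ stopped delta s)%:R) [::])%:E.
Proof.
by have <- := prob_messages_event hX delta j (fun s => ~~ stopped delta s) k.
Qed.

Lemma cost_le_expected_size j m :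
  (cost delta (tree j) (fun=> 1%R) m [::])%:E <= \int[P j]_t sample_size X delta t.
Proof.
rewrite costE expected_size_series; apply: nneseries_lim_ge => k _ _.
exact: Ex_ge0.
Qed.

Lemma expected_size_le j (V : R) :
  (forall m, (cost delta (tree j) (fun=> 1) m [::] <= V)%R) ->
  \int[P j]_t sample_size X delta t <= V%:E.
Proof.
move=> h; rewrite expected_size_series; apply: lime_le.
  by apply: is_cvg_nneseries => k _ _; exact: Ex_ge0.
by apply: nearW => m; rewrite -costE lee_fin.
Qed.

Let decided_event b m : set T := [set t | decided delta b (upto m t)].

Let decision_eventE b : decision_event X delta b = \bigcup_m decided_event b m.
Proof.
apply/seteqP; split => t.
  move=> [n sn dn]; exists n => //.
  by rewrite /decided_event /= decided_upto sn leqnn dn eqxx.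
move=> [m _]; rewrite /decided_event /= decided_upto.
by case E : (stop _ _) => [n|//] /andP[_ /eqP dn]; exists n.
Qed.

Let measurable_decided_event b m : measurable (decided_event b m).
Proof. exact: (measurable_messages_event hX delta (decided delta b)). Qed.

Lemma measurable_decision_event b : measurable (decision_event X delta b).
Proof. by rewrite decision_eventE; exact: bigcup_measurable. Qed.

Lemma decision_prob_le j b m :
  (decision_prob delta (tree j) b m [::])%:E <= P j (decision_event X delta b).
Proof.
rewrite /decision_prob -(prob_messages_event hX delta j (decided delta b)).
apply: le_measure; rewrite ?inE//.
- exact: measurable_decided_event.
- exact: measurable_decision_event.
- by rewrite decision_eventE => t tm; exists m.
Qed.

Lemma decision_event_le j b (V : R) :
  (forall m, (decision_prob delta (tree j) b m [::] <= V)%R) ->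
  P j (decision_event X delta b) <= V%:E.
Proof.
move=> h; have := @nondecreasing_cvg_mu _ _ _ (P j) (decided_event b)
  (measurable_decided_event b).
rewrite -decision_eventE => /(_ (measurable_decision_event b)) cvE.
have nd : nondecreasing_seq (decided_event b).
  move=> m n mn; apply/subsetPset => t; rewrite /decided_event /= !decided_upto.
  by case: (stop _ _) => // k /andP[km ->]; rewrite (leq_trans km mn).
have {}cvE := cvE nd.
rewrite -(cvg_lim _ cvE)//; apply: lime_le; first by apply/cvg_ex; eexists; exact: cvE.
apply: nearW => m; rewrite /= (prob_messages_event hX delta j (decided delta b) m) lee_fin.
exact: h.
Qed.

End sample_size_and_decision.

(** * Lower bound *)

Lemma Hg1_neq_Hf : Hg1 != Hf. Proof. exact/eqP. Qed.
Lemma Hg2_neq_Hf : Hg2 != Hf. Proof. exact/eqP. Qed.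

Section lower_bound.
Context {R : realType} d (T : measurableType d).
Variables (P : hyp -> probability T R) (X : nat -> {mfun T >-> R}).
Hypothesis hX : forall j : hyp, iid_normal (P j) X (mean j).
Implicit Types (delta : dtest R) (j i : hyp) (b : bool).

Local Notation tree := message_tree.
Local Notation EN delta j := (\int[P j]_t sample_size X delta t)%E.

Lemma divergence_tree delta j i s :
  divergence (tree delta j) (tree delta i) s = info (next_quantizer delta s) j i.
Proof.
by rewrite /divergence /message_tree !message_probN//; exact: measurable_next_quantizer.
Qed.

Lemma message_tree_null delta j i s b : tree delta j s b = 0 -> tree delta i s b = 0.
Proof.
have mq := measurable_next_quantizer delta s.
rewrite /message_tree => /eqP; rewrite (message_prob_null _ _ mq) => h.
by apply/eqP; rewrite (message_prob_null _ _ mq).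
Qed.

Local Opaque info I_f kl_g cost decision_prob.

(** [information_inequality] from [L = 1] with [t = 1 / B]: since [B] bounds the error probability
    under [i], the penalty term costs at most 1. *)
Lemma wald_bound delta j i b (B : R) m : 0 < B ->
  decision_prob delta (tree delta i) b m [::] <= B ->
  decision_prob delta (tree delta j) b m [::] * - ln B - 1 <=
  cost delta (tree delta j) (fun s => info (next_quantizer delta s) j i) m [::].
Proof.
move=> B0 AB; have Bi : 0 < B^-1 by rewrite invr_gt0.
have := information_inequality delta b m [::] (tree_prob_message_tree delta j)
  (tree_prob_message_tree delta i) (fun s c => @message_tree_null delta j i s c)
  (fun s c => @message_tree_null delta i j s c) Bi ltr01.
rewrite ln1 subr0 lnV ?posrE//.
have -> : divergence (tree delta j) (tree delta i) =
    fun s => info (next_quantizer delta s) j i.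
  by apply/funext => s; exact: divergence_tree.
have := decision_prob_ge0 delta b m [::] (tree_prob_message_tree delta i).
have : B^-1 * 1 * decision_prob delta (tree delta i) b m [::] <= 1.
  by rewrite mulr1 mulrC ler_pdivrMr// mul1r.
move: (decision_prob _ _ _ _ _) (decision_prob _ _ _ _ _) (cost _ _ _ _ _) => x y z.
move: (B^-1) => k; lra.
Qed.

(** With [m >= n / B], Markov's inequality bounds by [B] the probability of not having stopped after
    [m] messages; a wrong decision accounts for the other [B]. *)
Lemma decision_prob_large delta j b (n B : R) : 0 < B ->
  (EN delta j <= n%:E)%E -> (P j (decision_event X delta (~~ b)) <= B%:E)%E ->
  exists m, 1 - 2 * B <= decision_prob delta (tree delta j) b m [::].
Proof.
move=> B0 hn hB.
have cn m : cost delta (tree delta j) (fun=> 1) m [::] <= n.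
  by rewrite -lee_fin; exact: le_trans (cost_le_expected_size hX delta j m) hn.
have n0 : 0 <= n by rewrite -(cost0 delta (tree delta j) (fun=> 1) [::]); exact: cn.
pose m := (Num.trunc (n / B)).+1; exists m.
have m0 : (0 : R) < m%:R by rewrite ltr0n.
have mn : n <= m%:R * B by rewrite -ler_pdivrMr// ltW// truncnS_gt.
have tot := decision_prob_total delta m [::] (tree_prob_message_tree delta j).
have hA : decision_prob delta (tree delta j) (~~ b) m [::] <= B.
  by rewrite -lee_fin; exact: le_trans (decision_prob_le hX delta j (~~ b) m) hB.
have : m%:R * (1 - decision_prob delta (tree delta j) true m [::] -
    decision_prob delta (tree delta j) false m [::]) <= m%:R * B.
  by apply: le_trans tot _; apply: le_trans (cn m) mn.
rewrite ler_pM2l// => h; case: b hA {hB} => /= hA; lra.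
Qed.

Lemma cost_le_size delta j (n : R) m : (EN delta j <= n%:E)%E ->
  cost delta (tree delta j) (fun=> 1) m [::] <= n.
Proof.
move=> hn.
by rewrite -lee_fin; exact: le_trans (cost_le_expected_size hX delta j m) hn.
Qed.

Lemma cost_cst_le delta j (k n : R) m : 0 <= k -> (EN delta j <= n%:E)%E ->
  cost delta (tree delta j) (fun=> k) m [::] <= k * n.
Proof.
move=> k0 hn; rewrite (cost_scale _ _ _ _ (tree_prob_message_tree delta j)).
by rewrite ler_wpM2l// cost_le_size.
Qed.

(** The two Wald bounds are added before the information is estimated: taken alone, each could be
    favoured by the quantizer at the expense of the other. *)
Lemma expected_size_ge_f delta (n B : R) : 0 < B < 1 -> (EN delta Hf <= n%:E)%E ->
  (P Hf (decision_event X delta true) <= B%:E)%E ->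
  (forall i, i != Hf -> P i (decision_event X delta false) <= B%:E)%E ->
  (1 - 2 * B) * - ln B - 1 <= I_f * n.
Proof.
move=> /andP[B0 B1] hn hf hg.
have half_le (x y : R) : x + x <= 2 * I_f * y -> x <= I_f * y by lra.
have [m hm] := @decision_prob_large delta Hf false n B B0 hn hf.
have lnB : 0 <= - ln B by rewrite oppr_ge0 ln_le0// ltW.
have h i : i != Hf -> (1 - 2 * B) * - ln B - 1 <=
    cost delta (tree delta Hf) (fun s => info (next_quantizer delta s) Hf i) m [::].
  move=> iN; have hi : decision_prob delta (tree delta i) false m [::] <= B.
    by rewrite -lee_fin; exact: le_trans (decision_prob_le hX delta i false m) (hg i iN).
  apply: le_trans (@wald_bound delta Hf i false B m B0 hi).
  by rewrite lerD2r ler_wpM2r.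
have tp := tree_prob_message_tree delta Hf.
apply: half_le; apply: le_trans (lerD (h Hg1 Hg1_neq_Hf) (h Hg2 Hg2_neq_Hf)) _.
rewrite -(costD _ _ _ _ _ tp).
apply: le_trans (cost_le delta m [::] tp
  (fun s => info_f_le (measurable_next_quantizer delta s))) _.
by apply: cost_cst_le => //; rewrite mulr_ge0// ltW// I_f_gt0.
Qed.

Lemma expected_size_ge_g (l : R) delta i (n B : R) : (forall l', kl_g l' <= kl_g l) ->
  i != Hf -> 0 < B < 1 -> (EN delta i <= n%:E)%E ->
  (P Hf (decision_event X delta true) <= B%:E)%E ->
  (P i (decision_event X delta false) <= B%:E)%E ->
  (1 - 2 * B) * - ln B - 1 <= kl_g l * n.
Proof.
move=> lmax iN /andP[B0 B1] hn hf hg.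
have [m hm] := @decision_prob_large delta i true n B B0 hn hg.
have lnB : 0 <= - ln B by rewrite oppr_ge0 ln_le0// ltW.
have hi : decision_prob delta (tree delta Hf) true m [::] <= B.
  by rewrite -lee_fin; exact: le_trans (decision_prob_le hX delta Hf true m) hf.
have h := ler_wpM2r lnB hm; rewrite -(lerD2r (- 1)) in h.
apply: le_trans h (le_trans (@wald_bound delta i Hf true B m B0 hi) _).
have tp := tree_prob_message_tree delta i.
apply: le_trans (cost_le delta m [::] tp (fun s =>
  info_g_le lmax (kl_g_gt0 l) (measurable_next_quantizer delta s) iN)) _.
by apply: cost_cst_le => //; exact/ltW/kl_g_gt0.
Qed.

Variables (prior W : hyp -> R) (c : R).
Hypotheses (prior_gt0 : forall j, 0 < prior j) (W_gt0 : forall j, 0 < W j) (c_gt0 : 0 < c).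

Definition wrong j : bool := if j is Hf then true else false.

Definition error delta j : R := fine (P j (decision_event X delta (wrong j))).

Lemma errorE delta j : P j (decision_event X delta (wrong j)) = (error delta j)%:E.
Proof.
by rewrite /error fineK//; apply: fin_num_measure; exact: measurable_decision_event.
Qed.

Lemma error_ge0 delta j : 0 <= error delta j.
Proof. by rewrite /error fine_ge0. Qed.

Lemma risk_fin delta (n : hyp -> R) : (forall j, EN delta j = (n j)%:E) ->
  risk P X prior W c delta =
  (prior Hf * (c * n Hf + W Hf * error delta Hf)
   + prior Hg1 * (c * n Hg1 + W Hg1 * error delta Hg1)
   + prior Hg2 * (c * n Hg2 + W Hg2 * error delta Hg2))%:E.
Proof.
move=> hn; rewrite /risk !hn.
by rewrite (errorE delta Hf) (errorE delta Hg1) (errorE delta Hg2).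
Qed.

Let sample_size_ge0 delta j : (0 <= EN delta j)%E.
Proof. by apply: integral_ge0 => t _; rewrite /sample_size; case: (stop _ _). Qed.

Lemma risk_term_le delta j :
  ((prior j)%:E * (c%:E * EN delta j + (W j)%:E * (error delta j)%:E)
    <= risk P X prior W c delta)%E.
Proof.
have t0 i : (0 <= (prior i)%:E * (c%:E * EN delta i + (W i)%:E * (error delta i)%:E))%E.
  apply: mule_ge0; first by rewrite lee_fin ltW.
  apply: adde_ge0; first by apply: mule_ge0 => //; rewrite lee_fin ltW.
  by rewrite -EFinM lee_fin mulr_ge0 ?error_ge0// ltW.
rewrite /risk (errorE delta Hf) (errorE delta Hg1) (errorE delta Hg2).
have t1 := t0 Hf; have t2 := t0 Hg1; have t3 := t0 Hg2.
case: j.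
- by rewrite -addeA leeDl// adde_ge0.
- by rewrite -addeA addeCA leeDl// adde_ge0.
- by rewrite [leRHS]addeC leeDl// adde_ge0.
Qed.

(** A bootstrap: an a priori bound [rho] on the risk makes expected sample sizes finite and all
    error probabilities at most [B], and these feed the information bounds. *)
Lemma risk_ge (l : R) delta (B w rho : R) : (forall l', kl_g l' <= kl_g l) ->
  0 < B < 1 -> (forall j, w <= prior j * W j) -> rho <= w * B ->
  (risk P X prior W c delta <= rho%:E)%E ->
  ((c * (prior Hf / I_f + (prior Hg1 + prior Hg2) / kl_g l) *
    ((1 - 2 * B) * - ln B - 1))%:E <= risk P X prior W c delta)%E.
Proof.
move=> lmax B01 hw hrho hr; have /andP[B0 B1] := B01.
have term j := le_trans (risk_term_le delta j) hr.
have [n hn] : exists n : hyp -> R, forall j, EN delta j = (n j)%:E.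
  exists (fun j => fine (EN delta j)) => j; rewrite fineK// ge0_fin_numE//.
  rewrite ltey; apply/negP => /eqP Einf; have := term j.
  by rewrite Einf gt0_muley ?lte_fin// addye// gt0_muley ?lte_fin.
have n0 j : 0 <= n j by rewrite -lee_fin -hn.
have eB j : error delta j <= B.
  have := term j; rewrite hn -(EFinM c) -(EFinM (W j)) -EFinD -EFinM lee_fin => h.
  have := hw j; have p0 := prior_gt0 j; have w0 := W_gt0 j; have nj := n0 j.
  have e0 := error_ge0 delta j.
  have pcn : 0 <= prior j * (c * n j) by rewrite mulr_ge0 ?mulr_ge0// ltW.
  move=> wj; have pw0 : 0 < prior j * W j by rewrite mulr_gt0.
  rewrite -(ler_pM2l pw0); apply: le_trans (_ : w * B <= _); first lra.
  by rewrite ler_wpM2r// ltW.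
have eBE j : (P j (decision_event X delta (wrong j)) <= B%:E)%E by rewrite errorE lee_fin.
have eBi i : i != Hf -> (P i (decision_event X delta false) <= B%:E)%E.
  by move=> /eqP iN; move: (eBE i); case: i iN.
have hnE j : (EN delta j <= (n j)%:E)%E by rewrite hn.
have hf := expected_size_ge_f B01 (hnE Hf) (eBE Hf) eBi.
have hg i (iN : i != Hf) := expected_size_ge_g lmax iN B01 (hnE i) (eBE Hf) (eBi i iN).
have h1 := hg Hg1 Hg1_neq_Hf.
have h2 := hg Hg2 Hg2_neq_Hf.
rewrite (risk_fin hn) lee_fin.
have If0 := @I_f_gt0 R; have Ig0 := @kl_g_gt0 R l.
move: hf h1 h2; set x := _ - 1; move: (I_f) (kl_g l) If0 Ig0 => a b a0 b0 hf h1 h2.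
have k1 : x / a <= n Hf by rewrite ler_pdivrMr// mulrC.
have k2 : x / b <= n Hg1 by rewrite ler_pdivrMr// mulrC.
have k3 : x / b <= n Hg2 by rewrite ler_pdivrMr// mulrC.
have g j y : y <= n j -> prior j * (c * y) <= prior j * (c * n j + W j * error delta j).
  move=> yn; rewrite ler_pM2l//; have := mulr_ge0 (ltW (W_gt0 j)) (error_ge0 delta j).
  by have := ler_wpM2l (ltW c_gt0) yn; lra.
apply: le_trans (lerD (lerD (g Hf _ k1) (g Hg1 _ k2)) (g Hg2 _ k3)).
by rewrite le_eqVlt; apply/orP; left; apply/eqP; ring.
Qed.

End lower_bound.

(** * The lower bound as [c] tends to 0 *)

Section lower_asymptotics.
Context {R : realType}.

(** Here [L] is [- ln c], so that [B] is an error bound of the form [C * c * |ln c|]. *)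
Lemma neg_ln_asymptotic (C eps : R) : 0 < C -> 0 < eps -> exists M : R, forall L, M <= L ->
  let B := C * (expR (- L) * L) in
  0 < B < 1 /\ (1 - eps) * L <= (1 - 2 * B) * - ln B - 1.
Proof.
(* [eta] measures each loss: [ln L] is bounded by the tangent of slope [eta], the constants by
   [eta * L], and [B] by [eta]. The total stays below [eps * L]. *)
move=> C0 eps0; pose eta := Num.min (eps / 8) (1 / 8).
have eta0 : 0 < eta by rewrite lt_min; apply/andP; split; lra.
have eta1 : eta <= eps / 8 by rewrite ge_min lexx.
have eta2 : eta <= 1 / 8 by rewrite ge_min lexx orbT.
exists ((`|ln C| + `|ln eta| + 2) / eta) => L ML B.
have LM : `|ln C| + `|ln eta| + 2 <= eta * L by rewrite mulrC -ler_pdivrMr.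
have l1 := ler_norm (ln C); have l2 := ler_norm (- ln eta); rewrite normrN in l2.
have l3 := normr_ge0 (ln C); have l4 := normr_ge0 (ln eta).
have L0 : 0 < L by rewrite -(pmulr_rgt0 _ eta0); lra.
have lnL : ln L <= eta * L - 1 - ln eta.
  have := @ln_le_sub1 R (eta * L) (mulr_gt0 eta0 L0).
  by rewrite lnM ?posrE//; lra.
have B0 : 0 < B by rewrite mulr_gt0// mulr_gt0// expR_gt0.
have lnB : ln B = ln C - L + ln L.
  by rewrite /B !lnM ?posrE ?mulr_gt0 ?expR_gt0// expRK addrA.
have hB : (1 - 2 * eta) * L <= - ln B by rewrite lnB; lra.
have etaL : eta * L <= 1 / 8 * L by rewrite ler_wpM2r// ltW.
have Beta : B <= eta.
  have BL : B <= expR (- (L / 2)).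
    by rewrite -(lnK B0) ler_expR; lra.
  apply: le_trans BL _; rewrite expRN -[leRHS]invrK lef_pV2 ?posrE ?invr_gt0 ?expR_gt0//.
  apply: le_trans (expR_ge1Dx _).
  have e1 : eta * eta^-1 = 1 by rewrite mulfV ?gt_eqF.
  rewrite -(ler_pM2l eta0) e1; lra.
split; first by rewrite B0/=; lra.
have h1 : (1 - 2 * eta) * ((1 - 2 * eta) * L) <= (1 - 2 * B) * - ln B.
  apply: ler_pM; [lra| |lra|exact: hB].
  by rewrite mulr_ge0//; lra.
have h2 : 0 <= eta * (eta * L) by rewrite mulr_ge0// ?mulr_ge0// ltW.
have h3 : eta * L <= eps / 8 * L by rewrite ler_wpM2r// ltW.
lra.
Qed.

Lemma near_ln_ge (M : R) : \forall c \near 0^'+, [/\ (0 : R) < c, c < 1 & M <= - ln c].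
Proof.
near=> c; have c0 : 0 < c by [].
have c1 : c < 1 by near: c; exact: nbhs_right_lt.
split => //; rewrite lerNr -ler_expR lnK ?posrE// ltW//.
by near: c; apply: nbhs_right_lt; exact: expR_gt0.
Unshelve. all: end_near. Qed.

Variables (d : measure_display) (T : measurableType d).
Variables (P : hyp -> probability T R) (X : nat -> {mfun T >-> R}).
Hypothesis hX : forall j : hyp, iid_normal (P j) X (mean j).
Variables (prior W : hyp -> R).
Hypotheses (prior_gt0 : forall j, 0 < prior j) (W_gt0 : forall j, 0 < W j).

(** The neighbourhood of 0 is chosen before [delta], so the bound applies to tests that vary with
    [c]. *)
Lemma risk_lower_asymptotic (l eps : R) : (forall l', kl_g l' <= kl_g l) -> 0 < eps ->
  \forall c \near 0^'+, forall delta : dtest R,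
    (((1 - eps) * (c * - ln c * (prior Hf / I_f + (prior Hg1 + prior Hg2) / kl_g l)))%:E
      <= risk P X prior W c delta)%E.
Proof.
move=> lmax eps0.
set K := prior Hf / I_f + _.
have K0 : 0 < K.
  apply: addr_gt0; apply: divr_gt0 => //; [exact: I_f_gt0|exact: addr_gt0|exact: kl_g_gt0].
pose w := Num.min (prior Hf * W Hf) (Num.min (prior Hg1 * W Hg1) (prior Hg2 * W Hg2)).
have w0 : 0 < w by rewrite !lt_min !mulr_gt0.
have hw j : w <= prior j * W j.
  by case: j; rewrite /w !ge_min lexx ?orbT.
have [M hM] := neg_ln_asymptotic (divr_gt0 K0 w0) eps0.
near=> c => delta.
have [c0 c1 cM] : [/\ 0 < c, c < 1 & M <= - ln c] by near: c; exact: near_ln_ge.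
have L0 : 0 < - ln c by rewrite oppr_gt0 ln_lt0// c0.
have [B01 hB] := hM _ cM; rewrite opprK lnK ?posrE// in B01 hB.
set B := K / w * (c * - ln c) in B01 hB.
(* Either the bound holds already, or the risk is below [K * c * |ln c|], which is the a priori
   bound required by [risk_ge]. *)
have [//|risk_lt] := leP _ (risk P X prior W c delta).
have := @risk_ge R d T P X hX prior W c prior_gt0 W_gt0 c0 l delta B w
  (K * (c * - ln c)) lmax B01 hw.
have -> : w * B = K * (c * - ln c).
  by rewrite /B; field; exact: lt0r_neq0.
have rho : (risk P X prior W c delta <= (K * (c * - ln c))%:E)%E.
  apply: le_trans (ltW risk_lt) _; rewrite lee_fin.
  have : 0 < c * - ln c * K by rewrite !mulr_gt0.
  have : 0 < eps * (c * - ln c * K) by rewrite !mulr_gt0.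
  lra.
move=> H; have h := H (lexx _) rho.
have := lt_le_trans risk_lt (le_trans _ h); rewrite ltxx; apply; rewrite lee_fin -/K.
have := ler_wpM2l (ltW (mulr_gt0 c0 K0)) hB; lra.
Unshelve. all: end_near. Qed.

End lower_asymptotics.

(** * Upper bound *)

Lemma exists_upper_bound (R : realType) (I : finType) (f : I -> R) :
  exists2 C, 0 < C & forall i, f i <= C.
Proof.
exists (1 + \sum_i `|f i|).
  by rewrite ltr_wpDr// sumr_ge0.
move=> i; rewrite (bigD1 i)//=.
have : 0 <= \sum_(k | k != i) `|f k| by exact: sumr_ge0.
have := ler_norm (f i); lra.
Qed.

Lemma exists_positive_lower_bound (R : realType) (I : finType) (f : I -> R) :
  (forall i, 0 < f i) -> exists2 k, 0 < k & forall i, k <= f i.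
Proof.
move=> f0; have [C C0 hC] := exists_upper_bound (fun i => (f i)^-1).
exists C^-1; first by rewrite invr_gt0.
by move=> i; rewrite -[f i]invrK lef_pV2 ?posrE ?invr_gt0.
Qed.

(** [expR y * (1 - y) <= 1], while [(1 + y + 2 y^2) (1 - y) = 1 + y^2 (1 - 2 y)]. *)
Lemma expR_le_quadratic (R : realType) (y : R) : y <= 1 / 2 -> expR y <= 1 + y + 2 * (y * y).
Proof.
move=> y2; have e := @expR_ge1Dx R (- y).
have y1 : 0 < 1 - y by lra.
rewrite -(ler_pM2r y1); apply: le_trans (_ : 1 <= _).
  have := ler_wpM2l (expR_ge0 y) e.
  by rewrite -expRD subrr expR0.
have : 0 <= y * y * (1 - 2 * y) by rewrite mulr_ge0 -?expr2 ?sqr_ge0//; lra.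
lra.
Qed.

(** * Smooth maxima of log odds and their drift *)

Section log_power_sum.
Context {R : realType} (I : finType).
Variables (theta : R) (O : pred I).
Hypothesis theta_gt0 : 0 < theta.
Implicit Types (y : I -> R) (r : I -> bool -> R) (p : bool -> R).

Definition power_sum y : R := \sum_(i | O i) expR (theta * ln (y i)).
Definition log_power_sum y : R := theta^-1 * ln (power_sum y).

Lemma power_sum_gt0 y o : O o -> 0 < power_sum y.
Proof.
move=> Oo; rewrite /power_sum (bigD1 o)//= ltr_wpDr ?expR_gt0//.
by apply: sumr_ge0 => i _; exact: expR_ge0.
Qed.

Lemma log_power_sum_ge y i : O i -> ln (y i) <= log_power_sum y.
Proof.
move=> Oi; rewrite /log_power_sum ler_pdivlMl//.
rewrite -[leLHS]expRK ler_ln ?posrE ?expR_gt0 ?(power_sum_gt0 _ Oi)//.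
by rewrite /power_sum (bigD1 i)//= lerDl sumr_ge0// => k _; exact: expR_ge0.
Qed.

Lemma card_gt0_of (o : I) : (0 : R) < #|I|%:R.
Proof. by rewrite ltr0n; apply/card_gt0P; exists o. Qed.

Lemma log_power_sum_le y o t : O o -> (forall i, O i -> ln (y i) <= t) ->
  log_power_sum y <= t + theta^-1 * ln #|I|%:R.
Proof.
move=> Oo h; rewrite /log_power_sum ler_pdivrMl// mulrDr mulVKf ?gt_eqF//.
rewrite -[theta * t]expRK -lnM ?posrE ?expR_gt0 ?(card_gt0_of o)//.
rewrite ler_ln ?posrE ?mulr_gt0 ?expR_gt0 ?(card_gt0_of o) ?(power_sum_gt0 _ Oo)//.
apply: le_trans (_ : \sum_(i | O i) expR (theta * t) <= _).
  by apply: ler_sum => i Oi; rewrite ler_expR ler_pM2l// h.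
rewrite sumr_const -[leLHS]mulr_natr ler_wpM2l ?expR_ge0// ler_nat.
exact: max_card.
Qed.

Lemma log_power_sum_ge_sum y (a : R) : 0 < a -> a <= \sum_(i | O i) y i ->
  ln a - ln #|I|%:R <= log_power_sum y.
Proof.
move=> a0 ha; have [[w Ow]|noO] := pselect (exists o, O o); last first.
  move: ha; rewrite big_pred0 ?leNgt ?a0// => i; apply/negbTE/negP => Oi.
  by apply: noO; exists i.
have n0 := card_gt0_of w.
suff [i Oi hi] : exists2 i, O i & a / #|I|%:R <= y i.
  apply: le_trans (log_power_sum_ge y Oi).
  by rewrite -ln_div ?posrE// ler_ln ?posrE ?divr_gt0//; apply: lt_le_trans hi; rewrite divr_gt0.
apply/not_exists2P => h.
suff : \sum_(i | O i) y i < a by rewrite ltNge ha.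
apply: lt_le_trans (_ : \sum_(i | O i) a / #|I|%:R <= _).
  apply: ltr_sum; first by apply/hasP; exists w; rewrite ?mem_index_enum.
  by move=> i Oi; rewrite ltNge; apply/negP => hi; have [] := h i.
rewrite sumr_const -[leLHS]mulr_natr mulrAC ler_pdivrMr// ler_wpM2l ?ler_nat ?max_card//.
exact: ltW.
Qed.

Lemma power_term_step (a b : R) : 0 < a -> 0 < b ->
  expR (theta * ln (a * b)) = expR (theta * ln a) * expR (theta * ln b).
Proof. by move=> a0 b0; rewrite lnM ?posrE// mulrDr expRD. Qed.

Lemma log_power_sum_step_ge y (r : I -> R) o C : O o -> (forall i, 0 < y i) ->
  (forall i, 0 < r i) -> (forall i, - C <= ln (r i)) ->
  log_power_sum y - C <= log_power_sum (fun i => y i * r i).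
Proof.
move=> Oo y0 r0 hC; rewrite /log_power_sum.
rewrite ler_pdivlMl// mulrBr mulVKf ?gt_eqF//.
rewrite -[theta * C]opprK -[- (theta * C)]expRK opprK -lnM ?posrE ?expR_gt0 ?(power_sum_gt0 _ Oo)//.
rewrite ler_ln ?posrE ?mulr_gt0 ?expR_gt0 ?(power_sum_gt0 _ Oo)//.
rewrite /power_sum mulr_suml; apply: ler_sum => i Oi.
by rewrite power_term_step// ler_wpM2l ?expR_ge0// ler_expR -mulrN ler_pM2l.
Qed.

Section drift.
Variables (p : bool -> R) (r : I -> bool -> R) (y : I -> R) (k : R).
Hypotheses (p_ge0 : forall b, 0 <= p b) (p_sum : p true + p false = 1).
Hypotheses (r_gt0 : forall i b, 0 < r i b) (y_gt0 : forall i, 0 < y i).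
Hypothesis drift : forall i, O i ->
  p true * expR (theta * ln (r i true)) + p false * expR (theta * ln (r i false)) <= k.

Lemma power_sum_drift :
  p true * power_sum (fun i => y i * r i true) +
  p false * power_sum (fun i => y i * r i false) <= k * power_sum y.
Proof.
rewrite /power_sum !mulr_sumr -big_split/=; apply: ler_sum => i Oi.
rewrite !power_term_step//.
by have := ler_wpM2l (expR_ge0 (theta * ln (y i))) (drift Oi); lra.
Qed.

Lemma mean_ln_le (a : R) (m : bool -> R) : 0 < a -> (forall b, 0 < m b) ->
  p true * ln (m true) + p false * ln (m false) <=
  ln a + (p true * m true + p false * m false) / a - 1.
Proof.
move=> a0 m0.
have h b : ln (m b) <= ln a + m b / a - 1.
  by have := @ln_le_sub1 R (m b / a) (divr_gt0 (m0 b) a0); rewrite ln_div ?posrE//; lra.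
have h1 := ler_wpM2l (p_ge0 true) (h true); have h2 := ler_wpM2l (p_ge0 false) (h false).
have e : (p true + p false) * (ln a - 1) = ln a - 1 by rewrite p_sum mul1r.
lra.
Qed.

(** Concavity of [ln], through its tangent at the current power sum, converts the multiplicative
    factor [k] into the additive decrease [(1 - k) / theta >= kap]. *)
Lemma log_power_sum_drift o kap : O o -> k <= 1 - theta * kap ->
  p true * log_power_sum (fun i => y i * r i true) +
  p false * log_power_sum (fun i => y i * r i false) <= log_power_sum y - kap.
Proof.
move=> Oo hk; have M0 := power_sum_gt0 y Oo.
have := mean_ln_le M0 (m := fun b => power_sum (fun i => y i * r i b))
  (fun b => power_sum_gt0 _ Oo).
have := power_sum_drift; rewrite -ler_pdivrMr// => h1 /= h2.
rewrite /log_power_sum [p true * _]mulrCA [p false * _]mulrCA -mulrDr ler_pdivrMl//.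
rewrite mulrBr mulVKf ?gt_eqF//; apply: le_trans h2 _.
by rewrite -addrA lerD2l lerBlDr [leRHS]addrC (le_trans h1).
Qed.

(** A smooth positive part of [log_power_sum y' + t]. Unlike a truncated maximum, it remains a
    supermartingale as soon as [k <= 1], even near 0. *)
Definition softplus t y' : R := theta^-1 * ln (1 + power_sum y' * expR (theta * t)).

Lemma softplus_drift t o : O o -> k <= 1 ->
  p true * softplus t (fun i => y i * r i true) +
  p false * softplus t (fun i => y i * r i false) <= softplus t y.
Proof.
move=> Oo k1; have e0 := expR_gt0 (theta * t).
have m0 y' : 0 < 1 + power_sum y' * expR (theta * t).
  by rewrite ltr_wpDr// mulr_ge0 ?expR_ge0// ltW// (power_sum_gt0 _ Oo).
have := mean_ln_le (m0 y) (m := fun b => 1 + power_sum (fun i => y i * r i b) * expR (theta * t))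
  (fun b => m0 _).
have h1 := power_sum_drift; have M0 := power_sum_gt0 y Oo; have my := m0 y.
rewrite /softplus [p true * (_ * _)]mulrCA [p false * (_ * _)]mulrCA -mulrDr ler_pM2l ?invr_gt0//.
move=> h; apply: le_trans h _; rewrite -addrA gerDl subr_le0 ler_pdivrMr// mul1r.
have h2 := ler_wpM2r (ltW M0) k1; have h3 := le_trans h1 h2; have := ler_wpM2r (ltW e0) h3; rewrite mul1r /=.
move: (power_sum _) (power_sum _) (power_sum _) (expR _) => A B C E; rewrite !mulrDr !mulr1 mulrDl.
rewrite addrACA p_sum -!mulrA => h4; exact: lerD.
Qed.

End drift.

Lemma softplus_ge0 t y o : O o -> 0 <= softplus t y.
Proof.
move=> Oo; apply: mulr_ge0; first by rewrite invr_ge0 ltW.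
apply: ln_ge0.
by rewrite lerDl mulr_ge0 ?expR_ge0// ltW// (power_sum_gt0 _ Oo).
Qed.

Lemma softplus_ge t y o : O o -> log_power_sum y + t <= softplus t y.
Proof.
move=> Oo; have M0 := power_sum_gt0 y Oo.
rewrite /softplus /log_power_sum ler_pdivlMl// mulrDr mulVKf ?gt_eqF//.
rewrite -[theta * t]expRK -lnM ?posrE ?expR_gt0// expRK ler_ln ?posrE ?mulr_gt0 ?expR_gt0//.
  by rewrite lerDr.
by rewrite addr_gt0 ?mulr_gt0 ?expR_gt0.
Qed.

Lemma softplus_le t y o : O o -> 0 <= t -> softplus t y <= t + theta^-1 * ln (1 + power_sum y).
Proof.
move=> Oo t0; have M0 := power_sum_gt0 y Oo.
have e1 : 1 <= expR (theta * t) by rewrite -expR0 ler_expR mulr_ge0// ltW.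
rewrite /softplus ler_pdivrMl// mulrDr mulVKf ?gt_eqF//.
rewrite -[theta * t in leRHS]expRK -lnM ?posrE ?expR_gt0 ?addr_gt0//.
have := ltW (mulr_gt0 M0 (expR_gt0 (theta * t))) => ?.
rewrite ler_ln ?posrE ?mulr_gt0 ?expR_gt0 ?addr_gt0//; first lra.
exact: mulr_gt0 (expR_gt0 _).
Qed.

End log_power_sum.

(** * Posterior and stages of the test [delta_I] *)

Section two_stage_facts.
Context {R : realType}.
Variables (prior W : hyp -> R) (lambda u c : R).
Hypotheses (prior_gt0 : forall j, 0 < prior j) (prior_sum : \sum_j prior j = 1).
Hypothesis (W_gt0 : forall j, 0 < W j).
Implicit Types (s : seq bool) (b : bool) (i j : hyp).

Local Notation state := (two_stage_state prior lambda u).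
Local Notation post s := (state s).1.
Local Notation stg s := (state s).2.
Local Notation mp s := (message_prob (stage_quantizer lambda (stg s))).
Local Notation deltaI := (delta_I prior W lambda u c).

Lemma sum_hyp (F : hyp -> R) : \sum_j F j = F Hf + F Hg1 + F Hg2.
Proof.
have n21 : Hg2 != Hg1 by apply/eqP.
rewrite (bigD1 Hf)//= (bigD1 Hg1) ?Hg1_neq_Hf//= (bigD1 Hg2) ?Hg2_neq_Hf ?n21//=.
rewrite big1 ?addr0 ?addrA// => i /andP[/andP[/eqP h1 /eqP h2] /eqP h3].
by case: i h1 h2 h3.
Qed.

Lemma two_stage_state_rcons s b :
  state (rcons s b) = two_stage_step lambda u (state s) b.
Proof. by rewrite /two_stage_state foldl_rcons. Qed.

Lemma post_rcons s b : post (rcons s b) = bayes_update (stage_quantizer lambda (stg s)) (post s) b.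
Proof. by rewrite two_stage_state_rcons. Qed.

Lemma post_gt0 s j : 0 < post s j.
Proof.
elim/last_ind: s j => [|s b IH] j //; rewrite post_rcons /bayes_update.
rewrite divr_gt0 ?mulr_gt0 ?stage_message_prob_gt0// sum_hyp.
by rewrite !addr_gt0 ?mulr_gt0 ?stage_message_prob_gt0.
Qed.

Let norm_gt0 s b : 0 < \sum_i post s i * mp s i b.
Proof. by rewrite sum_hyp !addr_gt0 ?mulr_gt0 ?stage_message_prob_gt0 ?post_gt0. Qed.

Lemma post_sum s : \sum_j post s j = 1.
Proof.
elim/last_ind: s => [|s b IH] //; rewrite post_rcons /bayes_update.
by rewrite -mulr_suml divff// gt_eqF.
Qed.

Lemma post_odds_step s b i j : post (rcons s b) i / post (rcons s b) j =
  post s i / post s j * (mp s i b / mp s j b).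
Proof.
rewrite post_rcons /bayes_update.
have h1 := lt0r_neq0 (norm_gt0 s b); have h2 := lt0r_neq0 (post_gt0 s j).
have h3 := lt0r_neq0 (stage_message_prob_gt0 lambda (stg s) j b).
by field; rewrite h1 h2 h3.
Qed.

Lemma max_post_ge (f : hyp -> R) j : f j <= max_post f.
Proof. by case: j; rewrite /max_post !le_max lexx ?orbT. Qed.

Lemma max_post_le_arg (f : hyp -> R) : max_post f <= f [arg max_(j > Hf) f j]%O.
Proof.
case: arg_maxP => // i _ h.
by rewrite /max_post !ge_max; apply/and3P; split; exact: h.
Qed.

(** The hypothesis on the prior covers the empty word, at which the end of the first stage is not
    tested. *)
Lemma first_stage_post_le s j : (forall j, prior j <= 1 - u) -> stg s = None ->
  post s j <= 1 - u.
Proof.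
move=> hprior; elim/last_ind: s => [|s b IH]//.
rewrite two_stage_state_rcons /two_stage_step /=.
case: (stg s) => [//|]; case: ltP => // h _; apply/ltW/le_lt_trans; last exact: h.
exact: max_post_ge.
Qed.

Lemma stage_transition s b d : stg s = None -> stg (rcons s b) = Some d ->
  1 - u <= post (rcons s b) d.
Proof.
rewrite two_stage_state_rcons /two_stage_step => -> /=.
case: leP => // h [<-]; apply: le_trans h _; exact: max_post_le_arg.
Qed.

Lemma second_stage_rcons s b d : stg s = Some d -> stg (rcons s b) = Some d.
Proof. by rewrite two_stage_state_rcons /two_stage_step => ->. Qed.

Lemma two_stage_not_stops s : ~~ stopped deltaI s -> ~~ two_stage_stops prior W lambda u c s.
Proof.
apply: contra => hs; rewrite /stopped /= /first_time.
have hn : two_stage_stops prior W lambda u c (mkseq (nth false s) (size s)).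
  by rewrite mkseq_nth.
case: pselect => [h|[]]; last by exists (size s).
by case: ex_minnP => n _; apply.
Qed.

Lemma two_stage_stop s : stop deltaI (nth false s) = Some (size s) ->
  two_stage_stops prior W lambda u c s.
Proof.
rewrite /= /first_time; case: pselect => // h; case: ex_minnP => n hn _ [nE].
by move: hn; rewrite nE mkseq_nth.
Qed.

End two_stage_facts.

(** The two alternatives call for the same decision and are not opponents: which of them holds need
    not be resolved for the final decision. *)
Definition opponents (j i : hyp) : bool := wrong j != wrong i.

Lemma opponents_neq j i : opponents j i -> i != j.
Proof. by move=> h; apply/eqP => E; rewrite E /opponents eqxx in h. Qed.

Lemma exists_opponent j : exists i, opponents j i.
Proof. by case: j; [exists Hg1|exists Hf|exists Hf]. Qed.

Lemma expR_mul_le (R : realType) (theta C z : R) : 0 < theta -> theta * C <= 1 / 2 ->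
  `|z| <= C -> expR (theta * z) <= 1 + theta * z + 2 * (theta * (theta * (C * C))).
Proof.
move=> t0 tC; rewrite ler_norml => /andP[z1 z2].
have z3 : theta * z <= 1 / 2 by apply: le_trans tC; rewrite ler_pM2l.
apply: le_trans (expR_le_quadratic z3) _; rewrite lerD2l ler_pM2l// mulrACA -mulrA.
rewrite ler_pM2l// ler_pM2l//.
have : 0 <= (C - z) * (C + z) by apply: mulr_ge0; lra.
lra.
Qed.

(** The moment of order [theta] of the likelihood ratio is [1 - theta * kl p q] up to
    [2 theta^2 C^2], so for small [theta] its decay rate is close to the information. *)
Lemma kl_moment_le (R : realType) (p q theta C kap : R) : 0 < theta -> theta * C <= 1 / 2 ->
  0 < p < 1 -> 0 < q < 1 -> `|ln (q / p)| <= C -> `|ln ((1 - q) / (1 - p))| <= C ->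
  kap <= kl p q - 2 * (theta * (C * C)) ->
  p * expR (theta * ln (q / p)) + (1 - p) * expR (theta * ln ((1 - q) / (1 - p)))
    <= 1 - theta * kap.
Proof.
move=> t0 tC /andP[p0 p1] /andP[q0 q1] /(expR_mul_le t0 tC) h1 /(expR_mul_le t0 tC) h2 hk.
have p1' : 0 < 1 - p by lra.
have q1' : 0 < 1 - q by lra.
have := ler_wpM2l (ltW p0) h1; have := ler_wpM2l (ltW p1') h2; have := ler_wpM2l (ltW t0) hk.
rewrite /kl -(invf_div p q) -(invf_div (1 - p) (1 - q)) !lnV ?posrE ?divr_gt0//.
move: (ln _) (ln _) (expR _) (expR _) => a1 a2 e1 e2.
move: (theta * (C * C)) => v {}h1 {}h2 h3; apply: le_trans (lerD h3 h2) _.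
lra.
Qed.

(** * Drift of the odds under each stage quantizer *)

Section drift_constants.
Local Opaque message_prob I_f kl_g nprob Phi.
Context {R : realType}.
Variable lambda : R.
Implicit Types (st : stage) (i j : hyp) (b : bool).

Local Notation mp st := (message_prob (stage_quantizer lambda st)).

Definition decisive_info j : R := if j is Hf then I_f else kl_g lambda.

Lemma decisive_info_gt0 j : 0 < decisive_info j.
Proof. by case: j; [exact: I_f_gt0|exact: kl_g_gt0|exact: kl_g_gt0]. Qed.

Lemma info_opponent j i : opponents j i ->
  info (stage_quantizer lambda (Some j)) j i = decisive_info j.
Proof.
case: j => h; first exact: info_half (opponents_neq h) (or_intror erefl).
- have -> : i = Hf by case: i h.
  exact: info_lambda Hg1_neq_Hf.
- have -> : i = Hf by case: i h.
  exact: info_lambda Hg2_neq_Hf.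
Qed.

Lemma message_ratio_gt0 st j i b : 0 < mp st i b / mp st j b.
Proof. by rewrite divr_gt0 ?stage_message_prob_gt0. Qed.

Lemma log_ratio_bounded : exists2 C : R, 0 < C &
  forall st j i b, `|ln (mp st i b / mp st j b)| <= C.
Proof.
have [C C0 hC] := exists_upper_bound (fun t : stage * hyp * hyp * bool =>
  `|ln (mp t.1.1.1 t.1.2 t.2 / mp t.1.1.1 t.1.1.2 t.2)|).
by exists C => // st j i b; have := hC (st, j, i, b).
Qed.

Lemma info_lower_bound : exists2 kap : R, 0 < kap &
  forall st j i, i != j -> kap <= info (stage_quantizer lambda st) j i.
Proof.
have [|k k0 hk] := @exists_positive_lower_bound R (stage * hyp * hyp)%type
  (fun t => if t.2 == t.1.2 then 1 else info (stage_quantizer lambda t.1.1) t.1.2 t.2).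
  by move=> [[st j] i] /=; case: eqVneq => // ij; apply: stage_info_gt0; rewrite eq_sym.
exists k => // st j i ij; have := hk (st, j, i).
by rewrite /= (negbTE ij).
Qed.

(** A Hellinger-type moment: the expectation under [j] of the power [theta] of the likelihood ratio
    of [i] to [j] for one message. *)
Definition ratio_moment (theta : R) st j i : R :=
  mp st j true * expR (theta * ln (mp st i true / mp st j true)) +
  mp st j false * expR (theta * ln (mp st i false / mp st j false)).

Lemma ratio_moment_le st j i (theta C kap : R) : 0 < theta -> theta * C <= 1 / 2 ->
  (forall b, `|ln (mp st i b / mp st j b)| <= C) ->
  kap <= info (stage_quantizer lambda st) j i - 2 * (theta * (C * C)) ->
  ratio_moment theta st j i <= 1 - theta * kap.
Proof.
move=> t0 tC hC; have := hC true; have := hC false.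
have mq := stage_quantizer_measurable lambda st.
rewrite /ratio_moment /info !(message_probN _ mq) => h1 h2 h3.
exact: kl_moment_le (stage_message_prob01 lambda st j) (stage_message_prob01 lambda st i) h2 h1 h3.
Qed.

End drift_constants.

(** * A supersolution for the sample size of [delta_I] *)

Section supersolution.
Context {R : realType}.
Variables (prior W : hyp -> R) (lambda u c : R).
Hypotheses (prior_gt0 : forall j, 0 < prior j) (prior_sum : \sum_j prior j = 1).
Hypothesis (W_gt0 : forall j, 0 < W j).
(** [C] bounds the change of log odds by one message. [kap] is a crude rate, valid for every stage
    quantizer and every other hypothesis; [kapc] is the rate of the right second-stage quantizer
    against opponents, later taken close to [decisive_info]. *)
Variables (j : hyp) (theta C kap kapc Wm : R).
Hypotheses (theta_gt0 : 0 < theta) (C_gt0 : 0 < C) (kap_gt0 : 0 < kap) (kapc_gt0 : 0 < kapc).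
Local Notation mp st := (message_prob (stage_quantizer lambda st)).
Local Notation moment st i := (ratio_moment lambda theta st j i).
Hypothesis hC : forall st i b, `|ln (mp st i b / mp st j b)| <= C.
Hypothesis hkap : forall st i, i != j -> moment st i <= 1 - theta * kap.
Hypothesis hkapc : forall i, opponents j i -> moment (Some j) i <= 1 - theta * kapc.
Hypothesis hWm : forall i, W i / W j <= Wm.

Local Notation state := (two_stage_state prior lambda u).
Local Notation post s := (state s).1.
Local Notation stg s := (state s).2.
Local Notation deltaI := (delta_I prior W lambda u c).
Local Notation lps := (log_power_sum theta).
Local Notation O := (opponents j).
Local Notation N := (predC1 j).
Local Notation tree := (message_tree deltaI j).

Definition odds (s : seq bool) i : R := post s i / post s j.
Definition weighted_odds s i : R := W i / W j * odds s i.
Local Notation x := odds.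
Local Notation y := weighted_odds.
Local Notation r s i b := (mp (stg s) i b / mp (stg s) j b).

Lemma odds_gt0 s i : 0 < x s i.
Proof. by rewrite divr_gt0 ?post_gt0. Qed.

Lemma weighted_odds_gt0 s i : 0 < y s i.
Proof. by rewrite mulr_gt0 ?odds_gt0// divr_gt0. Qed.

Lemma odds_rcons s b : x (rcons s b) = (fun i => x s i * r s i b).
Proof. by apply/funext => i; rewrite /odds post_odds_step. Qed.

Lemma weighted_odds_rcons s b : y (rcons s b) = (fun i => y s i * r s i b).
Proof. by apply/funext => i; rewrite /weighted_odds odds_rcons mulrA. Qed.

Lemma sum_odds_ge s : post s j <= 1 - u -> u <= \sum_(i | i != j) x s i.
Proof.
move=> h; have p0 := post_gt0 lambda u prior_gt0 s j.
have pS := post_sum lambda u prior_gt0 prior_sum s.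
rewrite /odds -mulr_suml.
move: pS; rewrite (bigD1 j)//= => pS.
have S0 : 0 <= \sum_(i | i != j) post s i by apply: sumr_ge0 => i _; exact/ltW/post_gt0.
move: (\sum_(i | i != j) _) pS S0 => S pS S0.
have q1 : 0 <= 1 - post s j by lra.
have -> : S = 1 - post s j by lra.
rewrite ler_pdivlMr//; apply: le_trans (_ : 1 - post s j <= _); last by [].
have [u0|u0] := leP 0 u; last first.
  apply: le_trans q1; rewrite pmulr_lle0 ?ltW//.
apply: le_trans (_ : u * 1 <= _); last lra.
by rewrite ler_wpM2l//; lra.
Qed.

(** Under [f] the sum is the inverse of [post_ratio]. Under an alternative the only opponent is [f],
    and its weighted odds exceed [post_ratio], whose denominator also contains the other
    alternative. *)
Lemma weighted_odds_ge s d : ~~ two_stage_stops prior W lambda u c s -> stg s = Some d ->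
  0 < c -> c <= \sum_(i | O i) y s i.
Proof.
move=> + sd c0; rewrite /two_stage_stops sd /= negbK in_itv /= /post_ratio => /andP[h1 h2].
have p0 i := post_gt0 lambda u prior_gt0 s i.
rewrite big_mkcond sum_hyp /weighted_odds /odds.
have a1 := mulr_gt0 (p0 Hg1) (W_gt0 Hg1); have a2 := mulr_gt0 (p0 Hg2) (W_gt0 Hg2).
have a0 := mulr_gt0 (p0 Hf) (W_gt0 Hf).
have ga (a b : R) k : 0 < a -> a <= b -> c < post s Hf * W Hf / b ->
    a = post s k * W k -> c <= W Hf / W k * (post s Hf / post s k).
  move=> a_gt0 ab h aE; rewrite mulrACA -invfM [W k * _]mulrC -aE [W Hf * _]mulrC.
  apply: le_trans (ltW h) _; rewrite ler_pM2l// lef_pV2 ?posrE//; exact: lt_le_trans ab.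
case: j; rewrite /= ?(add0r, addr0).
- move: h2; rewrite -[_ / _]invf_div ltf_pV2 ?posrE ?divr_gt0 ?addr_gt0// => /ltW h2.
  apply: le_trans h2 _; rewrite le_eqVlt; apply/orP; left; apply/eqP.
  have := lt0r_neq0 (p0 Hf); have := lt0r_neq0 (W_gt0 Hf) => k1 k2.
  by field; rewrite k1 k2.
- by apply: (ga _ _ _ a1 _ h1) => //; rewrite lerDl ltW.
- by apply: (ga _ _ _ a2 _ h1) => //; rewrite lerDr ltW.
Qed.

Lemma two_stage_state_nil : state [::] = (prior, None).
Proof. by []. Qed.

Local Opaque message_prob two_stage_state.
Hypotheses (c_gt0 : 0 < c) (u_gt0 : 0 < u) (u_le : u <= 1 / 2).
Hypothesis hprior : forall i, prior i <= 1 - u.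
Local Notation L := (- ln c).
Local Notation Lu := (- ln u).
Local Notation K1 := (ln #|{: hyp}|%:R + C).
Hypotheses (L_ge1 : 1 <= L) (Lu_le : Lu <= L).
Hypothesis K_le : ln Wm + theta^-1 * ln #|{: hyp}|%:R + K1 <= L.

(** Up to a constant, [excess] is the log-odds distance to the stopping boundary.
    The three terms of [early_bound] pay for the rest of the first stage, for a
    second stage after the right preliminary decision, and for one after a wrong
    decision, which lasts [O(L)] but has probability [O(u)]. *)
Definition excess s : R := lps O (y s) + L + K1.
Definition late_bound d s : R := Num.max 0 (excess s) / (if d == j then kapc else kap).
Definition early_bound s : R :=
  (lps N (x s) + Lu + K1) / kap + softplus theta O (L + K1) (y s) / kapc
  + 8 / kap * (u * L) * \sum_(i | i != j) x s i.
Definition size_bound s : R := if stg s is Some d then late_bound d s else early_bound s.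

Let mp_ge0 s b : 0 <= mp (stg s) j b.
Proof. exact: message_prob_ge0. Qed.

Let mp_sum s : mp (stg s) j true + mp (stg s) j false = 1.
Proof.
by rewrite (message_probN _ (stage_quantizer_measurable lambda (stg s))) addrC subrK.
Qed.

Lemma delta_I_step F s : step tree F s =
  mp (stg s) j true * F (rcons s true) + mp (stg s) j false * F (rcons s false).
Proof. by []. Qed.

Let r_gt0 s i b : 0 < r s i b.
Proof. exact: message_ratio_gt0. Qed.

Let r_ge s i b : - C <= ln (r s i b).
Proof. by have := hC (stg s) i b; rewrite ler_norml => /andP[]. Qed.

Let lnn_ge0 : 0 <= ln (#|{: hyp}|%:R : R).
Proof. by rewrite ln_ge0// ler1n; apply/card_gt0P; exists Hf. Qed.

Lemma late_bound_ge0 d s : 0 <= late_bound d s.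
Proof.
rewrite /late_bound divr_ge0 ?le_max ?lexx//.
by case: ifP => _; exact: ltW.
Qed.

(** The margin [K1] is made for this step. Before stopping, [excess] is at least [C], the logarithm
    of the number of hypotheses being lost between sum and maximum; one message lowers it by at most
    [C]. The truncation at 0 is thus inactive, and the drift is that of the log power sum. *)
Lemma late_bound_step s d : ~~ two_stage_stops prior W lambda u c s -> stg s = Some d ->
  1 + step tree (late_bound d) s <= late_bound d s.
Proof.
move=> ns sd; have [w Oo] := exists_opponent j.
have h1 := log_power_sum_ge_sum theta_gt0 c_gt0 (weighted_odds_ge ns sd c_gt0).
have ex0 : C <= excess s by rewrite /excess; lra.
have ex1 b : 0 <= excess (rcons s b).
  rewrite /excess weighted_odds_rcons.
  have := log_power_sum_step_ge theta_gt0 Oo (weighted_odds_gt0 s) (r_gt0 s ^~ b) (r_ge s ^~ b).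
  by move: ex0; rewrite /excess; move: (lps O _) (lps O _) => a1 a2 h2 h3; lra.
set kd := if d == j then kapc else kap.
have lateE s' : 0 <= excess s' -> late_bound d s' = excess s' / kd.
  by move=> e0; rewrite /late_bound max_r.
rewrite delta_I_step (lateE _ (ex1 true)) (lateE _ (ex1 false)) (lateE _ (le_trans (ltW C_gt0) ex0)).
have kd0 : 0 < kd by rewrite /kd; case: ifP.
have hk i : O i -> moment (stg s) i <= 1 - theta * kd.
  rewrite sd /kd; case: eqP => [->|_] Oi; first exact: hkapc.
  exact/hkap/opponents_neq.
have := log_power_sum_drift theta_gt0 (mp_ge0 s) (mp_sum s) (r_gt0 s) (weighted_odds_gt0 s)
  hk Oo (lexx _).
rewrite -!weighted_odds_rcons /excess; have := mp_sum s.
move: (lps O _) (lps O _) (lps O _) (mp _ _ true) (mp _ _ false) => a0 a1 a p q pq h.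
rewrite !mulrA -!mulrDl -[X in X + _ <= _](mulfV (lt0r_neq0 kd0)) -mulrDl ler_pM2r ?invr_gt0//.
have e (t : R) : (p + q) * t = t by rewrite pq mul1r.
have := e L; have := e K1; move: (ln #|_|%:R) (ln c) h => n l h e1 e2; lra.
Qed.

Lemma early_duration_ge s : stg s = None -> C <= lps N (x s) + Lu + K1.
Proof.
move=> sn; have := log_power_sum_ge_sum theta_gt0 u_gt0
  (sum_odds_ge (first_stage_post_le j hprior sn)).
by rewrite -/N; move: (lps _ _) => a h; lra.
Qed.

Lemma early_duration_ge0 s b : stg s = None -> 0 <= lps N (x (rcons s b)) + Lu + K1.
Proof.
move=> sn; have [w Ow] := exists_opponent j; have Nw : N w by exact: opponents_neq.
have h1 := early_duration_ge sn.
have := log_power_sum_step_ge theta_gt0 Nw (odds_gt0 s) (r_gt0 s ^~ b) (r_ge s ^~ b).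
rewrite odds_rcons; move: h1; rewrite -/N.
move: (log_power_sum _ _ _) (log_power_sum _ _ _) => a1 a2 h1 h2; lra.
Qed.

Lemma sum_odds_ge0 s : 0 <= \sum_(i | i != j) x s i.
Proof. by apply: sumr_ge0 => i _; exact/ltW/odds_gt0. Qed.

Let B_ge0 : 0 <= 8 / kap * (u * L).
Proof.
by apply: mulr_ge0; [rewrite divr_ge0// ltW|rewrite mulr_ge0 ?ltW// (lt_le_trans ltr01)].
Qed.

Lemma early_bound_ge0 s b : stg s = None -> 0 <= early_bound (rcons s b).
Proof.
move=> sn; have [w Ow] := exists_opponent j.
rewrite /early_bound !addr_ge0//.
- by rewrite divr_ge0 ?early_duration_ge0// ltW.
- by rewrite divr_ge0 ?(ltW kapc_gt0)// (softplus_ge0 theta_gt0 _ _ Ow).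
- by rewrite mulr_ge0// sum_odds_ge0.
Qed.

Lemma sum_odds_martingale s :
  mp (stg s) j true * (\sum_(i | i != j) x (rcons s true) i) +
  mp (stg s) j false * (\sum_(i | i != j) x (rcons s false) i) = \sum_(i | i != j) x s i.
Proof.
rewrite !odds_rcons !mulr_sumr -big_split/=; apply: eq_bigr => i _.
have p b : mp (stg s) j b != 0 by exact/lt0r_neq0/stage_message_prob_gt0.
have e (q a t : R) : q != 0 -> q * (a * (t / q)) = a * t by move=> q0; field.
rewrite (e _ _ _ (p true)) (e _ _ _ (p false)) -mulrDr.
by rewrite (message_probN _ (stage_quantizer_measurable lambda (stg s))) addrC subrK mulr1.
Qed.

(** The first term decreases by 1 on average and pays for the message; the second is a
    supermartingale, the third a martingale. *)
Lemma early_bound_step s : stg s = None -> 1 + step tree early_bound s <= early_bound s.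
Proof.
move=> sn; have [w Ow] := exists_opponent j; have Nw : N w by exact: opponents_neq.
have m1 := log_power_sum_drift theta_gt0 (mp_ge0 s) (mp_sum s) (r_gt0 s) (odds_gt0 s)
  (fun i => hkap (stg s) (i:=i)) Nw (lexx _).
have k1 i : O i -> moment (stg s) i <= 1.
  move=> /opponents_neq /(hkap (stg s)) /le_trans; apply.
  by rewrite gerBl mulr_ge0 ?ltW.
have m2 := softplus_drift theta_gt0 (mp_ge0 s) (mp_sum s) (r_gt0 s) (weighted_odds_gt0 s)
  k1 (L + K1) Ow (lexx _).
have m3 := sum_odds_martingale s.
rewrite -!odds_rcons in m1; rewrite -!weighted_odds_rcons in m2.
rewrite delta_I_step /early_bound.
have := mp_sum s; move: m1 m2 m3.
move: (\sum_(i | i != j) _) (\sum_(i | i != j) _) (\sum_(i | i != j) _) => x0 x1 x2.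
move: (softplus _ _ _ _) (softplus _ _ _ _) (softplus _ _ _ _) => s0 s1 s2.
move: (lps N _) (lps N _) (lps N _) (mp _ _ true) (mp _ _ false) => a0 a1 a p q.
move: (8 / kap * (u * L)) => B m1 m2 m3 pq.
have i1 : 0 <= kap^-1 by rewrite invr_ge0 ltW.
have i2 : 0 <= kapc^-1 by rewrite invr_ge0 ltW.
have := ler_wpM2r i1 m1; have := ler_wpM2r i2 m2; rewrite [(_ - kap) * _]mulrBl mulfV ?lt0r_neq0//.
have := congr1 ( *%R B) m3.
have e (t : R) : (p + q) * t = t by rewrite pq mul1r.
have := e ((Lu + K1) / kap).
move: (kap^-1) (kapc^-1) (ln _ + C) (ln u) => k k' n l h1 h2 h3 h4; lra.
Qed.

(** After a wrong decision the posterior of [j] is at most [u], so the sum [X] of odds satisfies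
    [u * X >= 1/2]. Then [excess] is at most [u * X + 3 L], by [ln X <= u * X - ln u] and the
    hypotheses on [L], hence at most [7 u X L]; the constant 8 is enough. *)
Lemma late_le_early s b d : stg s = None -> stg (rcons s b) = Some d ->
  late_bound d (rcons s b) <= early_bound (rcons s b).
Proof.
move=> sn sd; have [w Ow] := exists_opponent j.
have a0 : 0 <= (lps N (x (rcons s b)) + Lu + K1) / kap.
  by rewrite divr_ge0 ?early_duration_ge0// ltW.
have b0 : 0 <= softplus theta O (L + K1) (y (rcons s b)) / kapc.
  by rewrite divr_ge0 ?(ltW kapc_gt0)// (softplus_ge0 theta_gt0 _ _ Ow).
have X0 := sum_odds_ge0 (rcons s b).
have c0 := mulr_ge0 B_ge0 X0.
rewrite /late_bound /early_bound; case: eqP => [dj|/eqP dj].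
  apply: le_trans (_ : softplus theta O (L + K1) (y (rcons s b)) / kapc <= _); last first.
    by rewrite -addrA addrCA lerDl addr_ge0.
  rewrite ler_pM2r ?invr_gt0// ge_max (softplus_ge0 theta_gt0 _ _ Ow)/=.
  by rewrite /excess -addrA (softplus_ge theta_gt0 _ _ Ow).
apply: le_trans (_ : 8 / kap * (u * L) * (\sum_(i | i != j) x (rcons s b) i) <= _); last first.
  by rewrite lerDr addr_ge0.
rewrite [8 / kap]mulrC -!mulrA mulrC ler_pM2l ?invr_gt0//.
have xX i : i != j -> x (rcons s b) i <= \sum_(i | i != j) x (rcons s b) i.
  by move=> ij; rewrite (bigD1 i)//= lerDl sumr_ge0// => k _; exact/ltW/odds_gt0.
have uX : 1 / 2 <= u * \sum_(i | i != j) x (rcons s b) i.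
  have pd := stage_transition sn sd; have p0 := post_gt0 lambda u prior_gt0 (rcons s b).
  have pS : post (rcons s b) j + post (rcons s b) d <= 1.
    rewrite -(post_sum lambda u prior_gt0 prior_sum (rcons s b)) (bigD1 j)//= lerD2l.
    by rewrite (bigD1 d)//= lerDl sumr_ge0// => k _; exact: ltW.
  apply: le_trans (ler_wpM2l (ltW u_gt0) (xX d dj)); rewrite /odds mulrA ler_pdivlMr//.
  have := p0 j; move: (post _ j) (post _ d) pd pS => a e pd pS a1.
  have k1 : u * (1 - u) <= u * e by rewrite ler_pM2l.
  have k2 : a <= u by lra.
  have k3 : 0 <= u * (1 / 2 - u) by rewrite mulr_ge0 ?subr_ge0// ltW.
  lra.
move: xX uX; rewrite -/(odds _); move: X0 {c0}.
set X := \sum_(i | _) _ => X0 xX uX.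
have XU : 0 < X by rewrite -(pmulr_rgt0 _ u_gt0) (lt_le_trans _ uX).
have Wm0 : 0 < Wm by apply: lt_le_trans (hWm j); rewrite divr_gt0.
have lnX : ln X <= u * X + Lu.
  have := @ln_le_sub1 R (u * X) (mulr_gt0 u_gt0 XU); rewrite lnM ?posrE//; lra.
have ylX i : O i -> ln (y (rcons s b) i) <= ln Wm + ln X.
  move=> /opponents_neq ij; rewrite lnM ?posrE ?odds_gt0 ?divr_gt0// lerD// ler_ln ?posrE ?odds_gt0 ?divr_gt0//.
  exact: xX.
have : lps O (y (rcons s b)) <= ln Wm + ln X + theta^-1 * ln #|{: hyp}|%:R :=
  log_power_sum_le theta_gt0 Ow ylX.
have L0 : 0 <= L by exact: le_trans ler01 L_ge1.
have h1 : u * X * 1 <= u * X * L by rewrite ler_wpM2l// ltW// mulr_gt0.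
have h2 : 1 / 2 * L <= u * X * L by rewrite ler_wpM2r.
rewrite ge_max => h; apply/andP; split; first by rewrite !mulr_ge0// ltW.
rewrite /excess; move: h K_le lnX Lu_le h1 h2.
rewrite [u * (L * X)]mulrCA [L * _]mulrC.
move: (u * X * L) => z8.
move: (u * X) => z7.
move: (ln u) => z6.
move: (ln X) => z5.
move: (ln Wm) => z4.
move: (ln #|_|%:R) => z3.
move: (theta^-1 * _) (lps O _) => z2 z1 h3 h4 h5 h6 h7 h8; lra.
Qed.

Lemma size_bound_step s : ~~ stopped deltaI s ->
  (forall b, 0 <= size_bound (rcons s b)) /\ 1 + step tree size_bound s <= size_bound s.
Proof.
move=> /two_stage_not_stops ns; rewrite /size_bound.
case E : (stg s) => [d|].
  have k b : stg (rcons s b) = Some d by exact: second_stage_rcons.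
  split => [b|]; first by rewrite k late_bound_ge0.
  by rewrite delta_I_step !k -delta_I_step; exact: late_bound_step.
split => [b|].
  by case: (stg (rcons s b)) => [d|]; [exact: late_bound_ge0|exact: early_bound_ge0].
apply: le_trans (early_bound_step E); rewrite lerD2l; apply: step_le.
  exact: tree_prob_message_tree.
move=> b; case F : (stg (rcons s b)) => [d|//]; exact: late_le_early.
Qed.

Lemma cost_delta_I_le m : cost deltaI tree (fun=> 1) m [::] <=
  (lps N (fun i => prior i / prior j) + Lu + K1) / kap +
  (L + K1 + theta^-1 * ln (1 + power_sum theta O (fun i => W i / W j * (prior i / prior j)))) / kapc
  + 8 / kap * (u * L) * \sum_(i | i != j) prior i / prior j.
Proof.
have [w Ow] := exists_opponent j.
have K10 : 0 <= K1 by rewrite addr_ge0// ltW.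
have L0 : 0 <= L by exact: le_trans ler01 L_ge1.
have sn : stg [::] = None by rewrite two_stage_state_nil.
have e0 : 0 <= early_bound [::].
  rewrite /early_bound !addr_ge0//.
  - by rewrite divr_ge0 ?(ltW kap_gt0)// (le_trans (ltW C_gt0))// early_duration_ge.
  - by rewrite divr_ge0 ?(ltW kapc_gt0)// (softplus_ge0 theta_gt0 _ _ Ow).
  - by rewrite mulr_ge0// sum_odds_ge0.
have e1 : size_bound [::] = early_bound [::] by rewrite /size_bound two_stage_state_nil.
have x0 : x [::] = fun i => prior i / prior j by rewrite /odds two_stage_state_nil.
have y0 : y [::] = fun i => W i / W j * (prior i / prior j) by rewrite /weighted_odds x0.
rewrite -e1 in e0.
apply: le_trans (cost_supersolution m (tree_prob_message_tree deltaI j) e0 size_bound_step) _.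
rewrite e1 /early_bound x0 y0 lerD2r lerD2l ler_pM2r ?invr_gt0//.
by rewrite (softplus_le theta_gt0 _ Ow)// addr_ge0.
Qed.

End supersolution.

(** * Error probabilities of [delta_I] *)

Section wrong_decision.
Context {R : realType}.
Variables (prior W : hyp -> R) (lambda u c : R).
Hypotheses (prior_gt0 : forall j, 0 < prior j) (prior_sum : \sum_j prior j = 1).
Hypotheses (W_gt0 : forall j, 0 < W j) (c_gt0 : 0 < c).
Variable j : hyp.

Local Notation state := (two_stage_state prior lambda u).
Local Notation post s := (state s).1.
Local Notation stg s := (state s).2.
Local Notation mp st := (message_prob (stage_quantizer lambda st)).
Local Notation deltaI := (delta_I prior W lambda u c).
Local Notation tree := (message_tree deltaI j).
Local Notation y := (weighted_odds prior W lambda u j).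
Local Notation O := (opponents j).

(** Counterpart of [weighted_odds_ge] beyond the boundary. For an alternative, a wrong decision
    means a ratio above [c]; since the test has stopped, it is then at least [1 / c]. *)
Lemma weighted_odds_wrong s : stop deltaI (nth false s) = Some (size s) ->
  decide deltaI s = wrong j -> c^-1 <= \sum_(i | O i) y s i.
Proof.
move=> /two_stage_stop /andP[_ +]; rewrite in_itv /= /post_ratio => + dec.
have p0 i := post_gt0 lambda u prior_gt0 s i.
rewrite big_mkcond sum_hyp /weighted_odds /odds.
have a1 := mulr_gt0 (p0 Hg1) (W_gt0 Hg1); have a2 := mulr_gt0 (p0 Hg2) (W_gt0 Hg2).
have a0 := mulr_gt0 (p0 Hf) (W_gt0 Hf).
have ga (a b : R) k : 0 < a -> a <= b -> c^-1 <= post s Hf * W Hf / b ->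
    a = post s k * W k -> c^-1 <= W Hf / W k * (post s Hf / post s k).
  move=> a_gt0 ab h aE; rewrite mulrACA -invfM [W k * _]mulrC -aE [W Hf * _]mulrC.
  apply: le_trans h _; rewrite ler_pM2l// lef_pV2 ?posrE//; exact: lt_le_trans ab.
move: dec; rewrite /= /post_ratio; case: j => /= dec; rewrite ?(add0r, addr0) => h.
- move: dec; rewrite -[_ / _ <= _]lef_pV2 ?posrE ?divr_gt0 ?addr_gt0// invf_div => dec.
  apply: le_trans dec _; rewrite le_eqVlt; apply/orP; left; apply/eqP.
  have := lt0r_neq0 (p0 Hf); have := lt0r_neq0 (W_gt0 Hf) => k1 k2.
  by field; rewrite k1 k2.
- move: h; rewrite ltNge dec/= -leNgt => h.
  by apply: (ga _ _ _ a1 _ h) => //; rewrite lerDl ltW.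
- move: h; rewrite ltNge dec/= -leNgt => h.
  by apply: (ga _ _ _ a2 _ h) => //; rewrite lerDr ltW.
Qed.

Local Opaque message_prob two_stage_state.

Lemma sum_weighted_odds_martingale s :
  step tree (fun s => \sum_(i | O i) y s i) s = \sum_(i | O i) y s i.
Proof.
rewrite /step /= !mulr_sumr -big_split/=; apply: eq_bigr => i _.
rewrite /message_tree /next_quantizer /= !weighted_odds_rcons//.
have p b : mp (stg s) j b != 0 by exact/lt0r_neq0/stage_message_prob_gt0.
have e (q a t : R) : q != 0 -> q * (a * (t / q)) = a * t by move=> q0; field.
rewrite (e _ _ _ (p true)) (e _ _ _ (p false)) -mulrDr.
by rewrite (message_probN _ (stage_quantizer_measurable lambda (stg s))) addrC subrK mulr1.
Qed.

Lemma decision_prob_delta_I_le m : decision_prob deltaI tree (wrong j) m [::] <=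
  c * \sum_(i | O i) W i / W j * (prior i / prior j).
Proof.
pose H s := c * \sum_(i | O i) y s i.
have H0 s : 0 <= H s.
  by rewrite mulr_ge0 ?sumr_ge0 ?(ltW c_gt0)// => i _; exact/ltW/weighted_odds_gt0.
have HE : H [::] = c * \sum_(i | O i) W i / W j * (prior i / prior j).
  by rewrite /H; under eq_bigr do rewrite /weighted_odds /odds two_stage_state_nil.
rewrite -HE; apply: decision_prob_supersolution => //.
- exact: tree_prob_message_tree.
- move=> s _; split => [b|]; first exact: H0.
  have := sum_weighted_odds_martingale s; rewrite /step /H => e.
  by rewrite ![_ * (c * _)]mulrCA -mulrDr e.
- move=> s st dec; rewrite /H -[leLHS](mulfV (lt0r_neq0 c_gt0)) ler_pM2l//.
  exact: weighted_odds_wrong.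
Qed.

End wrong_decision.

Lemma near_forall_hyp (I : Type) (F : set_system I) (FF : Filter F) (Q : I -> hyp -> Prop) :
  (forall j, \forall c \near F, Q c j) -> \forall c \near F, forall j, Q c j.
Proof.
by move=> h; apply: filterS3 (h Hf) (h Hg1) (h Hg2) => c h1 h2 h3; case.
Qed.

(** * The upper bound as [c] tends to 0 *)

Section upper_asymptotics.
Context {R : realType} (d : measure_display) (T : measurableType d).
Variables (P : hyp -> probability T R) (X : nat -> {mfun T >-> R}).
Hypothesis hX : forall j : hyp, iid_normal (P j) X (mean j).
Variables (prior W : hyp -> R).
Hypotheses (prior_gt0 : forall j, 0 < prior j) (prior_sum : \sum_j prior j = 1).
Hypothesis W_gt0 : forall j, 0 < W j.
Variables (lambda : R) (u : R -> R).
Hypothesis u_range : forall c, 0 < c -> 0 < u c /\ u c < 1 / 2.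
Hypothesis u_cvg : u c @[c --> 0^'+] --> 0.
Hypothesis u_log : ln (u c) / ln c @[c --> 0^'+] --> 0.

Local Notation deltaI c := (delta_I prior W lambda (u c) c).
Local Notation EN c j := (\int[P j]_t sample_size X (deltaI c) t)%E.

Local Opaque message_prob two_stage_state I_f kl_g info.

Lemma near_u_le (e : R) : 0 < e -> \forall c \near 0^'+, u c <= e.
Proof.
move=> e0; move/cvgr0Pnorm_lt : u_cvg => /(_ e e0).
apply: filterS => c h; apply: le_trans (ler_norm _) (ltW h).
Qed.

Lemma near_log_u_le (e : R) : 0 < e -> \forall c \near 0^'+, - ln (u c) <= e * - ln c.
Proof.
move=> e0; move/cvgr0Pnorm_lt : u_log => /(_ e e0) h.
near=> c.
have [c0 c1 _] : [/\ 0 < c, c < 1 & 0 <= - ln c] by near: c; exact: near_ln_ge.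
have lc : ln c < 0 by rewrite ln_lt0// c0.
have /ltW : `|ln (u c) / ln c| < e by near: c.
rewrite normrM normfV (ltr0_norm lc) ler_pdivrMr ?oppr_gt0//; apply: le_trans.
by rewrite -normrN ler_norm.
Unshelve. all: end_near. Qed.

Lemma prior_lt1 j : prior j < 1.
Proof.
have p1 := prior_gt0 Hf; have p2 := prior_gt0 Hg1; have p3 := prior_gt0 Hg2.
by move: prior_sum; rewrite sum_hyp; case: j => ?; lra.
Qed.

Lemma near_prior_le : \forall c \near 0^'+, forall j, prior j <= 1 - u c.
Proof.
have [k k0 hk] := @exists_positive_lower_bound R hyp (fun j => 1 - prior j)
  (fun j => ltac:(rewrite subr_gt0; exact: prior_lt1)).
apply: filterS (near_u_le k0) => c uc j.
by have := hk j; lra.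
Qed.

Lemma exists_drift_exponent (kapc : R) j : kapc < decisive_info lambda j ->
  exists t : R * R * R, let: (theta, C, kap) := t in
  [/\ 0 < theta, 0 < C, 0 < kap &
   [/\ forall st i b, `|ln (message_prob (stage_quantizer lambda st) i b /
                          message_prob (stage_quantizer lambda st) j b)| <= C,
     forall st i, i != j -> ratio_moment lambda theta st j i <= 1 - theta * kap &
     forall i, opponents j i -> ratio_moment lambda theta (Some j) j i <= 1 - theta * kapc]].
Proof.
move=> hk; have [C C0 hC] := log_ratio_bounded lambda.
have [kap kap0 hkap] := info_lower_bound lambda.
pose g := Num.min (kap / 2) (decisive_info lambda j - kapc).
have g0 : 0 < g by rewrite lt_min divr_gt0 ?subr_gt0.
(* The first bound makes the quadratic estimate of the exponential valid; the second keeps the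
   second-order loss below both the margin under [decisive_info] and half of the crude
   information. *)
pose theta := Num.min (1 / 2 / C) (g / (2 * (C * C))).
have CC : 0 < 2 * (C * C) by rewrite !mulr_gt0.
have t0 : 0 < theta by rewrite lt_min !divr_gt0.
have tC : theta * C <= 1 / 2 by rewrite -ler_pdivlMr// ge_min lexx.
have tg : 2 * (theta * (C * C)) <= g.
  by rewrite mulrCA -ler_pdivlMr// ge_min lexx orbT.
have g1 : g <= kap / 2 by rewrite ge_min lexx.
have g2 : g <= decisive_info lambda j - kapc by rewrite ge_min lexx orbT.
exists (theta, C, kap / 2); split => //; first by rewrite divr_gt0.
split => [st i b|st i ij|i ji].
- exact: hC.
- apply: (ratio_moment_le t0 tC) => [b|]; first exact: hC.
  by have := hkap st j i ij; move: tg g1; move: (2 * _) (info _ _ _) => a b *; lra.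
- apply: (ratio_moment_le t0 tC) => [b|]; first exact: hC.
  rewrite info_opponent//; move: tg g2; move: (2 * _) (decisive_info _ _) => a b *; lra.
Qed.

Lemma expected_size_delta_I j (eps : R) : 0 < eps ->
  \forall c \near 0^'+, (EN c j <= ((1 + eps) / decisive_info lambda j * - ln c)%:E)%E.
Proof.
move=> eps0; set I := decisive_info lambda j.
have I0 : 0 < I by exact: decisive_info_gt0.
pose kapc := I / (1 + eps / 2).
have k1 : 0 < 1 + eps / 2 by rewrite addr_gt0// divr_gt0.
have kapc0 : 0 < kapc by rewrite divr_gt0.
have kapcI : kapc < I by rewrite ltr_pdivrMr// ltr_pMr// ltrDl divr_gt0.
have [[[theta C] kap] [t0 C0 kap0 [hC hk hkc]]] := exists_drift_exponent kapcI.
have [Wm Wm0 hWm] := exists_upper_bound (fun i => W i / W j).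
pose n : R := ln #|{: hyp}|%:R.
pose A := log_power_sum theta (predC1 j) (fun i => prior i / prior j).
pose D := theta^-1 * ln (1 + power_sum theta (opponents j)
  (fun i => W i / W j * (prior i / prior j))).
pose X0 := \sum_(i | i != j) prior i / prior j.
have X00 : 0 <= X0 by apply: sumr_ge0 => i _; rewrite divr_ge0// ltW.
(* The main term uses [1 + eps / 2]. The other [eps / 2] is shared equally by the first-stage
   duration, the constant terms and wrong preliminary decisions. *)
pose e := eps / 2 / I / 3.
have e0 : 0 < e by rewrite !divr_gt0.
have B0 : 0 < 8 / kap * X0 + 1 by rewrite ltr_wpDl// mulr_ge0// divr_ge0// ltW.
pose M := Num.max (1 : R) (Num.max (ln Wm + theta^-1 * n + (n + C))
  (((A + (n + C)) / kap + (n + C + D) / kapc) / e)).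
near=> c.
have [c0 c1] : [/\ 0 < c, c < 1 & M <= - ln c] by near: c; exact: near_ln_ge.
rewrite !ge_max => /and3P[L1 LK Le].
have [u0 u1] := u_range c0.
have uB : u c <= e / (8 / kap * X0 + 1) by near: c; apply: near_u_le; rewrite divr_gt0.
have Lu1 : - ln (u c) <= 1 * - ln c by near: c; exact: near_log_u_le.
have Lu2 : - ln (u c) <= e * kap * - ln c.
  by near: c; apply: near_log_u_le; rewrite mulr_gt0.
have hprior : forall j, prior j <= 1 - u c by near: c; exact: near_prior_le.
rewrite mul1r in Lu1.
apply: (expected_size_le hX) => m.
apply: le_trans (cost_delta_I_le prior_gt0 prior_sum W_gt0 t0 C0 kap0 kapc0 hC hk hkc hWm
  c0 u0 (ltW u1) hprior L1 Lu1 LK m) _.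
rewrite -/n -/A -/D -/X0.
have L0 : 0 < - ln c by exact: lt_le_trans ltr01 L1.
move: Le; rewrite ler_pdivrMr// => Le.
have Lk : - ln (u c) / kap <= e * - ln c by rewrite ler_pdivrMr// mulrAC.
have uB' : 8 / kap * (u c * - ln c) * X0 <= e * - ln c.
  rewrite mulrA mulrAC ler_pM2r// mulrAC.
  move: uB; rewrite ler_pdivlMr// => uB; apply: le_trans uB.
  by rewrite [8 / kap * X0 * _]mulrC ler_pM2l// lerDl.
have -> : (1 + eps) / I * - ln c = - ln c / kapc + 3 * (e * - ln c).
  have := lt0r_neq0 I0 => I1; rewrite /e /kapc; field; rewrite I1 /=.
  by apply: lt0r_neq0; rewrite addr_gt0.
move: Le Lk uB'; rewrite !mulrDl.
move: (_ / kap) (_ / kapc) => *; lra.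
Unshelve. all: end_near. Qed.

Lemma risk_upper_asymptotic (eps : R) : 0 < eps ->
  \forall c \near 0^'+, (risk P X prior W c (deltaI c) <= ((1 + eps) *
    (c * - ln c * (prior Hf / I_f + (prior Hg1 + prior Hg2) / kl_g lambda)))%:E)%E.
Proof.
move=> eps0; set K := prior Hf / I_f + _.
have K0 : 0 < K.
  apply: addr_gt0; apply: divr_gt0 => //; [exact: I_f_gt0|exact: addr_gt0|exact: kl_g_gt0].
pose err j := \sum_(i | opponents j i) W i / W j * (prior i / prior j).
(* A bound on the contribution of the errors to the risk, divided by [c]: a constant, hence
   negligible against [- ln c]. *)
pose E := prior Hf * (W Hf * err Hf) + prior Hg1 * (W Hg1 * err Hg1)
  + prior Hg2 * (W Hg2 * err Hg2).
have e2 : 0 < eps / 2 by rewrite divr_gt0.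
near=> c.
have [c0 c1 LE] : [/\ 0 < c, c < 1 & E / (eps / 2 * K) <= - ln c] by near: c; exact: near_ln_ge.
have hEN : forall j, (EN c j <= ((1 + eps / 2) / decisive_info lambda j * - ln c)%:E)%E.
  by near: c; apply: near_forall_hyp => j; exact: (expected_size_delta_I j e2).
have [n hn] : exists n : hyp -> R, forall j, EN c j = (n j)%:E.
  exists (fun j => fine (EN c j)) => j; rewrite fineK// ge0_fin_numE.
    exact: le_lt_trans (hEN j) (ltry _).
  by apply: integral_ge0 => t _; rewrite /sample_size; case: (stop _ _).
have nle j : n j <= (1 + eps / 2) / decisive_info lambda j * - ln c.
  by rewrite -lee_fin -hn.
have ele j : error P X (deltaI c) j <= c * err j.
  rewrite -lee_fin -(errorE hX (deltaI c) j); apply: (decision_event_le hX) => m.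
  exact: decision_prob_delta_I_le.
have term j : prior j * (c * n j + W j * error P X (deltaI c) j) <=
    c * (prior j * ((1 + eps / 2) / decisive_info lambda j * - ln c) + prior j * (W j * err j)).
  rewrite -mulrDr mulrCA ler_pM2l// mulrDr lerD ?ler_pM2l//.
  by rewrite mulrCA ler_pM2l.
rewrite (risk_fin hX prior W c hn) lee_fin.
apply: le_trans (lerD (lerD (term Hf) (term Hg1)) (term Hg2)) _.
have dist (a b e : R) : c * a + c * b + c * e = c * (a + b + e) by rewrite !mulrDr.
rewrite dist [decisive_info _ Hf]/decisive_info [decisive_info _ Hg1]/decisive_info.
rewrite [decisive_info _ Hg2]/decisive_info.
have EK : E <= eps / 2 * K * - ln c by rewrite mulrC -ler_pdivrMr// mulr_gt0.
have -> : (1 + eps) * (c * - ln c * K) = c * ((1 + eps / 2) * K * - ln c + eps / 2 * K * - ln c).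
  by field.
rewrite ler_pM2l//; apply: le_trans (_ : (1 + eps / 2) * K * - ln c + E <= _); last by rewrite lerD2l.
rewrite /K /E le_eqVlt; apply/orP; left; apply/eqP.
have I1 := lt0r_neq0 (@I_f_gt0 R); have I2 := lt0r_neq0 (kl_g_gt0 lambda).
move: (I_f) (kl_g _) I1 I2 => a b a0 b0.
by field; rewrite a0 b0.
Unshelve. all: end_near. Qed.

End upper_asymptotics.

(** * Asymptotic optimality *)

Lemma risk_expansion_of_bounds (R : realType) (r : R -> \bar R) (K : R) : 0 < K ->
  (forall eps, 0 < eps -> \forall c \near 0^'+,
    (((1 - eps) * (c * - ln c * K))%:E <= r c)%E) ->
  (forall eps, 0 < eps -> \forall c \near 0^'+,
    (r c <= ((1 + eps) * (c * - ln c * K))%:E)%E) ->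
  risk_expansion r K.
Proof.
move=> K0 lo up.
(* The error term is defined through [fine], which is faithful only where the risk is finite. *)
have fin : \forall c \near 0^'+, exists x, r c = x%:E.
  near=> c.
  have : (((1 - 1) * (c * - ln c * K))%:E <= r c)%E by near: c; exact: lo.
  have : (r c <= ((1 + 1) * (c * - ln c * K))%:E)%E by near: c; exact: up.
  by case: (r c) => [x| |]// _ _; exists x.
exists (fun c => fine (r c) / (c * - ln c * K) - 1).
  apply/cvgr0Pnorm_le => e e0; near=> c.
  have [c0 c1 L1] : [/\ 0 < c, c < 1 & 1 <= - ln c] by near: c; exact: near_ln_ge.
  have q0 : 0 < c * - ln c * K by rewrite !mulr_gt0// (lt_le_trans ltr01).
  have : (((1 - e) * (c * - ln c * K))%:E <= r c)%E by near: c; exact: lo.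
  have : (r c <= ((1 + e) * (c * - ln c * K))%:E)%E by near: c; exact: up.
  have [x ->] : exists x, r c = x%:E by near: c.
  rewrite !lee_fin /= => h1 h2; rewrite -ler_pdivrMr// in h1; rewrite -ler_pdivlMr// in h2.
  by rewrite ler_norml lerBrDr addrC h2 lerBlDr addrC h1.
near=> c.
have [c0 c1 L1] : [/\ 0 < c, c < 1 & 1 <= - ln c] by near: c; exact: near_ln_ge.
have q0 : 0 < c * - ln c * K by rewrite !mulr_gt0// (lt_le_trans ltr01).
have [x ->] : exists x, r c = x%:E by near: c.
rewrite /= ler0_norm; last by rewrite -oppr_ge0 (le_trans ler01).
by rewrite addrC subrK [in RHS]mulrAC mulrC mulfVK// gt_eqF.
Unshelve. all: end_near. Qed.

Lemma risk_expansion_ratio (R : realType) (r s : R -> \bar R) (K : R) : 0 < K ->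
  risk_expansion r K -> risk_expansion s K -> (r c / s c)%E @[c --> 0^'+] --> 1%E.
Proof.
move=> K0 [a1 a1c r1] [a2 a2c s2].
have lim : (1 + a1 c) / (1 + a2 c) @[c --> 0^'+] --> (1 : R).
  have h (f : R -> R) : f c @[c --> 0^'+] --> 0 -> 1 + f c @[c --> 0^'+] --> (1 : R).
    by move=> f0; rewrite -[X in _ --> X]addr0; apply: cvgD => //; exact: cvg_cst.
  rewrite -[X in _ --> X](divr1 1); apply: cvgM; first exact: h.
  by apply: cvgV; [exact: oner_neq0|exact: h].
have : ((1 + a1 c) / (1 + a2 c))%:E @[c --> 0^'+] --> 1%E by apply: cvg_EFin; [exact: nearW|exact: lim].
apply: cvg_trans; apply: near_eq_cvg; near=> c.
have [c0 c1 L1] : [/\ 0 < c, c < 1 & 1 <= - ln c] by near: c; exact: near_ln_ge.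
have q0 : 0 < c * `|ln c| by rewrite mulr_gt0// normr_gt0; apply/eqP => l0; move: L1; rewrite l0 oppr0 ler10.
have a20 : 0 < 1 + a2 c.
  have : `|a2 c| < 1 by near: c; move/cvgr0Pnorm_lt : a2c; apply.
  by rewrite ltr_norml => /andP[h _]; rewrite -ltrBlDl sub0r.
have -> : r c = (c * `|ln c| * (1 + a1 c) * K)%:E by near: c.
have -> : s c = (c * `|ln c| * (1 + a2 c) * K)%:E by near: c.
have d0 : c * `|ln c| * (1 + a2 c) * K != 0 by rewrite lt0r_neq0// mulr_gt0// mulr_gt0.
rewrite inver (negbTE d0) -EFinM; congr EFin.
have := lt0r_neq0 q0; have := lt0r_neq0 a20; have := lt0r_neq0 K0.
move: (c * `|ln c|) => q k0 e0 q0'; by field; rewrite k0 e0 q0'.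
Unshelve. all: end_near. Qed.

Theorem corollary1 (R : realType) (d : measure_display) (T : measurableType d)
    (P : hyp -> probability T R) (X : nat -> {mfun T >-> R})
    (hX : forall j : hyp, iid_normal (P j) X (mean j))
    (prior W : hyp -> R)
    (prior_gt0 : forall j : hyp, 0 < prior j)
    (prior_sum : \sum_(j : hyp) prior j = 1)
    (W_gt0 : forall j : hyp, 0 < W j)
    (lambda : R)
    (lambda_max : forall l : R, kl_g l <= kl_g lambda)
    (u : R -> R)
    (u_range : forall c : R, 0 < c -> 0 < u c /\ u c < 1 / 2)
    (u_cvg : u c @[c --> 0^'+] --> 0)
    (u_log : ln (u c) / ln c @[c --> 0^'+] --> 0) :
  let deltaI (c : R) := delta_I prior W lambda (u c) c in
  let K := prior Hf / I_f + (prior Hg1 + prior Hg2) / I_g in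
  risk_expansion (fun c => risk P X prior W c (deltaI c)) K
  /\ forall deltaB : R -> dtest R,
      (forall c : R, 0 < c -> bayes_solution P X prior W c (deltaB c)) ->
      (risk P X prior W c (deltaB c) / risk P X prior W c (deltaI c))%E
        @[c --> 0^'+] --> 1%E
      /\ risk_expansion (fun c => risk P X prior W c (deltaB c)) K.

Proof.
move=> deltaI K.
have K0 : 0 < K.
  rewrite /K (I_gE lambda_max); apply: addr_gt0; apply: divr_gt0 => //.
  - exact: I_f_gt0.
  - exact: addr_gt0.
  - exact: kl_g_gt0.
have lower (delta : R -> dtest R) eps : 0 < eps -> \forall c \near 0^'+,
    (((1 - eps) * (c * - ln c * K))%:E <= risk P X prior W c (delta c))%E.
  move=> eps0; rewrite /K (I_gE lambda_max).
  by apply: filterS (risk_lower_asymptotic hX prior_gt0 W_gt0 lambda_max eps0) => c; exact.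
have upper eps : 0 < eps -> \forall c \near 0^'+,
    (risk P X prior W c (deltaI c) <= ((1 + eps) * (c * - ln c * K))%:E)%E.
  move=> eps0; rewrite /K (I_gE lambda_max).
  exact: risk_upper_asymptotic.
have expI := risk_expansion_of_bounds K0 (lower deltaI) upper.
split => // deltaB bayes.
have expB : risk_expansion (fun c => risk P X prior W c (deltaB c)) K.
  (* The Bayes solution inherits the lower bound valid for all tests, and its risk is at most that
     of [deltaI c]. *)
  apply: risk_expansion_of_bounds K0 (lower deltaB) _ => eps eps0.
  near=> c; apply: le_trans (bayes c _ (deltaI c)) _ => //.
  by near: c; exact: upper.
by split => //; exact: risk_expansion_ratio K0 expB expI.
Unshelve. all: end_near. Qed.
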